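(* Let $1<p<\infty$, $p'=p/(p-1)$, and $0<q\le1$. Then $$(\mathcal{B}^{p',q})^{\ast}\approx\mathcal{M}^{p,\infty}.$$
   Context: Fix $n\in\mathbb{N}$, $0<\alpha<\infty$, $1<s\le n/\alpha$. Let $G_\alpha=\mathcal{F}^{-1}[(1+|\cdot|^2)^{-\alpha/2}]$ be the Bessel kernel on $\mathbb{R}^n$. For $E\subseteq\mathbb{R}^n$ the Bessel capacity is $\mathcal{C}(E)=\inf\{\|f\|_{L^s(\mathbb{R}^n)}^s: f\ge 0,\ G_\alpha\ast f\ge 1\text{ on }E\}$. $\mathcal{M}(\mathbb{R}^n)$ is the set of extended real-valued Lebesgue measurable functions on $\mathbb{R}^n$ (identified a.e.). For $0<p,q<\infty$, $\|f\|_{L^{p,q}}=p^{1/q}\left(\int_0^\infty |\{|f|>t\}|^{q/p}t^q\frac{dt}{t}\right)^{1/q}$, and $\|f\|_{L^{p,\infty}}=\sup_{t>0}t|\{|f|>t\}|^{1/p}$. $\mathcal{M}^{p,\infty}$ is the set of $f\in\mathcal{M}(\mathbb{R}^n)$ with $\|f\|_{\mathcal{M}^{p,\infty}}=\sup_K\|f\chi_K\|_{L^{p,\infty}}/\mathcal{C}(K)^{1/p}<\infty$, supremum over all compact $K\subseteq\mathbb{R}^n$ with $\mathcal{C}(K)\ne0$. For $1<p<\infty$, $0<q\le1$: $b\in\mathcal{M}(\mathbb{R}^n)$ is a $\mathcal{B}^{p',q}$ block if there is a bounded set $E\subseteq\mathbb{R}^n$ with $\{b\ne0\}\subseteq E$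 and $\mathcal{C}(E)^{1/p}\|b\|_{L^{p',q}}\le1$. $\mathcal{B}^{p',q}$ is the set of $f\in\mathcal{M}(\mathbb{R}^n)$ with a decomposition $f=\sum_k\lambda_kb_k$ (countable sum, pointwise a.e. convergent), $\{\lambda_k\}\in\ell^1$, each $b_k$ a $\mathcal{B}^{p',q}$ block; $\|f\|_{\mathcal{B}^{p',q}}=\inf\sum_k|\lambda_k|$ over all such decompositions. $X^\ast$ is the space of continuous linear functionals on $X$, and $X^\ast\approx Y$ means: for every $\mathcal{L}\in X^\ast$ there is a unique $g\in Y$ with $\mathcal{L}(f)=\int_{\mathbb{R}^n}f g\,dx$ for all $f\in X$; conversely every $g\in Y$ defines by this formula an element of $X^\ast$; and there is a constant $c>0$ with $c^{-1}\|g\|_Y\le\|\mathcal{L}\|\le c\|g\|_Y$ for all such pairs. *)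

(* Defs.v *)
From HB Require Import structures.
From mathcomp Require Import all_boot all_order all_algebra.
From mathcomp Require Import all_classical all_reals all_analysis.
From mathcomp Require Import measurable_realfun complex.

Set Implicit Arguments.
Unset Strict Implicit.
Unset Printing Implicit Defensive.

Import Order.TTheory GRing.Theory Num.Theory.
Import numFieldNormedType.Exports.

Local Open Scope classical_set_scope.
Local Open Scope ring_scope.
Local Open Scope ereal_scope.

Definition rV_display : measure_display -> measure_display.
Proof. exact. Qed.

(* The product sigma-algebra on row vectors, i.e. the one generated by the
   coordinates (cf. the library's sigma-algebra on [n.-tuple T]); for the real
   line this is the Borel sigma-algebra of R^n. *)
Section measurable_rV.
Context {d} {T : measurableType d} (n : nat).

Definition rV_coord (i : 'I_n) (v : 'rV[T]_n) : T := v ord0 i.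

Let rV_set0 : g_sigma_preimage rV_coord set0.
Proof. exact: sigma_algebra0. Qed.

Let rV_setC A : g_sigma_preimage rV_coord A -> g_sigma_preimage rV_coord (~` A).
Proof. exact: sigma_algebraC. Qed.

Let rV_bigcup (F : _^nat) : (forall i, g_sigma_preimage rV_coord (F i)) ->
  g_sigma_preimage rV_coord (\bigcup_i (F i)).
Proof. exact: sigma_algebra_bigcup. Qed.

HB.instance Definition _ := @isMeasurable.Build (rV_display d)
  'rV[T]_n (g_sigma_preimage rV_coord) rV_set0 rV_setC rV_bigcup.

End measurable_rV.

Lemma measurable_rV_coord d (T : measurableType d) n (i : 'I_n) :
  measurable_fun [set: 'rV[T]_n] (rV_coord i).
Proof.
move=> _ Y mY; rewrite setTI; apply: sub_sigma_algebra => /=.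
rewrite -bigcup_seq/=; exists i => /=; first by rewrite mem_index_enum.
by exists Y => //; rewrite setTI.
Qed.

Lemma measurable_fun_rVP d d' (T : measurableType d) (X : measurableType d') n
    (f : X -> 'rV[T]_n) :
  (forall i, measurable_fun [set: X] (rV_coord i \o f)) ->
  measurable_fun [set: X] f.
Proof.
move=> mf.
have sub : g_sigma_preimage (fun i : 'I_n => rV_coord i \o f) `<=` measurable.
  apply: smallest_sub; first exact: sigma_algebra_measurable.
  case: n => [|n] in f mf *; first by rewrite big_ord0.
  rewrite -bigcup_mkord_ord; apply: bigcup_sub => i Ii.
  by move=> A [B mB <-]; exact: mf.
rewrite g_sigma_preimage_comp in sub.
by move=> _ A mA; apply: sub; exists A.
Qed.

Section rV_cons.
Context d (T : measurableType d) (n : nat).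

Definition rV_cons (z : T * 'rV[T]_n) : 'rV[T]_n.+1 :=
  \row_i oapp (z.2 ord0) z.1 (unlift ord0 i).

Definition rV_uncons (v : 'rV[T]_n.+1) : T * 'rV[T]_n :=
  (v ord0 ord0, \row_i v ord0 (lift ord0 i)).

Lemma rV_uncons_consK : cancel rV_cons rV_uncons.
Proof.
case=> a v; congr pair; first by rewrite mxE unlift_none.
by apply/rowP => i; rewrite !mxE liftK.
Qed.

Lemma measurable_rV_cons : measurable_fun setT rV_cons.
Proof.
apply: measurable_fun_rVP => i.
have [j ->|->] := unliftP ord0 i.
  rewrite (_ : _ \o _ = rV_coord j \o snd).
    by apply: measurableT_comp => //; exact: measurable_rV_coord.
  by apply/funext => z; rewrite /rV_coord/= mxE liftK.
rewrite (_ : _ \o _ = fst)//.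
by apply/funext => z; rewrite /rV_coord/= mxE unlift_none.
Qed.

Lemma measurable_rV_uncons : measurable_fun setT rV_uncons.
Proof.
apply/measurable_fun_pairP; split; first exact: (measurable_rV_coord ord0).
apply: measurable_fun_rVP => i.
rewrite (_ : _ \o _ = rV_coord (lift ord0 i)); first exact: measurable_rV_coord.
by apply/funext => v; rewrite /rV_coord/= mxE.
Qed.

Variables (R : realType) (m1 : {sigma_finite_measure set T -> \bar R})
  (m : {sigma_finite_measure set 'rV[T]_n -> \bar R}).

Definition rV_cons_measure : set 'rV[T]_n.+1 -> \bar R :=
  pushforward (m1 \x m) rV_cons.

Let rV_cons_measure0 : rV_cons_measure set0 = 0.
Proof. by rewrite /rV_cons_measure /pushforward preimage_set0 measure0. Qed.

Let rV_cons_measure_ge0 A : 0 <= rV_cons_measure A.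
Proof. exact: (measure_ge0 (m1 \x m)). Qed.

Let rV_cons_measure_sigma_additive : semi_sigma_additive rV_cons_measure.
Proof.
have mc A : measurable A -> measurable (rV_cons @^-1` A).
  by move=> mA; rewrite -[X in measurable X]setTI; exact: measurable_rV_cons.
move=> F mF tF mUF; rewrite /rV_cons_measure /pushforward preimage_bigcup.
apply: (@measure_semi_sigma_additive _ _ _ (m1 \x m)).
- by move=> i; exact: mc.
- apply/trivIsetP => /= i j _ _ ij; rewrite -preimage_setI.
  by move/trivIsetP : tF => /(_ _ _ _ _ ij) ->//; rewrite preimage_set0.
- by rewrite -preimage_bigcup; exact: mc.
Qed.

HB.instance Definition _ := isMeasure.Build _ _ _ rV_cons_measure
  rV_cons_measure0 rV_cons_measure_ge0 rV_cons_measure_sigma_additive.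

Let rV_cons_measure_sigma_finite : sigma_finite setT rV_cons_measure.
Proof.
have /sigma_finiteP[F [TF ndF Foo]] := sigma_finiteT m1.
have /sigma_finiteP[G [TG ndG Goo]] := sigma_finiteT m.
have FG : [set: (T * 'rV[T]_n)%type] = \bigcup_k (F k `*` G k).
  rewrite -setXTT TF TG predeqE => -[x y]; split.
    move=> [/= [i _ Fix] [k _ Gky]]; exists (maxn i k) => //; split.
    - by move: x Fix; exact/subsetPset/ndF/leq_maxl.
    - by move: y Gky; exact/subsetPset/ndG/leq_maxr.
  by move=> [k _ []/= ? ?]; split; exists k.
exists (fun k => rV_uncons @^-1` (F k `*` G k)).
  by rewrite -preimage_bigcup -FG preimage_setT.
move=> k; have [mF Fk] := Foo k; have [mG Gk] := Goo k; split.
  rewrite -[X in measurable X]setTI; apply: measurable_rV_uncons => //.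
  exact: measurableX.
rewrite /rV_cons_measure /pushforward -comp_preimage.
rewrite (_ : _ \o _ = id) ?preimage_id.
  by rewrite product_measure1E// lte_mul_pinfty// ge0_fin_numE.
by apply/funext => z; exact: rV_uncons_consK.
Qed.

HB.instance Definition _ := Measure_isSigmaFinite.Build _ _ _ rV_cons_measure
  rV_cons_measure_sigma_finite.

End rV_cons.

Fixpoint borel_lebesgue_rV (R : realType) (n : nat) :
    {sigma_finite_measure set 'rV[measurableTypeR R]_n -> \bar R} :=
  match n with
  | 0 => @dirac _ 'rV[measurableTypeR R]_0 (\row_i 0%R) R
  | n'.+1 => rV_cons_measure (@lebesgue_measure R) (borel_lebesgue_rV R n')
  end.

(* R^n with its sigma-algebra of Lebesgue measurable sets (completion of the
   Borel sigma-algebra), and the complete Lebesgue measure on it. *)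
Definition leb_space (R : realType) (n : nat) :=
  caratheodory_type ((borel_lebesgue_rV R n)^*)%mu.

Definition leb (R : realType) (n : nat) : set (leb_space R n) -> \bar R :=
  @completed_measure_extension _ _ _ (borel_lebesgue_rV R n).

Arguments leb : clear implicits.

HB.instance Definition _ (R : realType) (n : nat) := Measure.on (leb R n).

(* Functions are extended real-valued representatives: the class M(R^n) is
   obtained by identifying those that agree [leb R n]-almost everywhere. *)
Definition leb_measurable (R : realType) (n : nat) (f : 'rV[R]_n -> \bar R) :=
  measurable_fun [set: leb_space R n] (f : leb_space R n -> \bar R).

Section Bessel_capacity.
Context {R : realType} {n : nat}.

Definition dotp (x y : 'rV[R]_n) : R := (\sum_(i < n) x ord0 i * y ord0 i)%R.

(* Fourier transform of an integrable function, with the normalization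
   F[f](xi) = int f(x) exp(-i x.xi) dx, i.e. the one for which the inverse
   transform of (1 + |xi|^2)^(-alpha/2) is the Bessel kernel of total mass 1. *)
Definition fourier (f : 'rV[R]_n -> \bar R) (xi : 'rV[R]_n) : R[i] :=
  Complex (fine (\int[leb R n]_x (f x * (cos (dotp x xi))%:E)))
          (- fine (\int[leb R n]_x (f x * (sin (dotp x xi))%:E)))%R.

(* G represents F^{-1}[(1 + |.|^2)^(-alpha/2)]. The symbol need not be
   integrable, so F^{-1} is the inverse of F on L^1 rather than an integral:
   G is the L^1 function, unique up to a null set, whose Fourier transform is
   the symbol. Only the class of G matters in convolutions. *)
Definition is_Bessel_kernel (alpha : R) (G : 'rV[R]_n -> \bar R) :=
  (leb R n).-integrable [set: leb_space R n] G /\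
  forall xi, fourier G xi = ((1 + dotp xi xi) `^ (- alpha / 2))%R%:C%C.

Definition convolution (G f : 'rV[R]_n -> \bar R) (x : 'rV[R]_n) : \bar R :=
  \int[leb R n]_y (G (x - y)%R * f y).

Definition capacity (G : 'rV[R]_n -> \bar R) (s : R) (E : set 'rV[R]_n) :
    \bar R :=
  ereal_inf [set ('N[leb R n]_(s%:E)[f]) `^ s | f in
    [set f : 'rV[R]_n -> \bar R | [/\ leb_measurable f, (forall x, 0 <= f x) &
      forall x, E x -> 1 <= convolution G f x]]].

End Bessel_capacity.

Section spaces.
Context {R : realType} {n : nat}.
Implicit Types (f g b : 'rV[R]_n -> \bar R) (p q : R).

Definition distribution_function f (t : R) : \bar R :=
  leb R n [set x | t%:E < `|f x|].

Definition Lorentz_norm p q f : \bar R :=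
  (p `^ q^-1)%R%:E *
  (\int[lebesgue_measure]_(t in `]0%R, +oo[)
    ((distribution_function f t) `^ (q / p) * (t `^ q / t)%R%:E)) `^ q^-1.

Definition weak_norm p f : \bar R :=
  ereal_sup [set t%:E * (distribution_function f t) `^ p^-1 |
    t in [set t : R | (0 < t)%R]].

(* [cap] stands for the capacity of the ambient Bessel kernel. *)
Variable cap : set 'rV[R]_n -> \bar R.

Definition M_norm p f : \bar R :=
  ereal_sup [set weak_norm p (fun x => f x * (\1_K x)%:E) / (cap K) `^ p^-1 |
    K in [set K : set 'rV[R]_n | compact K /\ cap K != 0]].

Definition M_space p : set ('rV[R]_n -> \bar R) :=
  [set f | leb_measurable f /\ M_norm p f < +oo].

(* A block is given by the exponents p (of the capacity) and p' (of the
   Lorentz space). *)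
Definition is_block p p' q b :=
  leb_measurable b /\
  exists E : set 'rV[R]_n, [/\ bounded_set E, [set x | b x != 0] `<=` E &
    (cap E) `^ p^-1 * Lorentz_norm p' q b <= 1].

Definition block_decomposition p p' q f (lambda : R^nat)
    (bs : ('rV[R]_n -> \bar R)^nat) :=
  [/\ \sum_(k <oo) `|lambda k|%:E < +oo,
      (forall k, is_block p p' q (bs k)) &
      \forall x \ae leb R n,
        (fun N => \sum_(k < N) (lambda k)%:E * bs k x) @ \oo --> f x].

Definition B_space p p' q : set ('rV[R]_n -> \bar R) :=
  [set f | leb_measurable f /\
    exists lambda bs, block_decomposition p p' q f lambda bs].

Definition B_norm p p' q f : \bar R :=
  ereal_inf [set \sum_(k <oo) `|lambda k|%:E | lambda in
    [set lambda : R^nat | exists bs, block_decomposition p p' q f lambda bs]].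

End spaces.

Section duality.
Context {R : realType} {n : nat}.
Notation fct := ('rV[R]_n -> \bar R).
Variables (X : set fct) (normX : fct -> \bar R).

(* Continuous linear functionals on the space of classes of functions of X.
   A functional is represented by a map on functions that respects equality
   almost everywhere on X; its values outside X are irrelevant. *)
Definition continuous_linear_functional (L : fct -> R) :=
  [/\ (forall f g, X f -> X g -> f = g %[ae leb R n] -> L f = L g),
      (forall (a : R) f g, X f -> X g ->
        L (fun x => a%:E * f x + g x) = (a * L f + L g)%R) &
      (forall f, X f -> forall e : R, (0 < e)%R -> exists2 d : R, (0 < d)%R &
        forall g, X g -> normX (fun x => g x - f x) < d%:E ->
          (`|L g - L f| < e)%R)].

Definition functional_norm (L : fct -> R) : \bar R :=
  ereal_sup [set `|L f|%:E | f in [set f | X f /\ normX f <= 1]].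

Definition represents (L : fct -> R) (g : fct) :=
  forall f, X f ->
    (leb R n).-integrable [set: leb_space R n] (fun x => f x * g x) /\
    (L f)%:E = \int[leb R n]_x (f x * g x).

Definition dual_identified_with (Y : set fct) (normY : fct -> \bar R) :=
  [/\ (forall L, continuous_linear_functional L ->
         exists g, [/\ Y g, represents L g &
           forall g', Y g' -> represents L g' -> g' = g %[ae leb R n]]),
      (forall g, Y g ->
         exists2 L, continuous_linear_functional L & represents L g) &
      exists2 c : R, (0 < c)%R &
        forall L g, continuous_linear_functional L -> Y g -> represents L g ->
          c^-1%:E * normY g <= functional_norm L /\
          functional_norm L <= c%:E * normY g].

End duality.

(* Main.v *)
(** A weak-type Hoelder inequality pairs a block b supported in E with g: on
    {|b| > t}, a subset of E, the norm of g bounds the integral of |g| by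
    p' ||g|| cap(E)^(1/p) |{|b| > t}|^(1/p'), and the layer-cake formula together
    with q <= 1 turns this into the Lorentz norm of b; summing over blocks gives
    int |f g| <= p' ||f|| ||g||.

    Conversely, a continuous functional L is controlled by the Lorentz norm on the
    functions supported in a fixed bounded set, so A |-> L(1_A) is countably additive
    and absolutely continuous there.  Its Radon-Nikodym densities on an exhausting
    sequence of boxes glue to a function g, and testing L on the indicators of
    K /\ {g > t} and K /\ {g < -t} gives the weak-type bound for g.  A functional
    that vanishes on indicators vanishes on bounded functions, then on blocks by
    truncation, then on all of B^{p',q} because the tails of a block decomposition
    are small; so L is the pairing with g.

    Of the capacity one only needs monotonicity, finiteness on bounded sets, and
    |E| <= C cap(E). *)
From HB Require Import structures.
Require Import Defs.
From mathcomp Require Import all_boot all_order all_algebra.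
From mathcomp Require Import all_classical all_reals all_analysis.
From mathcomp Require Import measurable_realfun ring lra.

Set Implicit Arguments.
Unset Strict Implicit.
Unset Printing Implicit Defensive.

Import Order.TTheory GRing.Theory Num.Theory.
Import numFieldNormedType.Exports.

Local Open Scope classical_set_scope.
Local Open Scope ring_scope.
Local Open Scope ereal_scope.

(** * Lebesgue measure on R^n *)

(** The supremum in the M-norm runs over compact sets, while the support of a block is only a
    bounded measurable set, so inner regularity of the completed Lebesgue measure is needed before
    the two can be paired. All functions are extended real-valued, and pointwise sums and products
    are linear only where the values are finite; the estimate |E| <= C cap(E) provides this, because
    it bounds the M-norm of the constant 1 and so puts B^{p',q} inside L^1. The same estimate makes
    a set of capacity zero a null set, which settles the blocks supported there and the compact sets
    that the supremum leaves out. For q < 1 the Lorentz functional is only a quasi-norm; hence a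
    functional is estimated on one block at a time, and the bound for L is stated in terms of the
    cost of a given decomposition. *)

Definition rV_borel (R : realType) (n : nat) : set (set 'rV[R]_n) :=
  @measurable _ 'rV[measurableTypeR R]_n.

(** The two sigma-algebras live on convertible types; [rV_borel] and [rV_leb] record which of them
    is meant for a set of row vectors. *)
Definition rV_leb (R : realType) (n : nat) : set (set 'rV[R]_n) :=
  @measurable _ (leb_space R n).

Section completion.
Context {R : realType} {n : nat}.
Local Notation lam := (borel_lebesgue_rV R n).
Local Notation mu := (leb R n).
Implicit Types A B : set 'rV[R]_n.

Lemma rV_borel_leb A : rV_borel A -> rV_leb A.
Proof. exact: (@caratheodory_measurable_mu_ext _ _ _ lam). Qed.

Lemma leb_borelE A : rV_borel A -> mu A = lam A.
Proof. exact: (@measurable_mu_extE _ _ _ lam). Qed.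

(** [leb] is the outer measure, defined on all sets, so monotonicity holds for arbitrary sets. *)
Lemma le_leb A B : A `<=` B -> mu A <= mu B.
Proof. by move=> AB; exact: (@le_mu_ext _ _ _ lam). Qed.

Lemma leb_ge0 A : 0 <= mu A.
Proof. exact: mu_ext_ge0. Qed.

Lemma leb_sigma_finite : sigma_finite [set: leb_space R n] mu.
Proof.
exact/completed_measure_extension_sigma_finite/sigma_finiteT.
Qed.

HB.instance Definition _ := Measure_isSigmaFinite.Build _ _ _ (leb R n) leb_sigma_finite.

(** By definition of the outer measure, [A] has Borel covers of measure at most [mu A + 1/(k+1)];
    their intersection attains [mu A]. For a set of infinite measure the whole space is taken. *)
Lemma borel_hull A : exists O : set 'rV[R]_n,
  [/\ rV_borel O, A `<=` O & lam O = mu A].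
Proof.
have [Afin|] := boolP (mu A \is a fin_num); last first.
  rewrite ge0_fin_numE ?leb_ge0// -leNgt leye_eq => /eqP Aoo.
  exists setT; split=> //; first exact: (@measurableT _ 'rV[measurableTypeR R]_n).
  rewrite -leb_borelE; last exact: (@measurableT _ 'rV[measurableTypeR R]_n).
  by apply/eqP; rewrite Aoo -leye_eq -Aoo; exact: le_leb.
have H (k : nat) : exists O : set 'rV[R]_n,
    [/\ rV_borel O, A `<=` O & lam O <= mu A + (k.+1%:R^-1)%:E].
  have /(_ (k.+1%:R^-1)%R) := @lb_ereal_inf_adherent R
     [set \sum_(k <oo) lam (A k) | A in measurable_cover A].
  have k0 : (0 < k.+1%:R^-1 :> R)%R by rewrite invr_gt0.
  move=> /(_ k0 Afin)[_ [F [mF AF] <-]] lt.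
  exists (\bigcup_k F k); split=> //.
    exact: (@bigcupT_measurable _ 'rV[measurableTypeR R]_n).
  apply: le_trans (ltW lt).
  apply: (@measure_sigma_subadditive _ _ _ lam) => //.
  exact: (@bigcupT_measurable _ 'rV[measurableTypeR R]_n).
have [U UP] := choice H.
exists (\bigcap_k U k); split.
- by apply: (@bigcapT_measurable _ 'rV[measurableTypeR R]_n) => k; have [] := UP k.
- by move=> x Ax k _; have [_ + _] := UP k; exact.
- have mO : rV_borel (\bigcap_k U k).
    by apply: (@bigcapT_measurable _ 'rV[measurableTypeR R]_n) => k; have [] := UP k.
  apply/eqP; rewrite eq_le; apply/andP; split; last first.
    rewrite -leb_borelE//; apply: le_leb => x Ax k _.
    by have [_ + _] := UP k; exact.
  apply/lee_addgt0Pr => e e0.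
  have [k ke] : exists k : nat, (k.+1%:R^-1 < e)%R.
    have := near_infty_natSinv_lt (PosNum e0) => -[k _ /(_ k)]/=.
    by move=> /(_ (leqnn k)) ?; exists k.
  have [mOk _ h] := UP k.
  apply: le_trans (le_trans h _).
    by apply: le_measure; rewrite ?inE//; move=> x; exact.
  by rewrite leeD2l// lee_fin ltW.
Qed.

End completion.

(** Lebesgue measure on the line is determined by its values on the intervals []a, b]], and a
    reflection preserves lengths. *)
Lemma lebesgue_measure_reflect (R : realType) (c : R) (A : set R) :
  measurable A ->
  pushforward lebesgue_measure ((fun y => c - y)%R : _ -> measurableTypeR R) A =
  lebesgue_measure A.
Proof.
move=> mA.
have mr : measurable_fun [set: measurableTypeR R]
    ((fun y => c - y)%R : _ -> measurableTypeR R).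
  exact: (measurable_funB (measurable_cst _)).
pose r : {mfun measurableTypeR R >-> measurableTypeR R} :=
  HB.pack ((fun y => c - y)%R : measurableTypeR R -> measurableTypeR R)
    (isMeasurableFun.Build _ _ _ _ _ mr).
apply/esym.
apply: (@lebesgue_measure_unique _ (pushforward lebesgue_measure r)) => //= _ [[a b]] _ <-.
rewrite /pushforward/=.
rewrite (_ : _ @^-1` _ = `[(c - b)%R, (c - a)%R[%classic); last first.
  apply/seteqP; split => x /=; rewrite !in_itv/= => /andP[h1 h2]; apply/andP; split; lra.
by rewrite !lebesgue_measure_itv/= !lte_fin ltrD2l ltrN2; case: ifPn => // _;
  congr EFin; ring.
Qed.

Lemma measurable_rV_reflect (R : realType) n (c : 'rV[R]_n) :
  measurable_fun [set: 'rV[measurableTypeR R]_n]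
    ((fun v => c - v)%R : _ -> 'rV[measurableTypeR R]_n).
Proof.
apply: measurable_fun_rVP => i.
rewrite (_ : _ \o _ = (fun y => c ord0 i - y)%R \o rV_coord i).
  apply: measurableT_comp; last exact: measurable_rV_coord.
  exact: (measurable_funB (measurable_cst _)).
by apply/funext => v; rewrite /rV_coord/= !mxE.
Qed.

(** Reflections are the maps [y -> x - y] of a convolution, and two of them compose to a
    translation. By induction on the dimension: reflecting the first coordinate permutes the slices,
    and each slice is reflected in the remaining coordinates. *)
Lemma borel_lebesgue_reflect (R : realType) n (c : 'rV[R]_n) A : rV_borel A ->
  borel_lebesgue_rV R n ((fun v => c - v)%R @^-1` A) = borel_lebesgue_rV R n A.
Proof.
elim: n => [|n IH] in c A *.
  move=> _; congr (borel_lebesgue_rV R 0 _); apply/funext => v/=.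
  by congr (A _); rewrite [RHS]thinmx0 [LHS]thinmx0.
move=> mA.
pose B := @rV_cons _ (measurableTypeR R) n @^-1` A.
have mB : measurable B.
  by rewrite -[X in measurable X]setTI; exact: measurable_rV_cons.
(* [phi x] is the measure of the slice of [A] over the first coordinate [x]. *)
pose phi (x : measurableTypeR R) := borel_lebesgue_rV R n (xsection B x).
have mphi : measurable_fun setT phi by exact: measurable_fun_xsection.
transitivity (\int[lebesgue_measure]_x phi (c ord0 ord0 - x)%R).
  rewrite /= /rV_cons_measure /pushforward /= /product_measure1.
  apply: eq_integral => x _; rewrite /phi /=.
  rewrite -[RHS](IH (\row_i c ord0 (lift ord0 i))%R); last first.
    exact: measurable_xsection.
  congr (borel_lebesgue_rV R n _); apply/funext => v.
  rewrite /xsection/preimage/= !inE /B/=; congr (A _).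
  by apply/rowP => i; rewrite !mxE; case: unliftP => [j|] -> /=; rewrite ?mxE.
transitivity (\int[lebesgue_measure]_x phi x); last by [].
have mr : measurable_fun [set: measurableTypeR R]
    ((fun y => c ord0 ord0 - y)%R : _ -> measurableTypeR R).
  exact: (measurable_funB (measurable_cst _)).
rewrite -(@ge0_integral_pushforward _ _ _ _ _ _ mr lebesgue_measure setT phi)//.
by apply: eq_measure_integral => //= S mS _; exact: lebesgue_measure_reflect.
Qed.

Section leb_reflect.
Context {R : realType} {n : nat}.
Local Notation lam := (borel_lebesgue_rV R n).
Local Notation mu := (leb R n).
Variable c : 'rV[R]_n.
Let r (v : 'rV[R]_n) := (c - v)%R.

Let rK : involutive r.
Proof. by move=> v; rewrite /r subKr. Qed.

(** One inequality is enough, as the reflection is an involution; it follows by reflecting a Borel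
    hull, for which invariance is known. *)
Lemma leb_reflect (A : set 'rV[R]_n) : mu (r @^-1` A) = mu A.
Proof.
have le B : mu (r @^-1` B) <= mu B.
  have [U [mU BU <-]] := borel_hull B.
  rewrite -(borel_lebesgue_reflect c mU) -leb_borelE.
    by apply: le_leb => x; exact: BU.
  rewrite -[X in rV_borel X](@setTI 'rV[R]_n).
  exact: measurable_rV_reflect.
apply/eqP; rewrite eq_le le/=.
rewrite [leLHS](_ : _ = mu (r @^-1` (r @^-1` A))) ?le//.
by congr (mu _); apply/funext => x; rewrite /preimage/= rK.
Qed.

(** By invariance of the outer measure, the Caratheodory criterion for the reflection of [A] is the
    criterion for [A] tested on the reflected set. *)
Lemma rV_leb_reflect (A : set 'rV[R]_n) : rV_leb A -> rV_leb (r @^-1` A).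
Proof.
move=> mA; suff : caratheodory_measurable (mu_ext lam) (r @^-1` A) by [].
move=> X; change (mu X = mu (X `&` r @^-1` A) + mu (X `&` ~` (r @^-1` A))).
rewrite -(leb_reflect X) -(leb_reflect (X `&` _)) -(leb_reflect (X `&` ~` _)).
have -> : r @^-1` (X `&` r @^-1` A) = r @^-1` X `&` A.
  by apply/funext => x; rewrite /preimage/setI/= rK.
have -> : r @^-1` (X `&` ~` (r @^-1` A)) = r @^-1` X `&` ~` A.
  by apply/funext => x; rewrite /preimage/setI/setC/= rK.
exact: mA.
Qed.

Lemma measurable_leb_reflect :
  measurable_fun [set: leb_space R n] (r : leb_space R n -> leb_space R n).
Proof. by move=> _ A mA; rewrite setTI; exact: rV_leb_reflect. Qed.

Lemma ge0_integral_leb_reflect (h : 'rV[R]_n -> \bar R) :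
  leb_measurable h -> (forall x, 0 <= h x) ->
  \int[mu]_x h (c - x)%R = \int[mu]_x h x.
Proof.
move=> mh h0.
rewrite -(@ge0_integral_pushforward _ _ _ _ _ _ measurable_leb_reflect mu setT h)//.
apply: eq_measure_integral => [|? S _ _]; first exact: measurable_leb_reflect.
exact: leb_reflect.
Qed.

End leb_reflect.

Lemma measurable_leb_borel {R : realType} {n : nat} :
  measurable_fun [set: leb_space R n] (id : leb_space R n -> 'rV[measurableTypeR R]_n).
Proof. by move=> _ A mA; rewrite setTI; exact: rV_borel_leb. Qed.

Lemma borel_leb_measurable {R : realType} {n : nat} (h : 'rV[R]_n -> \bar R) :
  measurable_fun [set: 'rV[measurableTypeR R]_n] h -> leb_measurable h.
Proof. by move=> mh; apply: (measurableT_comp mh); exact: measurable_leb_borel. Qed.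

Lemma ge0_integral_leb_borel {R : realType} {n : nat} (h : 'rV[R]_n -> \bar R) :
  measurable_fun [set: 'rV[measurableTypeR R]_n] h -> (forall x, 0 <= h x) ->
  \int[leb R n]_x h x = \int[borel_lebesgue_rV R n]_x h x.
Proof.
move=> mh h0.
rewrite -[LHS](@ge0_integral_pushforward _ _ _ _ _ _ measurable_leb_borel (leb R n) setT h)//.
apply: eq_measure_integral => [|? S mS _]; first exact: measurable_leb_borel.
exact: leb_borelE.
Qed.

Lemma ge0_markov d (T : measurableType d) (R : realType)
    (mu : {measure set T -> \bar R}) (D : set T) (f : T -> \bar R) (t : R) :
  measurable D -> measurable_fun D f -> (forall x, D x -> 0 <= f x) ->
  (0 <= t)%R -> t%:E * mu (D `&` [set x | t%:E < f x]) <= \int[mu]_(x in D) f x.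
Proof.
move=> mD mf f0 t0.
have mA : measurable (D `&` [set x | t%:E < f x]) by exact: emeasurable_fun_o_infty.
apply: (@le_trans _ _ (\int[mu]_(x in D `&` [set x | t%:E < f x]) f x)).
  rewrite -integral_cst//; apply: ge0_le_integral => //.
  - exact: measurable_funS mf.
  - by move=> x [_ /ltW].
exact: ge0_subset_integral.
Qed.

(* Fubini's theorem is available for the product sigma-algebra only, not for its
   completion, so convolutions are estimated through Borel majorants. *)
Lemma borel_majorant (R : realType) n (h : 'rV[R]_n -> \bar R) :
  leb_measurable h -> (forall x, 0 <= h x) -> \int[leb R n]_x h x < +oo ->
  exists H : 'rV[R]_n -> \bar R,
    [/\ measurable_fun [set: 'rV[measurableTypeR R]_n] H,
        (forall x, h x <= H x) &
        \int[borel_lebesgue_rV R n]_x H x = \int[leb R n]_x h x].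
Proof.
move=> mh h0 hoo.
(* [q] enumerates the rationals, with the value 0 at the numbers that encode none. *)
pose q (k : nat) : R := ratr (odflt (0:rat)%R (unpickle k)).
have [U UP] := choice (fun k => borel_hull [set x | (q k)%:E < h x]).
have mU k : measurable (U k : set 'rV[measurableTypeR R]_n) by have [] := UP k.
(* The majorant is the supremum over [k] of [max(q k, 0)] times the indicator of [U k], a Borel hull
   of [{h > q k}]. *)
pose a k x : \bar R := (Num.max (q k) 0 * \1_(U k) x)%:E.
have a0 k x : 0 <= a k x.
  by rewrite lee_fin mulr_ge0// le_max lexx orbT.
have ma k : measurable_fun [set: 'rV[measurableTypeR R]_n] (a k).
  apply/measurable_EFinP; apply: measurable_funM => //.
pose H x := esups (a^~ x) 0%N.
have aH k x : a k x <= H x by apply: ereal_sup_ubound; exists k.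
have H0 x : 0 <= H x by exact: le_trans (a0 0%N x) (aH _ _).
have mH : measurable_fun [set: 'rV[measurableTypeR R]_n] H.
  exact: measurable_fun_esups.
have hH x : h x <= H x.
  rewrite leNgt; apply/negP => Hh.
  have Hfin : H x \is a fin_num by rewrite ge0_fin_numE// (lt_le_trans Hh)// leey.
  have [r Hr rh] : exists2 r : R, (fine (H x) < r)%R & r%:E <= h x.
    case E : (h x) Hh => [r| |] Hh; last by have := h0 x; rewrite E.
      by exists r => //; rewrite -lte_fin fineK.
    by exists (fine (H x) + 1)%R; rewrite ?leey// ltrDl.
  have [p] := rat_in_itvoo Hr; rewrite in_itv/= => /andP[Hp pr].
  have qk : q (pickle p) = ratr p by rewrite /q pickleK.
  have := aH (pickle p) x; apply/negP; rewrite -ltNge.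
  have [_ hU _] := UP (pickle p).
  rewrite /a indicE mem_set; last first.
    by apply: hU => /=; rewrite qk (lt_le_trans _ rh)// lte_fin.
  by rewrite mulr1 qk -(fineK Hfin) lte_fin lt_max Hp.
exists H; split=> //.
rewrite -ge0_integral_leb_borel//.
have mHl : leb_measurable H by exact: borel_leb_measurable.
have mA k : measurable ([set x | (q k)%:E < h x] : set (leb_space R n)).
  rewrite -[X in measurable X](@setTI (leb_space R n)).
  exact: (emeasurable_fun_o_infty measurableT mh).
have mUl k : measurable (U k : set (leb_space R n)) by exact: rV_borel_leb (mU k).
apply: ge0_ae_eq_integral => //.
(* At a level [q k > 0] Markov's inequality makes [{h > q k}] of finite measure, so its hull exceeds
   it by a null set only; levels [q k <= 0] contribute nothing to [H]. *)
have : (leb R n).-negligible (\bigcup_k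
    if (0 < q k)%R then U k `\` [set x | (q k)%:E < h x] else set0).
  apply: negligible_bigcup => k; case: ifPn => qk; last exact: negligible_set0.
  apply/negligibleP; first exact: measurableD.
  have [_ hU UE] := UP k.
  have fA : leb R n [set x | (q k)%:E < h x] < +oo.
    have := @ge0_markov _ _ _ (leb R n) setT h (q k) measurableT mh (fun x _ => h0 x) (ltW qk).
    have fin (y : \bar R) : (q k)%:E * y < +oo -> y < +oo.
      by rewrite !ltey; apply: contraNneq => ->; rewrite gt0_muley.
    by rewrite setTI => /le_lt_trans/(_ hoo)/fin.
  have E1 := etrans (leb_borelE (mU k)) UE.
  rewrite measureD//; last by change (leb R n (U k) < +oo); rewrite E1.
  rewrite setIidr//.
  change (leb R n (U k) - leb R n [set x | (q k)%:E < h x] = 0).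
  rewrite E1 subee//.
  by rewrite ge0_fin_numE ?leb_ge0.
apply: negligibleS => x /= /not_implyP[_ Hh]; apply: contrapT => NN; apply: Hh.
apply/eqP; rewrite eq_le hH andbT.
apply: ge_ereal_sup => _ [k _ <-].
rewrite /a; have [qk|qk] := ltP 0%R (q k); last by rewrite mul0r.
rewrite indicE; case: (boolP (x \in U k)) => xU; last by rewrite mulr0.
rewrite mulr1; have [//|hq] := ltP (q k)%:E (h x); first exact: ltW.
exfalso; apply: NN; exists k => //; rewrite qk; split; first exact: set_mem.
by rewrite /= ltNge hq.
Qed.

(** * Boxes and compact sets *)

Section boxes.
Context {R : realType} {n : nat}.
Local Notation lam := (borel_lebesgue_rV R n).
Local Notation mu := (leb R n).
Local Notation rVb := 'rV[measurableTypeR R]_n.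

Definition box (N : nat) : set 'rV[R]_n :=
  [set v | forall i, (`|v ord0 i| <= N%:R)%R].

Lemma borel_coord (i : 'I_n) (B : set R) : measurable B ->
  rV_borel [set v : 'rV[R]_n | B (v ord0 i)].
Proof.
move=> mB; have := @measurable_rV_coord _ (measurableTypeR R) n i measurableT B mB.
by rewrite setTI.
Qed.

Lemma borel_box N : rV_borel (box N).
Proof.
rewrite (_ : box N = \bigcap_(i in [set: 'I_n])
    [set v : 'rV[R]_n | `[(- N%:R)%R, N%:R%R]%classic (v ord0 i)]).
  apply: (@fin_bigcap_measurable _ rVb) => // i _.
  by apply: borel_coord; exact: measurable_itv.
apply/seteqP; split => v /= H i; first by move=> _; rewrite /= in_itv/= -ler_norml.
by have := H i I; rewrite /= in_itv/= -ler_norml.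
Qed.

Lemma box_mono N M : (N <= M)%N -> box N `<=` box M.
Proof. by move=> NM v vN i; apply: le_trans (vN i) _; rewrite ler_nat. Qed.

Lemma ler_coord_norm (v : 'rV[R]_n) i : (`|v ord0 i| <= `|v|)%R.
Proof.
by rewrite [leRHS]/Num.norm /= mx_normrE; apply/bigmax_geP; right => /=; exists (ord0, i).
Qed.

Lemma norm_boxP N (v : 'rV[R]_n) : box N v <-> (`|v| <= N%:R)%R.
Proof.
split=> [vN|vN i]; last exact: le_trans (ler_coord_norm v i) vN.
by rewrite [leLHS]/Num.norm /= mx_normrE; apply: bigmax_le => // -[i j] _ /=; rewrite ord1.
Qed.

Lemma bounded_box N : bounded_set (box N).
Proof.
exists N%:R; split; first exact: num_real.
by move=> M NM v /norm_boxP vN; exact: le_trans vN (ltW NM).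
Qed.

Lemma bounded_subset_box (E : set 'rV[R]_n) : bounded_set E ->
  exists N, E `<=` box N.
Proof.
move=> [M [Mr bM]]; exists (Num.truncn (`|M| + 1)).+1 => v Ev; apply/norm_boxP.
apply: le_trans (bM (`|M| + 1)%R _ v Ev) _.
  by rewrite (le_lt_trans (ler_norm _))// ltrDl.
exact/ltW/truncnS_gt.
Qed.

Lemma box_cover : \bigcup_N box N = setT.
Proof.
apply/seteqP; split => // v _; exists (Num.truncn `|v|).+1 => //.
by apply/norm_boxP; exact/ltW/truncnS_gt.
Qed.

Lemma closed_coord (i : 'I_n) (B : set R) : closed B ->
  closed [set v : 'rV[R]_n | B (v ord0 i)].
Proof.
by move=> cB; apply: (@closed_comp _ _ (fun v : 'rV[R]_n => v ord0 i)) => // v _; exact: coord_continuous.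
Qed.

Lemma open_coord (i : 'I_n) (B : set R) : open B ->
  open [set v : 'rV[R]_n | B (v ord0 i)].
Proof.
by move=> cB; apply: (@open_comp _ _ (fun v : 'rV[R]_n => v ord0 i)) => // v _; exact: coord_continuous.
Qed.

Lemma compact_box N : compact (box N).
Proof.
apply: bounded_closed_compact; first exact: bounded_box.
rewrite (_ : box N = \bigcap_(i in [set: 'I_n])
    [set v : 'rV[R]_n | `[(- N%:R)%R, N%:R%R]%classic (v ord0 i)]).
  by apply: closed_bigI => i _; apply: closed_coord; exact: interval_closed.
apply/seteqP; split => v /= H i; first by move=> _; rewrite /= in_itv/= -ler_norml.
by have := H i I; rewrite /= in_itv/= -ler_norml.
Qed.

Lemma borel_ball (x : 'rV[R]_n) (e : R) : (0 < e)%R -> rV_borel (ball x e).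
Proof.
move=> e0.
rewrite (_ : ball x e = \bigcap_(i in [set: 'I_n])
    [set v : 'rV[R]_n | ball (x ord0 i) e (v ord0 i)]).
  apply: (@fin_bigcap_measurable _ rVb) => // i _.
  by apply: borel_coord; exact: measurable_ball.
apply/seteqP; split => v /= H; first by move=> i _; exact: H.2.
by split=> // i j; rewrite ord1; exact: H.
Qed.

(** Balls of the sup norm are finite intersections of coordinate slabs, hence Borel. A compact set
    is the intersection over [m] of finite unions of balls of radius [1/(m+1)] centred in it. *)
Lemma borel_compact (K : set 'rV[R]_n) : compact K -> rV_borel K.
Proof.
move=> cK.
have H (m : nat) : exists D : set 'rV[R]_n,
    [/\ finite_set D, D `<=` K & K `<=` \bigcup_(x in D) ball x m.+1%:R^-1].
  move: (cK); rewrite compact_cover => /(_ _ K (fun x => ball x m.+1%:R^-1)).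
  case.
  - by move=> x _; exact: ball_open.
  - by move=> x Kx; exists x => //; exact: ballxx.
  - move=> D DK KD; refine (ex_intro _ _ (And3 _ _ KD)); first exact: finite_fset.
    by move=> x /DK /set_mem.
have [D DP] := choice H.
have -> : K = \bigcap_m \bigcup_(x in D m) ball x m.+1%:R^-1.
  apply/seteqP; split => [x Kx m _|x Hx]; first by have [_ _] := DP m; exact.
  have clK : closed K by exact: compact_closed (@norm_hausdorff _ _) cK.
  apply: clK => B /nbhs_ballP[e /= e0 eB].
  have [m _ /(_ m (leqnn m)) me] := near_infty_natSinv_lt (PosNum e0).
  have [y yD yx] := Hx m I; exists y; split.
    by have [_ + _] := DP m; exact.
  by apply: eB; apply: ball_sym; apply: le_ball yx; exact: ltW.
apply: (@bigcapT_measurable _ rVb) => m.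
by apply: (@fin_bigcup_measurable _ rVb) => // [|x _]; [by case: (DP m)|exact: borel_ball].
Qed.

End boxes.

Lemma borel_lebesgue_box (R : realType) n N :
  borel_lebesgue_rV R n (box N) = ((N%:R *+ 2) ^+ n)%:E.
Proof.
elim: n => [|n IH].
  by rewrite /= /dirac indicE mem_set// => -[].
rewrite /= /rV_cons_measure /pushforward.
rewrite (_ : _ @^-1` _ = `[(- N%:R)%R, N%:R%R]%classic `*` box N).
  rewrite product_measure1E//; last exact: borel_box.
  rewrite IH exprS EFinM; congr (_ * _).
  have := @lebesgue_measure_itv R `[(- N%:R)%R, N%:R%R]; rewrite /= => E.
  apply: etrans E _; rewrite lte_fin -subr_gt0 opprK -mulr2n.
  case: ifPn => [_|]; first by congr (_%:E); rewrite opprK mulr2n.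
  by rewrite -leNgt => h; congr (_%:E); apply/le_anti; rewrite h andbT mulrn_wge0.
apply/seteqP; split => [[x v] H|[x v] [/= Hx Hv] i].
  split=> /=; first by have := H ord0; rewrite mxE unlift_none /= in_itv/= ler_norml.
  by move=> i; have := H (lift ord0 i); rewrite mxE liftK.
rewrite mxE; case: unliftP => [j|] _ /=; first exact: Hv.
by move: Hx; rewrite in_itv/= ler_norml.
Qed.

Lemma leb_box (R : realType) n N : leb R n (box N) = ((N%:R *+ 2) ^+ n)%:E.
Proof. by rewrite leb_borelE; [exact: borel_lebesgue_box|exact: borel_box]. Qed.

Lemma borel_lebesgue_box_lty (R : realType) n N : borel_lebesgue_rV R n (box N) < +oo.
Proof. by rewrite borel_lebesgue_box ltry. Qed.

Lemma leb_box_lty (R : realType) n N : leb R n (box N) < +oo.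
Proof. by rewrite leb_box ltry. Qed.

(** * Inner regularity of the completed Lebesgue measure *)

Section inner_regularity.
Context {R : realType} {n : nat}.
Local Notation lam := (borel_lebesgue_rV R n).
Local Notation mu := (leb R n).
Local Notation rVb := 'rV[measurableTypeR R]_n.

(** Approximation by closed sets from inside and open sets from outside, with the error measured in
    a box: there all measures are finite, so continuity from above is available. *)
Let close N (e : R) (A : set 'rV[R]_n) := exists F U : set 'rV[R]_n,
  [/\ [/\ closed F, rV_borel F & F `<=` A], [/\ open U, rV_borel U & A `<=` U] &
     lam ((U `\` F) `&` box N) <= e%:E].

Let approximable N (A : set 'rV[R]_n) := forall e : R, (0 < e)%R -> close N e A.

Let closeC N e A : close N e A -> close N e (~` A).
Proof.
move=> [F [U [[cF mF FA] [oU mU AU] le]]]; exists (~` U), (~` F); split.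
- split; [exact: open_closedC|exact: (@measurableC _ rVb)|exact: subsetC].
- split; [exact: closed_openC|exact: (@measurableC _ rVb)|exact: subsetC].
- rewrite (_ : ~` F `\` ~` U = U `\` F)//.
  by apply/seteqP; split => x /=; [move=> [? /contrapT]|move=> [? ?]; split => //; apply].
Qed.

(** A countable union of closed sets need not be closed, so only finitely many inner approximations
    are kept; the error of this cut tends to 0 within the box. *)
Let approximable_bigcup N (A : (set 'rV[R]_n)^nat) :
  (forall k, approximable N (A k)) -> approximable N (\bigcup_k A k).
Proof.
move=> Ak e e0.
(* These tolerances add up to [e / 2]; the other half pays for cutting the union at a finite
   stage. *)
have h k : close N (e / 2 / (2 ^ k.+1)%:R) (A k).
  by apply: Ak; rewrite !divr_gt0// ltr0n expn_gt0.
have [F FP] := choice h; have [U UP] := choice FP; clear h FP.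
have mF k : measurable (F k : set rVb) by have [[]] := UP k.
have mU k : measurable (U k : set rVb) by have [_ []] := UP k.
have mB : measurable (box N : set rVb) by exact: borel_box.
pose G m := \bigcup_(k in `I_m) F k.
have mG m : measurable (G m : set rVb) by exact: (@fin_bigcup_measurable _ rVb).
pose D m := (\bigcup_k U k `\` G m) `&` box N.
have mD m : measurable (D m : set rVb).
  apply: (@measurableI _ rVb) => //; apply: (@measurableD _ rVb) => //.
  exact: (@bigcupT_measurable _ rVb).
have Dcap : \bigcap_m D m `<=` \bigcup_k ((U k `\` F k) `&` box N).
  move=> x Dx; have [[[k _ Ukx] _] Nx] := Dx 0%N I; exists k => //; split => //.
  split => // Fkx; have [[_ +] _] := Dx k.+1 I; apply.
  by exists k => //=.
have leD : lam (\bigcap_m D m) <= (e / 2)%:E.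
  apply: (@le_trans _ _ (\sum_(k <oo) lam ((U k `\` F k) `&` box N))).
    apply: measure_sigma_subadditive => //.
    - by move=> k; apply: (@measurableI _ rVb) => //; exact: (@measurableD _ rVb).
    - exact: (@bigcapT_measurable _ rVb).
  apply: (@le_trans _ _ (\sum_(k <oo) (0 + (e / 2 / (2 ^ k.+1)%:R)%:E))).
    by apply: lee_nneseries => // k _; rewrite add0e; have [_ _] := UP k.
  apply: le_trans (epsilon_trick _ _ _) _ => //.
    by rewrite ltW// divr_gt0.
  by rewrite eseries0// add0e.
have Dfin : lam (D 0%N) < +oo.
  by apply: le_lt_trans (borel_lebesgue_box_lty R n N); apply: le_measure;
    rewrite ?inE//; move=> x [].
have cv : lam (D m) @[m --> \oo] --> lam (\bigcap_m D m).
  apply: nonincreasing_cvg_mu => //; first exact: (@bigcapT_measurable _ rVb).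
  move=> m p mp; apply/subsetPset => x [[Ux Gx] Nx]; split => //; split => //.
  by move=> [k /= km Fk]; apply: Gx; exists k => //=; exact: leq_trans mp.
have fincap : lam (\bigcap_m D m) \is a fin_num.
  by rewrite ge0_fin_numE// (le_lt_trans leD)// ltry.
have [m _ /(_ m (leqnn m)) /= lem] : \forall m \near \oo, lam (D m) < e%:E.
  move: cv; rewrite -(fineK fincap) => /fine_cvgP[Df /cvgrPdist_lt/(_ (e / 2)%R)].
  rewrite divr_gt0// => /(_ isT) cv; near=> m.
  have Dm : lam (D m) \is a fin_num by near: m; exact: Df.
  rewrite -(fineK Dm) lte_fin.
  have : (`|fine (lam (\bigcap_m D m)) - fine (lam (D m))| < e / 2)%R by near: m.
  rewrite ltr_norml => /andP[lo _].
  have : (fine (lam (\bigcap_m D m)) <= e / 2)%R by rewrite -lee_fin fineK.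
  by move: lo => /= lo hi; lra.
exists (G m), (\bigcup_k U k); split.
- split; first by apply: closed_bigcup => // k _; have [[]] := UP k.
    exact: mG.
  by move=> v [k _ Fv]; exists k => //; have [[_ _ +] _ _] := UP k; apply.
- split; first by apply: bigcup_open => k _; have [_ []] := UP k.
    exact: (@bigcupT_measurable _ rVb).
  by move=> v [k _ Av]; exists k => //; have [_ [_ _ +] _] := UP k; apply.
- exact: ltW.
Unshelve. all: by end_near. Qed.

Let approximable_sigma N : sigma_algebra setT (approximable N).
Proof.
split.
- move=> e e0; exists set0, set0; split.
  + by split; [exact: closed0|exact: (@measurable0 _ rVb)|].
  + by split; [exact: open0|exact: (@measurable0 _ rVb)|].
  + by rewrite setD0 set0I measure0 lee_fin ltW.
- by move=> A HA e e0; rewrite setTD; exact/closeC/HA.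
- by move=> A HA; exact: approximable_bigcup.
Qed.

(** The open half-space is its own outer approximation; the closed half-spaces [F m] increase to
    it. *)
Let approximable_ray N (i : 'I_n) (x : R) :
  approximable N [set v | (x < v ord0 i)%R].
Proof.
move=> e e0.
pose F (m : nat) := [set v : 'rV[R]_n | (x + m.+1%:R^-1 <= v ord0 i)%R].
pose A := [set v : 'rV[R]_n | (x < v ord0 i)%R].
have mA : measurable (A : set rVb).
  rewrite (_ : A = [set v | `]x, +oo[%classic (v ord0 i)]).
    by apply: borel_coord; exact: measurable_itv.
  by apply/seteqP; split => v /=; rewrite in_itv/= andbT.
have FE m : F m = [set v | `[(x + m.+1%:R^-1)%R, +oo[%classic (v ord0 i)].
  by apply/seteqP; split => v /=; rewrite in_itv/= andbT.
have mF m : measurable (F m : set rVb).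
  by rewrite FE; apply: borel_coord; exact: measurable_itv.
have mB : measurable (box N : set rVb) by exact: borel_box.
pose D m := (A `\` F m) `&` box N.
have mD m : measurable (D m : set rVb).
  by apply: (@measurableI _ rVb) => //; exact: (@measurableD _ rVb).
have D0 : \bigcap_m D m = set0.
  apply/seteqP; split => // v Dv; have [[/= Av _] _] := Dv 0%N I.
  have [m _ /(_ m (leqnn m)) /= me] := near_infty_natSinv_lt (PosNum (etrans (subr_gt0 _ _) Av)).
  have [[_ /=]] := Dv m I; case.
  rewrite /F/=; move: me; set u := (m.+1%:R^-1)%R => me; lra.
have Dfin : lam (D 0%N) < +oo.
  by apply: le_lt_trans (borel_lebesgue_box_lty R n N); apply: le_measure;
    rewrite ?inE//; move=> v [].
have : lam (D m) @[m --> \oo] --> lam (\bigcap_m D m).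
  apply: nonincreasing_cvg_mu => //; first exact: (@bigcapT_measurable _ rVb).
  move=> m p mp; apply/subsetPset => v [[Av Gv] Nv]; split => //; split => //.
  move=> /= Fv; apply: Gv; apply: le_trans Fv; rewrite lerD2l lef_pV2 ?posrE//.
  by rewrite ler_nat ltnS.
rewrite D0 measure0 => /fine_cvgP[Df /cvgrPdist_lt/(_ e e0) cv].
near \oo => m; exists (F m), A; split.
- split; [by rewrite FE; apply: closed_coord; exact: interval_closed|exact: mF|].
  by move=> v; apply: lt_le_trans; rewrite ltrDl.
- split=> //; rewrite (_ : A = [set v | `]x, +oo[%classic (v ord0 i)]).
    by apply: open_coord; exact: interval_open.
  by apply/seteqP; split => v /=; rewrite in_itv/= andbT.
- have Dm : lam (D m) \is a fin_num by near: m; exact: Df.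
  rewrite -(fineK Dm) lee_fin ltW//.
  have : (`|0 - fine (lam (D m))| < e)%R by near: m.
  by rewrite sub0r normrN; apply: le_lt_trans; rewrite ler_norm.
Unshelve. all: by end_near. Qed.

(** The approximable sets form a sigma-algebra, and the open half-spaces generate the Borel sets. *)
Let borel_approximable N A : rV_borel A -> approximable N A.
Proof.
apply: (smallest_sub (approximable_sigma N)) => B.
rewrite -bigcup_seq => -[i _ [C mC]]; rewrite setTI => <-.
have : (@RGenOInfty.G R).-sigma.-measurable C by rewrite -RGenOInfty.measurableE.
have sC : sigma_algebra setT [set C : set R | approximable N (@rV_coord _ (measurableTypeR R) n i @^-1` C)].
  have [h0 hC hU] := approximable_sigma N; split.
  - by rewrite /= preimage_set0.
  - by move=> X /= /hC; rewrite !setTD preimage_setC.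
  - by move=> X /= /hU; rewrite preimage_bigcup.
apply: (smallest_sub sC) => _ [x ->].
apply: (eq_ind_r (approximable N) (@approximable_ray N i x)).
by apply/funext => v; rewrite /preimage/= /rV_coord in_itv/= andbT.
Qed.

(** Inside a large box, removing a Borel hull of the complement of [A] leaves a Borel subset [D] of
    [A] that loses no measure. A closed set approximating [D] from inside lies in the box, hence is
    compact. *)
Lemma leb_inner_regular (A : set 'rV[R]_n) (c : \bar R) : rV_leb A -> c < mu A ->
  exists K, [/\ compact K, K `<=` A & c < mu K].
Proof.
move=> mA cA.
have mBl N : rV_leb (box N : set 'rV[R]_n) by apply: rV_borel_leb; exact: borel_box.
have mAB N : @measurable _ (leb_space R n) (A `&` box N).
  exact: (@measurableI _ (leb_space R n) _ _ mA (mBl N)).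
have [N cN] : exists N, c < mu (A `&` box N).
  have cv : mu (A `&` box N) @[N --> \oo] --> mu (\bigcup_N (A `&` box N)).
    apply: (@nondecreasing_cvg_mu _ (leb_space R n) _ mu).
    - exact: mAB.
    - exact: (@bigcupT_measurable _ (leb_space R n)).
    - by move=> N M NM; apply/subsetPset; apply: setIS; exact: box_mono.
  apply: contrapT => /forallNP H; move: cA; apply/negP; rewrite -leNgt.
  rewrite -[X in mu X]setIT -box_cover setI_bigcupr.
  rewrite -(cvg_lim _ cv)//; apply: lime_le; first by apply/cvg_ex; eexists; exact: cv.
  by apply: nearW => N; rewrite leNgt; apply/negP; exact: H.
have [U [mU BU UE]] := borel_hull (box N `\` A).
pose D := box N `\` U.
have mD : rV_borel D by apply: (@measurableD _ rVb) => //; exact: borel_box.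
have DA : D `<=` A by move=> x [Nx Ux]; apply: contrapT => Ax; exact/Ux/BU.
(* As [U] has the measure of the part of the box outside [A], its complement in the box has at least
   the measure of [A] there. *)
have cD : c < lam D.
  apply: (lt_le_trans cN).
  have fN : mu (box N `\` A) \is a fin_num.
    rewrite ge0_fin_numE ?leb_ge0//; apply: le_lt_trans (leb_box_lty R n N).
    exact: le_leb.
  rewrite -(leeD2rE _ _ fN) -[in leRHS]UE.
  have E1 : mu (box N) = mu (box N `\` A) + mu (box N `&` A).
    by apply: (measureDI mu) => //; exact: mBl.
  have E2 : lam (box N) = lam D + lam (box N `&` U).
    by apply: (measureDI lam) => //; exact: borel_box.
  rewrite addeC setIC -E1 leb_borelE; last exact: borel_box.
  rewrite E2 leeD2l//; apply: le_measure; rewrite ?inE//.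
  by apply: (@measurableI _ rVb) => //; exact: borel_box.
apply: contrapT => /forallNP H; move: cD; apply/negP; rewrite -leNgt.
apply/lee_addgt0Pr => e e0.
have [F [V [[cF mF FD] [oV mV DV] le]]] := borel_approximable N mD e0.
have Fc : lam F <= c.
  rewrite leNgt; apply/negP => cF'; apply: (H F); split.
  - apply: (subclosed_compact cF (@compact_box R n N)) => x /FD[].
    by [].
  - exact: subset_trans DA.
  - by rewrite leb_borelE.
(* [D] minus [F] lies in [V] minus [F] and in the box, so it has measure at most [e]. *)
apply: le_trans (leeD Fc le).
have E3 : lam D = lam (D `\` F) + lam (D `&` F) by exact: (measureDI lam).
rewrite E3 addeC; apply: leeD.
  by rewrite setIidr.
apply: le_measure; rewrite ?inE//.
- exact: (@measurableD _ rVb).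
- apply: (@measurableI _ rVb); last exact: borel_box.
  exact: (@measurableD _ rVb).
- by move=> x [Dx Fx]; split; [split => //; exact: DV|exact: Dx.1].
Qed.

End inner_regularity.

(** * The Bessel capacity *)

Lemma ge0_integral_borel_reflect (R : realType) n (c : 'rV[R]_n) (h : 'rV[R]_n -> \bar R) :
  measurable_fun [set: 'rV[measurableTypeR R]_n] h -> (forall x, 0 <= h x) ->
  \int[borel_lebesgue_rV R n]_x h (c - x)%R = \int[borel_lebesgue_rV R n]_x h x.
Proof.
move=> mh h0.
rewrite -(ge0_integral_leb_borel mh h0) -(ge0_integral_leb_reflect c (borel_leb_measurable mh) h0).
rewrite ge0_integral_leb_borel//.
by apply: (measurableT_comp mh); exact: measurable_rV_reflect.
Qed.

Lemma integral_leb_reflect (R : realType) n (c : 'rV[R]_n) (h : 'rV[R]_n -> \bar R) :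
  leb_measurable h -> \int[leb R n]_x h (c - x)%R = \int[leb R n]_x h x.
Proof.
move=> mh; rewrite [LHS]integralE [RHS]integralE; congr (_ - _).
- rewrite -(@ge0_integral_leb_reflect _ _ c (h^\+) (measurable_funepos mh))//.
  by apply: eq_integral => x _; rewrite !funeposE.
- rewrite -(@ge0_integral_leb_reflect _ _ c (h^\-) (measurable_funeneg mh))//.
  by apply: eq_integral => x _; rewrite !funenegE.
Qed.

Lemma measurable_rV_sub (R : realType) n :
  measurable_fun [set: ('rV[measurableTypeR R]_n * 'rV[measurableTypeR R]_n)%type]
    (fun z => (z.1 - z.2)%R : 'rV[measurableTypeR R]_n).
Proof.
apply: measurable_fun_rVP => i.
rewrite (_ : _ \o _ = ((@rV_coord _ (measurableTypeR R) n i \o fst)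
  \- (@rV_coord _ (measurableTypeR R) n i \o snd))%R).
  apply: measurable_funB.
    by apply: measurableT_comp; [exact: measurable_rV_coord|exact: measurable_fst].
  by apply: measurableT_comp; [exact: measurable_rV_coord|exact: measurable_snd].
by apply/funext => z; rewrite /rV_coord/= !mxE.
Qed.

(** Tonelli for the product of the Borel measures, then translation invariance of the inner
    integral. *)
Lemma integral_borel_convolution (R : realType) n (H F : 'rV[R]_n -> \bar R) :
  measurable_fun [set: 'rV[measurableTypeR R]_n] H -> (forall x, 0 <= H x) ->
  measurable_fun [set: 'rV[measurableTypeR R]_n] F -> (forall x, 0 <= F x) ->
  \int[borel_lebesgue_rV R n]_x (\int[borel_lebesgue_rV R n]_y (H (x - y)%R * F y)) =
  (\int[borel_lebesgue_rV R n]_x H x) * (\int[borel_lebesgue_rV R n]_x F x).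
Proof.
move=> mH H0 mF F0.
pose f (z : 'rV[measurableTypeR R]_n * 'rV[measurableTypeR R]_n) : \bar R :=
  H (z.1 - z.2)%R * F z.2.
have mf : measurable_fun setT f.
  apply: emeasurable_funM; last exact: measurableT_comp.
  exact: (measurableT_comp mH (@measurable_rV_sub R n)).
rewrite (@fubini_tonelli _ _ _ _ _ (borel_lebesgue_rV R n) (borel_lebesgue_rV R n) f)//; last first.
  by move=> z; rewrite mule_ge0.
rewrite -ge0_integralZl//; last by apply: integral_ge0.
apply: eq_integral => y _; rewrite /f/= ge0_integralZr//.
  congr (_ * _).
  (* The translation [x -> x - y] is the reflection [x -> y - x] followed by [x -> 0 - x]. *)
  rewrite -[RHS](ge0_integral_borel_reflect 0 mH H0).
  have mH' : measurable_fun [set: 'rV[measurableTypeR R]_n] (fun x => H (0 - x)%R).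
    by apply: (measurableT_comp mH); exact: measurable_rV_reflect.
  rewrite -[RHS](ge0_integral_borel_reflect y mH')//.
  by apply: eq_integral => x _; rewrite sub0r opprB.
exact: (measurableT_comp mH (measurableT_comp (@measurable_rV_sub R n) (measurable_pair2 y))).
Qed.

(** For [y > e], write [y = y^(1-s) y^s]; the exponent [1 - s] is negative, so the first factor is
    at most [e^(1-s)]. *)
Lemma le_poweR_weighted (R : realType) (e s : R) (y : \bar R) :
  (0 < e)%R -> (1 < s)%R -> 0 <= y -> y <= e%:E + (e `^ (1 - s))%:E * y `^ s.
Proof.
move=> e0 s1; case: y => [y| |]//; last first.
  by move=> _; rewrite poweRyr ?gt_eqF ?(lt_trans ltr01)// gt0_muley ?lte_fin ?powR_gt0// addey.
rewrite lee_fin => y0; rewrite poweR_EFin -EFinM -EFinD lee_fin.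
have [ye|ey] := leP y e.
  by rewrite (le_trans ye)// lerDl mulr_ge0 ?powR_ge0.
have y1 : (0 < y)%R by exact: lt_trans ey.
rewrite -[leLHS]add0r lerD ?(ltW e0)//.
have {1}-> : y = (y `^ (1 - s) * y `^ s)%R.
  by rewrite -powRD ?subrK ?powRr1// gt_eqF// implybT.
rewrite ler_wpM2r ?powR_ge0// -opprB !powRN lef_pV2 ?posrE ?powR_gt0//.
by rewrite ge0_ler_powR ?nnegrE ?(ltW e0) ?(ltW ey)// ?subr_ge0 ltW.
Qed.

(* The inequality [y <= e + e^(1-s) y^s] turns [1 <= G * f] into a lower bound for
   [|G| * f^s], to which Markov's inequality applies. *)
Lemma leb_le_capacity (R : realType) n (G : 'rV[R]_n -> \bar R) (s : R) :
  (1 < s)%R -> (leb R n).-integrable [set: leb_space R n] G ->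
  exists2 C : R, (0 < C)%R & forall A, leb R n A <= C%:E * capacity G s A.
Proof.
move=> s1 iG.
have s0 : (0 < s)%R by exact: lt_trans s1.
have mG : leb_measurable G := measurable_int _ iG.
have mGa : leb_measurable (fun x => `|G x|) by exact: measurableT_comp mG.
have [_ Goo] := integrableP _ _ _ iG.
have [H [mH GH IH]] := borel_majorant mGa (fun x => abse_ge0 (G x)) Goo.
have H0 x : 0 <= H x by exact: le_trans (GH x).
have Ifin : \int[leb R n]_x `|G x| \is a fin_num.
  by rewrite ge0_fin_numE// integral_ge0.
pose g := fine (\int[leb R n]_x `|G x|).
have gE : \int[borel_lebesgue_rV R n]_x H x = g%:E by rewrite IH fineK.
have g0 : (0 <= g)%R by rewrite fine_ge0// integral_ge0.
(* With [g] the L^1 norm of [G], this makes [e * g <= 1/2]. *)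
pose e : R := ((2 * (g + 1))^-1)%R.
have e0 : (0 < e)%R by rewrite invr_gt0 mulr_gt0// ltr_wpDl.
have eg : (e * g <= 2^-1)%R.
  by rewrite /e invfM -mulrA ger_pMr// ?invr_gt0// ler_pdivrMl ?mulr1 ?lerDl ?ltr_wpDl.
pose k := (e `^ (1 - s))%R.
have k0 : (0 < k)%R by rewrite powR_gt0.
(* Markov's inequality at level [1/(4k)], for a function whose integral is [g] times that of [F],
   costs the factor [4 k g]; adding 1 keeps the constant positive when [g = 0]. *)
exists (4 * k * g + 1)%R; first by rewrite ltr_wpDl// !mulr_ge0 ?(ltW k0).
have C0 : (0 < 4 * k * g + 1)%R by rewrite ltr_wpDl// !mulr_ge0 ?(ltW k0).
move=> A.
rewrite -lee_pdivrMl//; apply: le_ereal_inf_tmp => _ [f [mf f0 Gf] <-].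
rewrite lee_pdivrMl// poweR_Lnorm ?gt_eqF//.
have mfs : leb_measurable (fun x => `|f x| `^ s).
  by apply: (measurableT_comp (measurable_poweR _)); exact: measurableT_comp mf.
have [fsoo|] := ltP (\int[leb R n]_x (`|f x| `^ s)) +oo; last first.
  by rewrite leye_eq => /eqP ->; rewrite gt0_muley ?lte_fin// leey.
have [F [mF fF IF]] := borel_majorant mfs (fun x => poweR_ge0 _ _) fsoo.
have F0 x : 0 <= F x by apply: le_trans (fF x); exact: poweR_ge0.
rewrite -IF.
pose K x := \int[borel_lebesgue_rV R n]_y (H (x - y)%R * F y).
have mr x : measurable_fun [set: 'rV[measurableTypeR R]_n] (fun y => H (x - y)%R).
  by apply: (measurableT_comp mH); exact: measurable_rV_reflect.
have mK : measurable_fun [set: 'rV[measurableTypeR R]_n] K.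
  apply: (@measurable_fun_fubini_tonelli_F _ _ 'rV[measurableTypeR R]_n 'rV[measurableTypeR R]_n R
   (borel_lebesgue_rV R n) (fun z => H (z.1 - z.2)%R * F z.2)).
    apply: emeasurable_funM; last exact: measurableT_comp.
    exact: (measurableT_comp mH (@measurable_rV_sub R n)).
  by move=> z; rewrite mule_ge0.
have K0 x : 0 <= K x by apply: integral_ge0 => y _; rewrite mule_ge0.
(* On [A] one has [1 <= e g + k K x <= 1/2 + k K x], which fails if [K x <= 1/(4k)]. *)
have AK : A `<=` [set x | ((4 * k)^-1)%:E < K x].
  move=> x /Gf Gfx /=.
  have mGx : leb_measurable (fun y => G (x - y)%R * f y).
    apply: emeasurable_funM; last exact: mf.
    exact: (measurableT_comp mG (measurable_leb_reflect x)).
  have le1 : 1 <= \int[leb R n]_y (H (x - y)%R * (e%:E + k%:E * F y)).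
    apply: (le_trans Gfx); apply: (le_trans (lee_abs _)).
    apply: (le_trans (le_abse_integral _ measurableT mGx)).
    apply: ge0_le_integral.
    - exact: measurableT.
    - by move=> y _; exact: abse_ge0.
    - exact: (measurableT_comp (@abse_measurable R setT) mGx).
    - apply: borel_leb_measurable; apply: emeasurable_funM => //.
      by apply: emeasurable_funD => //; exact: measurable_funeM.
    - move=> y _; rewrite abseM lee_pmul//.
      rewrite gee0_abs//; apply: le_trans (le_poweR_weighted e0 s1 (f0 y)) _.
      rewrite leeD2l// lee_wpmul2l ?lee_fin ?(ltW k0)//.
      by have := fF y; rewrite gee0_abs.
  have E : \int[leb R n]_y (H (x - y)%R * (e%:E + k%:E * F y)) = (e * g)%:E + k%:E * K x.
    rewrite ge0_integral_leb_borel; last 2 first.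
    - apply: emeasurable_funM => //.
      by apply: emeasurable_funD => //; exact: measurable_funeM.
    - by move=> y; rewrite mule_ge0// adde_ge0 ?mule_ge0 ?lee_fin ?(ltW k0) ?(ltW e0).
    under eq_integral => y _.
      rewrite ge0_muleDr ?mule_ge0 ?lee_fin ?(ltW k0) ?(ltW e0)//.
      rewrite [H _ * _]muleC muleCA. over.
    rewrite ge0_integralD//.
    - rewrite ge0_integralZl_EFin ?(ltW e0)// ge0_integral_borel_reflect// gE EFinM.
      congr (_ + _); rewrite ge0_integralZl_EFin ?(ltW k0)//.
        by move=> y _; rewrite mule_ge0.
      exact: emeasurable_funM.
    - by move=> y _; rewrite mule_ge0 ?lee_fin ?(ltW e0).
    - exact: measurable_funeM.
    - by move=> y _; rewrite !mule_ge0 ?lee_fin ?(ltW k0).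
    - by apply: measurable_funeM; exact: emeasurable_funM.
  rewrite ltNge; apply/negP => Kx.
  move: le1; rewrite E; apply/negP; rewrite -ltNge.
  have le2 : k%:E * K x <= (4^-1)%:E.
    rewrite muleC -lee_pdivlMr//; apply: le_trans Kx _.
    by rewrite -EFinM lee_fin invfM.
  have eg' : (e * g)%:E <= (2^-1)%:E by rewrite lee_fin.
  apply: (le_lt_trans (leeD eg' le2)).
  by rewrite -EFinD lte_fin; lra.
have mS : measurable [set x : 'rV[measurableTypeR R]_n | ((4 * k)^-1)%:E < K x].
  by rewrite -[X in measurable X]setTI; exact: emeasurable_fun_o_infty.
apply: (@le_trans _ _ (borel_lebesgue_rV R n [set x | ((4 * k)^-1)%:E < K x])).
  by rewrite -leb_borelE//; exact: le_leb.
have k4 : (0 <= (4 * k)^-1)%R by rewrite invr_ge0 mulr_ge0// ltW.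
have := ge0_markov (borel_lebesgue_rV R n) measurableT mK (fun x _ => K0 x) k4.
rewrite setTI integral_borel_convolution// gE => h.
rewrite -[leLHS]mul1e (_ : 1 = (4 * k)%:E * ((4 * k)^-1)%:E); last first.
  by rewrite -EFinM mulfV// mulf_neq0// gt_eqF.
have k4' : 0 <= (4 * k)%:E by rewrite lee_fin mulr_ge0// ltW.
rewrite -muleA; apply: le_trans (lee_wpmul2l k4' h) _.
rewrite muleA -EFinM lee_wpmul2r//; last by rewrite lee_fin lerDl.
exact: integral_ge0.
Qed.

Lemma capacity_ge0 (R : realType) n (G : 'rV[R]_n -> \bar R) (s : R) A :
  0 <= capacity G s A.
Proof. by apply: le_ereal_inf_tmp => _ [f _ <-]; exact: poweR_ge0. Qed.

Lemma le_capacity (R : realType) n (G : 'rV[R]_n -> \bar R) (s : R) A B :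
  A `<=` B -> capacity G s A <= capacity G s B.
Proof.
move=> AB; apply: ereal_inf_le_tmp => _ [f [mf f0 Gf] <-]; exists f => //.
by split=> // x /AB; exact: Gf.
Qed.

(** At frequency 0 the Fourier transform is the integral and the symbol is 1. *)
Lemma Bessel_kernel_integral (R : realType) n (alpha : R) (G : 'rV[R]_n -> \bar R) :
  is_Bessel_kernel alpha G -> \int[leb R n]_x G x = 1.
Proof.
move=> [iG FG].
have Gfin : \int[leb R n]_x G x \is a fin_num by exact: integrable_fin_num.
have dotp0 (x : 'rV[R]_n) : dotp x 0%R = 0%R.
  by rewrite /dotp big1// => i _; rewrite mxE mulr0.
have := FG 0%R; rewrite /fourier => -[].
under eq_integral => x _ do rewrite dotp0 cos0 mule1.
by move=> E _; rewrite -(fineK Gfin) E dotp0 addr0 powR1.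
Qed.

(* G has integral 1, so a multiple of the indicator of a large box is admissible. *)
Lemma capacity_bounded (R : realType) n (alpha s : R) (G : 'rV[R]_n -> \bar R) E :
  (1 < s)%R -> is_Bessel_kernel alpha G -> bounded_set E -> capacity G s E < +oo.
Proof.
move=> s1 hG /bounded_subset_box[N EN].
have s0 : (0 < s)%R by exact: lt_trans s1.
have iG := hG.1; have mG : leb_measurable G := measurable_int _ iG.
have G1 := Bessel_kernel_integral hG.
have mBox M : measurable (box M : set (leb_space R n)) by apply: rV_borel_leb; exact: borel_box.
have mGa : measurable_fun [set: leb_space R n] (fun x => `|G x|) by exact: measurableT_comp.
(* Outside a large box, [|G|] has integral at most 1/2. *)
have [M GM] : exists M, \int[leb R n]_(x in ~` box M) `|G x| <= (2^-1)%:E.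
  have cv : \int[leb R n]_(x in box M) `|G x| @[M --> \oo] --> \int[leb R n]_(x in \bigcup_M box M) `|G x|.
    apply: ge0_nondecreasing_set_cvg_integral.
    - by move=> M P MP; apply/subsetPset; exact: box_mono.
    - exact: mBox.
    - by move=> i; exact: (@measurable_funS _ _ (leb_space R n) _ _ _ _ measurableT (@subsetT _ _) mGa).
    - by move=> i x _; exact: abse_ge0.
  have [_ Goo] := integrableP _ _ _ iG.
  have Ifin : \int[leb R n]_x `|G x| \is a fin_num.
    by rewrite ge0_fin_numE// integral_ge0.
  have split_int M : \int[leb R n]_x `|G x| =
     \int[leb R n]_(x in box M) `|G x| + \int[leb R n]_(x in ~` box M) `|G x|.
    rewrite -[in LHS](setUv (box M)); apply: ge0_integral_setU.
    - exact: mBox.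
    - by apply: measurableC; exact: mBox.
    - by rewrite setUv; exact: mGa.
    - by move=> x _; exact: abse_ge0.
    - exact/disj_setPCl.
  move: cv; rewrite box_cover -(fineK Ifin) => /fine_cvgP[Df /cvgrPdist_le/(_ (2^-1)%R)].
  rewrite invr_gt0 => /(_ (ltr0Sn _ 1)) cv.
  near \oo => M; exists M.
  have fM : \int[leb R n]_(x in box M) `|G x| \is a fin_num by near: M; exact: Df.
  have : (`|fine (\int[leb R n]_x `|G x|) - fine (\int[leb R n]_(x in box M) `|G x|)| <= 2^-1)%R.
    by near: M.
  move=> /(le_trans (ler_norm _)); rewrite -lee_fin EFinB !fineK// (split_int M) [X in X - _]addeC addeK//.
(* For [x] in [box N] this box catches at least half of the integral of [G], which the height 2
   compensates. *)
pose f (y : 'rV[R]_n) : \bar R := 2%:E * (\1_(box (M + N)) y)%:E.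
have mf : leb_measurable f.
  apply: measurable_funeM; apply/measurable_EFinP.
  exact: (@measurable_indic _ (leb_space R n) R setT).
have f0 x : 0 <= f x by rewrite mule_ge0// lee_fin.
have f1 x : E x -> 1 <= convolution G f x.
  move=> /EN xN; rewrite /convolution.
  (* [B] contains [box M] because [x] lies in [box N]. *)
  pose B := (fun y => (x - y)%R) @^-1` box (M + N).
  have mB : measurable (B : set (leb_space R n)) by apply: rV_leb_reflect; exact: mBox.
  have mh : leb_measurable (fun y => G (x - y)%R * f y).
    apply: emeasurable_funM; last exact: mf.
    exact: (measurableT_comp mG (measurable_leb_reflect x)).
  rewrite -(integral_leb_reflect x mh).
  have -> : \int[leb R n]_y (G (x - (x - y))%R * f (x - y)%R) = \int[leb R n]_(y in B) (2%:E * G y).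
    rewrite [RHS]integral_mkcond; apply: eq_integral => y _.
    rewrite patchE subKr /f indicE; case: ifPn => yB.
      by rewrite mem_set ?mule1 1?muleC//; exact: set_mem yB.
    by rewrite memNset ?mule0//; move: yB; rewrite notin_setE.
  have iGB : (leb R n).-integrable B G by exact: integrableS iG.
  have iGC : (leb R n).-integrable (~` B) G by apply: integrableS iG => //; exact: measurableC.
  rewrite integralZl//.
  have H : 1 = \int[leb R n]_(y in B) G y + \int[leb R n]_(y in ~` B) G y.
    rewrite -G1 -[in LHS](setUv B); apply: integral_setU.
    - exact: mB.
    - by apply: measurableC; exact: mB.
    - by rewrite setUv; exact: mG.
    - exact/disj_setPCl.
  have le2 : \int[leb R n]_(y in ~` B) G y <= (2^-1)%:E.
    apply: le_trans (lee_abs _) _; apply: le_trans (le_abse_integral _ _ _) _.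
    - exact: measurableC.
    - exact: measurable_int iGC.
    apply: le_trans GM; apply: ge0_subset_integral.
    - by apply: measurableC; exact: mB.
    - by apply: measurableC; exact: mBox.
    - exact: (@measurable_funS _ _ (leb_space R n) _ _ _ _ measurableT (@subsetT _ _) mGa).
    - by move=> z _; exact: abse_ge0.
    move=> z Bz zM; apply: Bz => i; rewrite !mxE natrD.
    by rewrite (le_trans (ler_normB _ _))// addrC lerD ?zM ?xN.
  have fB : \int[leb R n]_(y in B) G y \is a fin_num by exact: integrable_fin_num.
  have fC : \int[leb R n]_(y in ~` B) G y \is a fin_num.
    by apply: integrable_fin_num => //; exact: measurableC.
  move: H le2; rewrite -(fineK fB) -(fineK fC) -EFinD => -[].
  rewrite lee_fin -EFinM lee_fin.
  by set u := fine _; set v := fine _ => uv v2; lra.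
apply: (@le_lt_trans _ _ ('N[leb R n]_(s%:E)[f] `^ s)).
  by apply: ereal_inf_lbound; exists f.
rewrite poweR_Lnorm ?gt_eqF//.
have -> : \int[leb R n]_x (`|f x| `^ s) = \int[leb R n]_(x in box (M + N)) (2 `^ s)%:E.
  rewrite [RHS]integral_mkcond; apply: eq_integral => y _.
  rewrite patchE /f indicE; case: ifPn => yB.
    by rewrite mule1 gee0_abs// poweR_EFin.
  by rewrite mule0 abse0 poweR0r// gt_eqF.
rewrite integral_cst; last exact: (mBox (M + N)%N).
by rewrite lte_mul_pinfty// ?lee_fin ?powR_ge0//; exact: leb_box_lty.
Unshelve. all: by end_near. Qed.

(** * Lorentz integrals and the weak-type Hoelder inequality *)

Lemma lebesgue_measure_ray_lt (R : realType) (y : \bar R) : 0 <= y ->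
  lebesgue_measure [set t : R | `]0%R, +oo[%classic t /\ t%:E < y] = y.
Proof.
case: y => [r| |]// r0.
  have -> : [set t : R | `]0%R, +oo[%classic t /\ t%:E < r%:E] = `]0%R, r[%classic.
    by apply/seteqP; split => t /=; rewrite !in_itv/= andbT lte_fin;
      [case=> -> ->|case/andP=> -> ->].
  rewrite lebesgue_measure_itv/=; case: ifPn => r1; first by rewrite sube0.
  by apply/esym/eqP; rewrite eq_le r0 andbT leNgt.
have -> : [set t : R | `]0%R, +oo[%classic t /\ t%:E < +oo] = `]0%R, +oo[%classic.
  by apply/seteqP; split => t /=; rewrite !in_itv/= andbT ltry//; case.
by rewrite lebesgue_measure_itv/= ltry.
Qed.

(** Tonelli for [k] on the region [0 < t < f x] under the graph of [f]. *)
Lemma layer_cake d (T : measurableType d) (R : realType)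
    (mu : {sigma_finite_measure set T -> \bar R}) (f k : T -> \bar R) :
  measurable_fun setT f -> (forall x, 0 <= f x) ->
  measurable_fun setT k -> (forall x, 0 <= k x) ->
  \int[mu]_x (f x * k x) =
  \int[lebesgue_measure]_(t in `]0%R, +oo[) \int[mu]_(x in [set x | t%:E < f x]) k x.
Proof.
move=> mf f0 mk k0.
pose B : set (T * measurableTypeR R) := [set z | `]0%R, +oo[%classic z.2 /\ z.2%:E < f z.1].
have mB : measurable B.
  apply: measurableI.
    rewrite -[X in measurable X]setTI; apply: measurable_snd => //.
  rewrite -[X in measurable X]setTI; apply: measurable_lte => //.
    by apply/measurable_EFinP; exact: measurable_snd.
  exact: measurableT_comp.
pose F (z : T * measurableTypeR R) : \bar R := (\1_B z)%:E * k z.1.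
have mF : measurable_fun setT F.
  apply: emeasurable_funM; last exact: measurableT_comp.
  by apply/measurable_EFinP; exact: measurable_indic.
have F0 z : 0 <= F z by rewrite mule_ge0// lee_fin.
have := @fubini_tonelli _ _ T (measurableTypeR R) R mu lebesgue_measure F mF F0.
rewrite (_ : \int[mu]_x _ = \int[mu]_x (f x * k x)); last first.
  apply: eq_integral => x _; rewrite /F/=.
  pose Bx : set (measurableTypeR R) := [set t | `]0%R, +oo[%classic t /\ t%:E < f x].
  have mBx : measurable Bx.
    have := @measurable_xsection _ _ _ _ B x mB; congr (measurable _).
    by apply/funext => t; rewrite /xsection/= inE.
  transitivity (\int[lebesgue_measure]_t (k x * (\1_Bx t)%:E) : \bar R).
    by apply: eq_integral => t _; rewrite muleC !indicE.
  rewrite ge0_integralZl//; last by apply/measurable_EFinP; exact: measurable_indic.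
  rewrite muleC; congr (_ * _); rewrite integral_indic// setIT.
  exact: lebesgue_measure_ray_lt.
move=> ->; rewrite [RHS]integral_mkcond; apply: eq_integral => t _.
rewrite patchE; case: ifPn => t0.
  rewrite [RHS]integral_mkcond; apply: eq_integral => x _.
  rewrite patchE /F/= indicE; case: ifPn => fx.
    rewrite mem_set ?mul1e//; split=> /=; [exact: set_mem t0|exact: set_mem fx].
  by rewrite memNset ?mul0e// => -[_ /=]; move: fx; rewrite notin_setE.
rewrite integral0_eq// => x _; rewrite /F indicE memNset ?mul0e// => -[/= + _].
by move: t0; rewrite notin_setE.
Qed.

Lemma continuous_powR (R : realType) (a x : R) : (0 < x)%R ->
  {for x, continuous (fun t : R => t `^ a)%R}.
Proof.
move=> x0; apply: differentiable_continuous; apply/derivable1_diffP.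
by apply: derivable_powR; rewrite in_itv/= andbT.
Qed.

Lemma integral_powR_itv (R : realType) (r x y : R) : r != 0%R -> (0 < x)%R -> (x < y)%R ->
  \int[lebesgue_measure]_(t in `[x, y]) (t `^ (r - 1))%:E =
  ((y `^ r - x `^ r) / r)%:E.
Proof.
move=> r0 x0 xy.
have cF t : (0 < t)%R -> {for t, continuous (fun t : R => r^-1 * t `^ r)%R}.
  move=> t0; apply: (@continuousM _ R (cst r^-1)%R); first exact: cst_continuous.
  exact: continuous_powR.
rewrite (@continuous_FTC2 _ _ (fun t => r^-1 * t `^ r)%R)//.
- by rewrite -EFinB -mulrBr mulrC.
- apply: continuous_in_subspaceT => t; rewrite inE/= in_itv/= => /andP[xt _].
  by apply: continuous_powR; exact: lt_le_trans xt.
- split.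
  + move=> t; rewrite in_itv/= => /andP[xt _].
    apply: derivableM => //; apply: derivable_powR.
    by rewrite in_itv/= andbT (lt_trans x0).
  + by apply: cvg_at_right_filter; exact: cF.
  + by apply: cvg_at_left_filter; apply: cF; exact: lt_trans xy.
- move=> t; rewrite in_itv/= => /andP[xt _].
  have t0 : (0 < t)%R by exact: lt_trans xt.
  rewrite derive1E deriveM//=; last by apply: derivable_powR; rewrite in_itv/= andbT.
  rewrite derive_cst scaler0 addr0 -derive1E powR_derive1 ?in_itv/= ?andbT//.
  by rewrite scalerA mulVf// scale1r.
Qed.

Lemma integral_powR_near0 (R : realType) (q a : R) : (0 < q)%R -> (0 < a)%R ->
  \int[lebesgue_measure]_(t in `]0%R, a]) (t `^ (q - 1))%:E <= (a `^ q / q)%:E.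
Proof.
move=> q0 a0.
(* The denominators start at 2, so that the left end stays strictly below [a]. *)
have cv : \int[lebesgue_measure]_(t in `[(a / k.+2%:R)%R, a]) (t `^ (q - 1))%:E @[k --> \oo] -->
   \int[lebesgue_measure]_(t in \bigcup_k `[(a / k.+2%:R)%R, a]%classic) (t `^ (q - 1))%:E.
  apply: ge0_nondecreasing_set_cvg_integral => //.
  - move=> k m km; apply/subsetPset => t /=; rewrite !in_itv/= => /andP[+ ->].
    rewrite andbT; apply: le_trans; rewrite ler_pM2l// lef_pV2 ?posrE//.
    by rewrite ler_nat !ltnS.
  - by move=> k; apply/measurable_EFinP; apply: measurable_funTS; exact: measurable_powR.
  - by move=> k t _; rewrite lee_fin powR_ge0.
rewrite (_ : `]0%R, a]%classic = \bigcup_k `[(a / k.+2%:R)%R, a]%classic); last first.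
  apply/seteqP; split => [t /=|t [k _ /=]]; rewrite !in_itv/=; last first.
    by move=> /andP[h ->]; rewrite andbT (lt_le_trans _ h)// divr_gt0.
  move=> /andP[t0 ta].
  have [m _ /(_ m (leqnn m)) /= me] := near_infty_natSinv_lt (PosNum (divr_gt0 t0 a0)).
  exists m => //=; rewrite in_itv/= ta andbT -ler_pdivlMl// mulrC ltW//.
  apply: lt_trans me; rewrite ltf_pV2 ?posrE//.
  by rewrite ltr_nat.
rewrite -(cvg_lim _ cv)//; apply: lime_le; first by apply/cvg_ex; eexists; exact: cv.
apply: nearW => k; rewrite integral_powR_itv//; last 3 first.
- by rewrite gt_eqF.
- by rewrite divr_gt0.
- by rewrite ltr_pdivrMr// ltr_pMr// ltr1n.
by rewrite lee_fin ler_pM2r ?invr_gt0// gerBl powR_ge0.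
Qed.

Lemma integral_powR_nearoo (R : realType) (p a : R) : (1 < p)%R -> (0 < a)%R ->
  \int[lebesgue_measure]_(t in `[a, +oo[) (t `^ (- p))%:E <= (a `^ (1 - p) / (p - 1))%:E.
Proof.
move=> p1 a0.
have cv : \int[lebesgue_measure]_(t in `[a, (a + k.+1%:R)%R]) (t `^ (- p))%:E @[k --> \oo] -->
   \int[lebesgue_measure]_(t in \bigcup_k `[a, (a + k.+1%:R)%R]%classic) (t `^ (- p))%:E.
  apply: ge0_nondecreasing_set_cvg_integral => //.
  - move=> k m km; apply/subsetPset => t /=; rewrite !in_itv/= => /andP[-> /le_trans]/=.
    by apply; rewrite lerD2l ler_nat ltnS.
  - by move=> k; apply/measurable_EFinP; apply: measurable_funTS; exact: measurable_powR.
  - by move=> k t _; rewrite lee_fin powR_ge0.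
rewrite (_ : `[a, +oo[%classic = \bigcup_k `[a, (a + k.+1%:R)%R]%classic); last first.
  apply/seteqP; split => [t /=|t [k _ /=]]; rewrite !in_itv/= ?andbT; last by case/andP.
  move=> ta; exists (Num.truncn (t - a)) => //=; rewrite in_itv/= ta/= -lerBlDl.
  exact/ltW/truncnS_gt.
rewrite -(cvg_lim _ cv)//; apply: lime_le; first by apply/cvg_ex; eexists; exact: cv.
apply: nearW => k.
have E : \int[lebesgue_measure]_(t in `[a, (a + k.+1%:R)%R]) (t `^ (- p))%:E =
    (((a + k.+1%:R) `^ (1 - p) - a `^ (1 - p)) / (1 - p))%:E.
  rewrite -integral_powR_itv ?subr_eq0 ?lt_eqF// ?ltrDl//.
  by apply: eq_integral => t _; congr (_ `^ _)%:E; ring.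
rewrite E.
have H (u v : R) : (0 <= u -> (u - v) / (1 - p) <= v / (p - 1))%R.
  move=> u0; rewrite (_ : (u - v) / (1 - p) = (v - u) / (p - 1))%R.
    by rewrite ler_pM2r ?invr_gt0 ?subr_gt0// gerBl.
  by rewrite -opprB -[(1 - p)%R]opprB invrN mulrNN.
by rewrite lee_fin H// powR_ge0.
Qed.

Section weak_hoelder.
Context d (T : measurableType d) (R : realType)
  (mu : {sigma_finite_measure set T -> \bar R}).
Implicit Types (f b k : T -> \bar R) (A : set T).

Lemma measurable_superlevel f (t : R) : measurable_fun setT f ->
  measurable [set x | t%:E < f x].
Proof. by move=> mf; rewrite -[X in measurable X]setTI; exact: emeasurable_fun_o_infty. Qed.

Lemma measurable_measure_superlevel f : measurable_fun setT f ->
  measurable_fun [set: measurableTypeR R] (fun t : R => mu [set x | t%:E < f x]).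
Proof.
move=> mf.
pose B : set (T * measurableTypeR R) := [set z | z.2%:E < f z.1].
have mB : measurable B.
  rewrite -[X in measurable X]setTI; apply: measurable_lte => //.
    by apply/measurable_EFinP; exact: measurable_snd.
  exact: measurableT_comp.
have := measurable_fun_ysection mu mB.
by congr measurable_fun; apply/funext => t; rewrite /= ysectionE.
Qed.

(** By the layer-cake formula the integral is that of [phi], the measure of the part of [A] where
    [k > t]. It is at most [mu A] and at most [(W/t)^p]; each bound is used where it is the smaller
    one. *)
Lemma weak_Lp_integral (p W : R) A k : (1 < p)%R -> (0 <= W)%R ->
  measurable A -> mu A < +oo -> measurable_fun setT k -> (forall x, 0 <= k x) ->
  (forall t : R, (0 < t)%R ->
    t%:E * mu (A `&` [set x | t%:E < k x]) `^ p^-1 <= W%:E) ->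
  \int[mu]_(x in A) k x <= (p / (p - 1) * W)%:E * mu A `^ (1 - p^-1).
Proof.
move=> p1 W0 mA Aoo mk k0 kW.
have p0 : (0 < p)%R by exact: lt_trans p1.
pose phi (t : R) := mu (A `&` [set x | t%:E < k x]).
have mphi : measurable_fun [set: measurableTypeR R] phi.
  have mf : measurable_fun setT (fun x => k x * (\1_A x)%:E).
    by apply: emeasurable_funM => //; apply/measurable_EFinP; exact: measurable_indic.
  (* For [t < 0] the set is all of [A]; for [t >= 0] it is a superlevel set of [k] times the
     indicator of [A]. *)
  apply: (@eq_measurable_fun _ _ _ _ _ (fun t : R =>
     if (t < 0)%R then mu A else mu [set x | t%:E < k x * (\1_A x)%:E])).
    move=> t _; case: ifPn => t0.
      congr (mu _); apply/seteqP; split => [x Ax|x []//]; split => //=.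
      by rewrite (lt_le_trans _ (k0 x))// lte_fin.
    congr (mu _); apply/seteqP; split => x /=.
      rewrite indicE; have [xA|xA] := boolP (x \in A).
        by rewrite mule1 => tk; split => //; exact: set_mem.
      by rewrite mule0 lte_fin => /lt_geF; rewrite leNgt (negbTE t0).
    by move=> [Ax tk]; rewrite indicE mem_set// mule1.
  apply: measurable_fun_ifT => //; first exact: measurable_fun_ltr.
  exact: measurable_measure_superlevel.
have -> : \int[mu]_(x in A) k x = \int[lebesgue_measure]_(t in `]0%R, +oo[) phi t.
  have mi : measurable_fun setT (fun x : T => (\1_A x)%:E : \bar R).
    by apply/measurable_EFinP; exact: measurable_indic.
  transitivity (\int[mu]_x (k x * (\1_A x)%:E)).
    rewrite integral_mkcond; apply: eq_integral => x _.
    by rewrite patchE indicE; case: ifPn => xA; rewrite ?mule1 ?mule0.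
  rewrite layer_cake//; apply: eq_integral => t _.
  by rewrite integral_indic//; exact: measurable_superlevel.
have phim t : phi t <= mu A by apply: le_measure; rewrite ?inE//;
  apply: measurableI => //; exact: measurable_superlevel.
have Afin : mu A \is a fin_num by rewrite ge0_fin_numE.
pose m := fine (mu A).
have mE : mu A = m%:E by rewrite fineK.
have m0 : (0 <= m)%R by exact: fine_ge0.
have phi0 t : 0 <= phi t by exact: measure_ge0.
have p1i : (1 - p^-1 != 0)%R by rewrite subr_eq0 eq_sym invr_eq1 gt_eqF.
have phiW t : (0 < t)%R -> phi t <= ((W / t) `^ p)%:E.
  move=> t0; have := kW t t0; rewrite -/(phi t).
  have : phi t \is a fin_num by rewrite ge0_fin_numE// (le_lt_trans (phim t)).
  have := phi0 t; case: (phi t) => // y; rewrite lee_fin => y0 _.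
  rewrite poweR_EFin -EFinM lee_fin => h.
  rewrite lee_fin -[y]powRr1// -(@mulVf _ p) ?gt_eqF// powRrM.
  rewrite ge0_ler_powR ?(ltW p0) ?nnegrE ?powR_ge0 ?divr_ge0 ?(ltW t0)//.
  by rewrite ler_pdivlMr// mulrC.
(* These two cases are set aside because the splitting point [t0] below has to be positive. *)
have phiz : (m = 0 \/ W = 0)%R -> \int[lebesgue_measure]_(t in `]0%R, +oo[) phi t = 0.
  move=> mW; apply: integral0_eq => t /=; rewrite in_itv/= andbT => t0.
  apply/eqP; rewrite eq_le phi0 andbT; case: mW => E.
    by apply: le_trans (phim t) _; rewrite mE E.
  by apply: le_trans (phiW t t0) _; rewrite E mul0r powR0// gt_eqF.
have rhs0 : 0 <= (p / (p - 1) * W)%:E * mu A `^ (1 - p^-1).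
  by rewrite mule_ge0 ?poweR_ge0// lee_fin mulr_ge0// divr_ge0 ?(ltW p0)// subr_ge0 ltW.
have [m1|m1] := eqVneq m 0%R; first by rewrite phiz//; left.
have [W1|W1] := eqVneq W 0%R; first by rewrite phiz//; right.
have {m0 m1} m0 : (0 < m)%R by rewrite lt0r m1.
have {W0 W1} W0 : (0 < W)%R by rewrite lt0r W1.
(* The level at which the two bounds agree: [(W / t0)^p = m]. *)
pose t0 := (W * m `^ (- p^-1))%R.
have t00 : (0 < t0)%R by rewrite mulr_gt0// powR_gt0.
rewrite (_ : `]0%R, +oo[%classic = `]0%R, t0]%classic `|` `]t0, +oo[%classic); last first.
  by rewrite -itv_bndbnd_setU ?bnd_simp// ltW.
rewrite ge0_integral_setU//=; last 2 first.
- exact: measurable_funTS.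
- apply/disj_setPS => t [/=]; rewrite !in_itv/= andbT => /andP[_ h1] h2.
  by move: (lt_le_trans h2 h1); rewrite ltxx.
apply: (@le_trans _ _ ((m * t0)%:E + (W `^ p)%:E * (t0 `^ (1 - p) / (p - 1))%:E)).
  apply: leeD.
    apply: (@le_trans _ _ (\int[lebesgue_measure]_(t in `]0%R, t0]) m%:E)).
      apply: ge0_le_integral => //; first exact: measurable_funTS.
      by move=> t _; rewrite -mE.
    have Em : lebesgue_measure (`]0%R, t0]%classic : set R) = t0%:E.
      by rewrite lebesgue_measure_itv/= lte_fin t00 sube0.
    by rewrite integral_cst//; apply: (eq_ind_r (fun y => m%:E * y <= _) _ Em).
  apply: (@le_trans _ _ (\int[lebesgue_measure]_(t in `[t0, +oo[) ((W `^ p)%:E * (t `^ (- p))%:E))).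
    apply: (@le_trans _ _ (\int[lebesgue_measure]_(t in `]t0, +oo[) ((W `^ p)%:E * (t `^ (- p))%:E))).
      apply: ge0_le_integral => //.
      - exact: measurable_funTS.
      - apply: measurable_funTS; apply: measurable_funeM; apply/measurable_EFinP; exact: measurable_powR.
      - move=> t; rewrite /= in_itv/= andbT => tt; have tp : (0 < t)%R by exact: lt_trans tt.
        apply: le_trans (phiW t tp) _.
        rewrite -EFinM lee_fin powRM ?invr_ge0 ?(ltW tp) ?(ltW W0)//.
        by rewrite -(@powR_inv1 _ t) ?(ltW tp)// -powRrM mulN1r lexx.
    apply: ge0_subset_integral => //.
    - apply: measurable_funTS; apply: measurable_funeM; apply/measurable_EFinP; exact: measurable_powR.
    - by move=> t _; rewrite -EFinM lee_fin mulr_ge0 ?powR_ge0.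
    - by move=> t /=; rewrite !in_itv/= !andbT => /ltW.
  rewrite ge0_integralZl_EFin ?powR_ge0//.
  - by rewrite lee_wpmul2l ?lee_fin ?powR_ge0//; exact: integral_powR_nearoo.
  - by move=> t _; rewrite lee_fin powR_ge0.
  - by apply: measurable_funTS; apply/measurable_EFinP; exact: measurable_powR.
rewrite mE poweR_EFin -!EFinM -EFinD lee_fin /t0.
have E1 : (m * (W * m `^ (- p^-1)) = W * m `^ (1 - p^-1))%R.
  by rewrite mulrCA -{1}[m]powRr1 ?(ltW m0)// -powRD// (gt_eqF m0) implybT.
have E2 : (W `^ p * (W * m `^ (- p^-1)) `^ (1 - p) = W * m `^ (1 - p^-1))%R.
  rewrite powRM ?(ltW W0) ?powR_ge0// mulrA -powRD ?(gt_eqF W0) ?implybT//.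
  rewrite addrC subrK powRr1 ?(ltW W0)// -powRrM; congr (_ * _ `^ _)%R.
  by field; rewrite gt_eqF.
(* Both pieces are multiples of [W m^(1-1/p)], with factors 1 and [1/(p-1)], which add up to
   [p/(p-1)]. *)
rewrite E1 mulrA E2 le_eqVlt; apply/orP; left; apply/eqP.
have pn : (p - 1 != 0)%R by rewrite subr_eq0 gt_eqF.
by field.
Qed.

End weak_hoelder.

Section lorentz.
Context d (T : measurableType d) (R : realType)
  (mu : {sigma_finite_measure set T -> \bar R}).
Implicit Types (f b k : T -> \bar R) (A : set T) (r q p : R).

(** The integral under the root in the quasi-norm of L^{r,q}, over an arbitrary measure space; on
    R^n it is convertible to the one in [Lorentz_norm]. *)
Definition lorentz_integral r q b : \bar R :=
  \int[lebesgue_measure]_(t in `]0%R, +oo[)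
    ((mu [set x | t%:E < `|b x|]) `^ (q / r) * (t `^ q / t)%:E).

Lemma lorentz_integral_ge0 r q b : 0 <= lorentz_integral r q b.
Proof.
apply: integral_ge0 => t; rewrite /= in_itv/= andbT => t0.
by rewrite mule_ge0 ?poweR_ge0// lee_fin divr_ge0 ?powR_ge0// ltW.
Qed.

Lemma measurable_layer f k : measurable_fun setT f ->
  measurable_fun setT k -> (forall x, 0 <= k x) ->
  measurable_fun [set: measurableTypeR R] (fun t : R => \int[mu]_(x in [set x | t%:E < f x]) k x).
Proof.
move=> mf mk k0.
pose B : set (T * measurableTypeR R) := [set z | z.2%:E < f z.1].
have mB : measurable B.
  rewrite -[X in measurable X]setTI; apply: measurable_lte => //.
    by apply/measurable_EFinP; exact: measurable_snd.
  exact: measurableT_comp.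
pose F (z : T * measurableTypeR R) : \bar R := (\1_B z)%:E * k z.1.
have mF : measurable_fun setT F.
  apply: emeasurable_funM; last exact: measurableT_comp.
  by apply/measurable_EFinP; exact: measurable_indic.
have F0 z : 0 <= F z by rewrite mule_ge0// lee_fin.
have := @measurable_fun_fubini_tonelli_G _ _ T (measurableTypeR R) R mu F mF F0.
congr measurable_fun; apply/funext => t; rewrite [RHS]integral_mkcond.
apply: eq_integral => x _; rewrite patchE /F/= indicE; case: ifPn => fx.
  by rewrite mem_set ?mul1e//; exact: set_mem fx.
by rewrite memNset ?mul0e//; move: fx; rewrite notin_setE.
Qed.

Lemma measurable_lorentz_integrand r q b : measurable_fun setT b ->
  measurable_fun (`]0%R, +oo[%classic : set (measurableTypeR R)) (fun t : R =>
    (mu [set x | t%:E < `|b x|]) `^ (q / r) * (t `^ q / t)%:E).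
Proof.
move=> mb; apply: (@eq_measurable_fun _ _ _ _ _ (fun t : R =>
    (mu [set x | t%:E < `|b x|]) `^ (q / r) * (t `^ q * t `^ (-1))%:E)).
  by move=> t; rewrite inE/= in_itv/= andbT => t0; rewrite powR_inv1// ltW.
apply: measurable_funTS; apply: emeasurable_funM.
  apply: (measurableT_comp (measurable_poweR _)).
  by apply: measurable_measure_superlevel; exact: measurableT_comp.
by apply/measurable_EFinP; apply: measurable_funM; exact: measurable_powR.
Qed.

Lemma le_superlevel b (t u : R) : measurable_fun setT b -> (t <= u)%R ->
  mu [set x | u%:E < `|b x|] <= mu [set x | t%:E < `|b x|].
Proof.
move=> mb tu; have mab : measurable_fun setT (fun x => `|b x|) by exact: measurableT_comp.
apply: le_measure; rewrite ?inE; [exact: measurable_superlevel|exact: measurable_superlevel|].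
by move=> x /=; apply: le_lt_trans; rewrite lee_fin.
Qed.

(** Since [q <= 1], the integrand is nonincreasing in the level: on []0, t]] it is at least its
    value at [t], and the interval has length [t]. *)
Lemma lorentz_chebyshev r q b t : (0 < r)%R -> (0 < q)%R -> (q <= 1)%R ->
  measurable_fun setT b -> (0 < t)%R ->
  (mu [set x | t%:E < `|b x|]) `^ (q / r) * (t `^ q)%:E <= lorentz_integral r q b.
Proof.
move=> r0 q0 q1 mb t0.
apply: (@le_trans _ _ (\int[lebesgue_measure]_(u in `]0%R, t])
    ((mu [set x | u%:E < `|b x|]) `^ (q / r) * (u `^ q / u)%:E))); last first.
  apply: ge0_subset_integral => //.
  - exact: measurable_lorentz_integrand.
  - move=> u /=; rewrite in_itv/= andbT => u0.
    by rewrite mule_ge0 ?poweR_ge0// lee_fin divr_ge0 ?powR_ge0// ltW.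
  - by move=> u /=; rewrite !in_itv/= andbT => /andP[].
have Em : lebesgue_measure (`]0%R, t]%classic : set R) = t%:E.
  by rewrite lebesgue_measure_itv/= lte_fin t0 sube0.
pose c : \bar R := (mu [set x | t%:E < `|b x|]) `^ (q / r) * (t `^ q / t)%:E.
have c0 : 0 <= c by rewrite mule_ge0 ?poweR_ge0// lee_fin divr_ge0 ?powR_ge0// ltW.
have cE : (mu [set x | t%:E < `|b x|]) `^ (q / r) * (t `^ q)%:E = c * t%:E.
  by rewrite -muleA -EFinM divfK ?gt_eqF.
rewrite cE; have -> : c * t%:E = \int[lebesgue_measure]_(u in `]0%R, t]) c.
  by rewrite integral_cst//; apply: (eq_ind_r (fun y => _ = c * y) _ Em).
apply: ge0_le_integral => //.
- apply: measurable_funS (measurable_lorentz_integrand _ _ mb) => //.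
  by move=> u /=; rewrite !in_itv/= andbT => /andP[].
- move=> u /=; rewrite in_itv/= => /andP[u0 ut].
  apply: lee_pmul; rewrite ?poweR_ge0//.
  + by rewrite lee_fin divr_ge0 ?powR_ge0// ltW.
  + apply: gt0_ler_poweR; rewrite ?in_itv/= ?andbT ?measure_ge0 ?leey//; last exact: le_superlevel.
    by rewrite divr_ge0 ?(ltW q0) ?(ltW r0).
  + have powE v : (0 < v)%R -> (v `^ q / v = v `^ (q - 1))%R.
      by move=> v0; rewrite powRB ?(gt_eqF v0) ?implybT// powRr1 ?ltW.
    rewrite lee_fin !powE// -opprB !powRN lef_pV2 ?posrE ?powR_gt0//.
    by rewrite ge0_ler_powR ?nnegrE ?(ltW u0) ?(ltW t0)// subr_ge0.
Qed.

Lemma lorentz_superlevel_lty r q b t : (0 < r)%R -> (0 < q)%R -> (q <= 1)%R ->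
  measurable_fun setT b -> lorentz_integral r q b < +oo -> (0 < t)%R ->
  mu [set x | t%:E < `|b x|] < +oo.
Proof.
move=> r0 q0 q1 mb Joo t0.
have := le_lt_trans (lorentz_chebyshev r0 q0 q1 mb t0) Joo.
rewrite !ltey; apply: contraNneq => ->.
by rewrite poweRyr ?gt0_mulye ?lte_fin ?powR_gt0// mulf_neq0 ?invr_neq0// gt_eqF.
Qed.

(* Trading the exponent 1 for q costs the factor [(y t)^(1-q)], bounded since [q <= 1]. *)
Lemma le_powR_interpolation (y t j q : R) : (0 <= y)%R -> (0 < t)%R ->
  (0 < q)%R -> (q <= 1)%R -> ((y * t) `^ q <= j)%R ->
  (y <= j `^ ((1 - q) / q) * (y `^ q * (t `^ q / t)))%R.
Proof.
move=> y0 t0 q0 q1 yj.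
have j0 : (0 <= j)%R by apply: le_trans yj; exact: powR_ge0.
have [->|yn] := eqVneq y 0%R; first by rewrite !mulr_ge0 ?powR_ge0// invr_ge0 ltW.
have {y0}yn : (0 < y)%R by rewrite lt0r yn.
have h : ((y * t) `^ (1 - q) <= j `^ ((1 - q) / q))%R.
  have -> : ((1 - q) / q = q^-1 * (1 - q))%R by rewrite mulrC.
  rewrite powRrM.
  rewrite ge0_ler_powR ?subr_ge0 ?nnegrE ?powR_ge0 ?mulr_ge0 ?(ltW yn) ?(ltW t0)//.
  have : (((y * t) `^ q) `^ q^-1 <= j `^ q^-1)%R.
    by rewrite ge0_ler_powR ?nnegrE ?powR_ge0 ?invr_ge0 ?(ltW q0).
  by rewrite -powRrM mulfV ?gt_eqF// powRr1// mulr_ge0 ?ltW.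
have t1 : (0 <= y `^ q * (t `^ q / t))%R.
  by rewrite !mulr_ge0 ?powR_ge0// invr_ge0 ltW.
apply: le_trans (ler_wpM2r t1 h).
rewrite powRM ?(ltW yn) ?(ltW t0)//.
rewrite [leRHS](_ : _ = (y `^ (1 - q) * y `^ q) * (t `^ (1 - q) * t `^ q) / t)%R; last by ring.
rewrite -!powRD ?(gt_eqF yn) ?(gt_eqF t0) ?implybT// !subrK.
by rewrite (powRr1 (ltW yn)) (powRr1 (ltW t0)) mulfK ?gt_eqF.
Qed.

(** With [r = p/(p-1)] and [j] the Lorentz integral of [b]: at level [t] of [|b|],
    [weak_Lp_integral] bounds the integral of [|k|] by [r W phi(t)^(1/r)]; interpolation turns this
    into [r W j^((1-q)/q)] times the Lorentz integrand, and [(1-q)/q + 1 = 1/q]. *)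
Lemma weak_hoelder (p q W : R) b k : (1 < p)%R -> (0 < q)%R -> (q <= 1)%R ->
  (0 <= W)%R -> measurable_fun setT b -> measurable_fun setT k ->
  (forall t : R, (0 < t)%R ->
    t%:E * mu ([set x | b x != 0] `&` [set x | t%:E < `|k x|]) `^ p^-1 <= W%:E) ->
  lorentz_integral (p / (p - 1)) q b < +oo ->
  \int[mu]_x (`|b x| * `|k x|) <=
    (p / (p - 1) * W)%:E * (lorentz_integral (p / (p - 1)) q b) `^ q^-1.
Proof.
move=> p1 q0 q1 W0 mb mk kW Joo.
set r := (p / (p - 1))%R.
have p0 : (0 < p)%R by exact: lt_trans p1.
have r0 : (0 < r)%R by rewrite divr_gt0// subr_gt0.
have rE : (1 - p^-1 = r^-1)%R.
  by rewrite /r invfM invrK mulrBr mulVf ?gt_eqF// mulr1.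
have mab : measurable_fun setT (fun x => `|b x|) by exact: measurableT_comp.
have mak : measurable_fun setT (fun x => `|k x|) by exact: measurableT_comp.
have J0 := lorentz_integral_ge0 r q b.
have Jfin : lorentz_integral r q b \is a fin_num by rewrite ge0_fin_numE.
pose j := fine (lorentz_integral r q b).
have jE : lorentz_integral r q b = j%:E by rewrite fineK.
have j0 : (0 <= j)%R by exact: fine_ge0.
pose phi (t : R) := mu [set x | t%:E < `|b x|].
have phi0 t : 0 <= phi t by exact: measure_ge0.
rewrite layer_cake//.
have rW0 : 0 <= (r * W)%:E by rewrite lee_fin mulr_ge0// ltW.
have c0 : (0 <= r * W * j `^ ((1 - q) / q))%R.
  by rewrite mulr_ge0 ?powR_ge0// mulr_ge0// ltW.
apply: (@le_trans _ _ (\int[lebesgue_measure]_(t in `]0%R, +oo[)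
   ((r * W * j `^ ((1 - q) / q))%:E * (phi t `^ (q / r) * (t `^ q / t)%:E)))).
  apply: ge0_le_integral => //.
  - by move=> t _; exact: integral_ge0.
  - by apply: measurable_funTS; exact: measurable_layer.
  - by apply: measurable_funeM; exact: measurable_lorentz_integrand.
  - move=> t /=; rewrite in_itv/= andbT => t0.
    have phioo : phi t < +oo by exact: lorentz_superlevel_lty Joo t0.
    have mS : measurable [set x | t%:E < `|b x|] by exact: measurable_superlevel.
    apply: (@le_trans _ _ ((r * W)%:E * phi t `^ (1 - p^-1))).
      apply: weak_Lp_integral => // u u0.
      apply: le_trans (kW u u0); rewrite lee_wpmul2l ?lee_fin ?(ltW u0)//.
      apply: gt0_ler_poweR; rewrite ?in_itv/= ?andbT ?measure_ge0 ?leey ?invr_ge0 ?(ltW p0)//.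
      apply: le_measure; rewrite ?inE.
      + by apply: measurableI => //; exact: measurable_superlevel.
      + apply: measurableI; last exact: measurable_superlevel.
        by rewrite -[X in measurable X]setTI; exact: emeasurable_neq.
      + apply: setSI => x /= tb; apply: contraTneq tb => ->.
        by rewrite abse0 -leNgt lee_fin ltW.
    rewrite (EFinM (r * W)) -muleA lee_wpmul2l//.
    have := lorentz_chebyshev r0 q0 q1 mb t0.
    rewrite -/(phi t) jE rE; have : phi t \is a fin_num by rewrite ge0_fin_numE.
    have := phi0 t; case: (phi t) => // y; rewrite lee_fin => y0 _.
    rewrite !poweR_EFin -!EFinM !lee_fin => yj.
    have yE : (y `^ (q / r) = (y `^ r^-1) `^ q)%R by rewrite -powRrM mulrC.
    rewrite yE; apply: le_powR_interpolation; rewrite ?powR_ge0//.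
    by rewrite powRM ?powR_ge0 ?(ltW t0)// -yE.
rewrite ge0_integralZl_EFin//; last 2 first.
- move=> t /=; rewrite in_itv/= andbT => t0.
  by rewrite mule_ge0 ?poweR_ge0// lee_fin divr_ge0 ?powR_ge0// ltW.
- exact: measurable_lorentz_integrand.
rewrite -/(lorentz_integral r q b) jE poweR_EFin -!EFinM lee_fin -(mulrA (r * W)%R).
rewrite ler_wpM2l//.
have [->|jn] := eqVneq j 0%R; first by rewrite mulr0 powR_ge0.
have jn0 : (j == 0)%R = false by exact/negbTE.
rewrite -{2}[j]powRr1// -powRD ?jn0 ?implybT//.
by rewrite (_ : (1 - q) / q + 1 = q^-1)%R// mulrBl mul1r mulfV ?gt_eqF// subrK.
Qed.

End lorentz.

(** * Truncation and homogeneity of Lorentz integrals *)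

Section lorentz_estimates.
Context d (T : measurableType d) (R : realType)
  (mu : {sigma_finite_measure set T -> \bar R}).
Implicit Types (b : T -> \bar R) (A : set T) (r q a : R).

(** Levels from [a] on are empty, every lower one has measure at most [mu A], and [t^(q-1)]
    integrates to at most [a^q / q] over []0, a]]. *)
Lemma lorentz_integral_bounded r q a A b : (0 < r)%R -> (0 < q)%R -> (0 < a)%R ->
  measurable A -> measurable_fun setT b ->
  (forall x, `|b x| <= a%:E * (\1_A x)%:E) ->
  lorentz_integral mu r q b <= mu A `^ (q / r) * (a `^ q / q)%:E.
Proof.
move=> r0 q0 a0 mA mb bA.
have mab : measurable_fun setT (fun x => `|b x|) by exact: measurableT_comp.
have bA' t : (0 < t)%R -> [set x | t%:E < `|b x|] `<=` A.
  move=> t0 x /= tb; apply: contrapT => Ax; have := lt_le_trans tb (bA x).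
  by rewrite indicE memNset// mule0 lte_fin ltNge (ltW t0).
have ba t : (a <= t)%R -> [set x | t%:E < `|b x|] = set0.
  move=> at_; apply/seteqP; split => // x /= tb; have := lt_le_trans tb (bA x).
  apply/negP; rewrite -leNgt; apply: (@le_trans _ _ a%:E); last by rewrite lee_fin.
  by rewrite -EFinM lee_fin ler_piMr ?(ltW a0)// indicE; case: (_ \in _).
apply: (@le_trans _ _ (\int[lebesgue_measure]_(t in `]0%R, a]) (mu A `^ (q / r) * (t `^ (q - 1))%:E))).
  rewrite /lorentz_integral [leLHS]integral_mkcond [leRHS]integral_mkcond.
  apply: ge0_le_integral => //.
  - move=> t _; rewrite patchE; case: ifPn => // /set_mem/=; rewrite in_itv/= andbT => t0.
    by rewrite mule_ge0 ?poweR_ge0// lee_fin divr_ge0 ?powR_ge0// ltW.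
  - by apply/(measurable_restrict _ _ _) => //; rewrite setTI; exact: measurable_lorentz_integrand.
  - apply/(measurable_restrict _ _ _) => //; rewrite setTI; apply: measurable_funTS.
    by apply: emeasurable_funM => //; apply/measurable_EFinP; exact: measurable_powR.
  - move=> t _; rewrite !patchE; case: ifPn => tD; last first.
      by case: ifPn => // _; rewrite mule_ge0 ?poweR_ge0// lee_fin powR_ge0.
    have t0 : (0 < t)%R by have := set_mem tD; rewrite /= in_itv/= andbT.
    case: ifPn => ta.
      rewrite (_ : t `^ q / t = t `^ (q - 1))%R; last first.
        by rewrite powRB ?(gt_eqF t0) ?implybT// powRr1// ltW.
      rewrite lee_wpmul2r ?lee_fin ?powR_ge0//.
      apply: gt0_ler_poweR; rewrite ?in_itv/= ?andbT ?measure_ge0 ?leey//.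
        by rewrite divr_ge0 ?(ltW q0) ?(ltW r0).
      by apply: le_measure; rewrite ?inE//; [exact: measurable_superlevel|exact: bA'].
    rewrite ba ?measure0 ?poweR0r ?mul0e// ?mulf_neq0 ?invr_neq0 ?gt_eqF//.
    move: ta; rewrite notin_setE/= in_itv/= t0/= => /negP; rewrite -ltNge; exact: ltW.
rewrite ge0_integralZl//.
- by rewrite lee_wpmul2l ?poweR_ge0//; exact: integral_powR_near0.
- by apply: measurable_funTS; apply/measurable_EFinP; exact: measurable_powR.
- by move=> t _; rewrite lee_fin powR_ge0.
- exact: poweR_ge0.
Qed.

Definition superlevel_restr b (j : nat) (x : T) : \bar R :=
  b x * (\1_[set x : T | (j%:R%:E < `|b x|)%E] x)%:E.

Lemma measurable_superlevel_restr b j : measurable_fun setT b ->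
  measurable_fun setT (superlevel_restr b j).
Proof.
move=> mb; apply: emeasurable_funM => //; apply/measurable_EFinP.
by apply: measurable_indic; apply: measurable_superlevel; exact: measurableT_comp.
Qed.

(** Dominated convergence in the level variable: the integrand of [b] dominates, and at each fixed
    level Chebyshev's inequality at height [j] gives decay like [j^(-q)]. *)
Lemma lorentz_integral_truncation r q b (e : R) : (0 < r)%R -> (0 < q)%R -> (q <= 1)%R ->
  measurable_fun setT b -> lorentz_integral mu r q b < +oo -> (0 < e)%R ->
  exists j, lorentz_integral mu r q (superlevel_restr b j) <= e%:E.
Proof.
move=> r0 q0 q1 mb Joo e0.
have mab : measurable_fun setT (fun x => `|b x|) by exact: measurableT_comp.
pose D : set (measurableTypeR R) := `]0%R, +oo[%classic.
pose h (j : nat) (t : R) := (mu [set x | t%:E < `|superlevel_restr b j x|]) `^ (q / r) * (t `^ q / t)%:E.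
pose g (t : R) := (mu [set x | t%:E < `|b x|]) `^ (q / r) * (t `^ q / t)%:E.
have g0 t : D t -> 0 <= g t.
  rewrite /D/= in_itv/= andbT => t0.
  by rewrite mule_ge0 ?poweR_ge0// lee_fin divr_ge0 ?powR_ge0// ltW.
have h0 j t : D t -> 0 <= h j t.
  rewrite /D/= in_itv/= andbT => t0.
  by rewrite mule_ge0 ?poweR_ge0// lee_fin divr_ge0 ?powR_ge0// ltW.
have hg j t : D t -> h j t <= g t.
  rewrite /D/= in_itv/= andbT => t0; rewrite lee_wpmul2r//.
    by rewrite lee_fin divr_ge0 ?powR_ge0// ltW.
  apply: gt0_ler_poweR; rewrite ?in_itv/= ?andbT ?measure_ge0 ?leey//.
    by rewrite divr_ge0 ?(ltW q0) ?(ltW r0).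
  apply: le_measure; rewrite ?inE.
  - by apply: measurable_superlevel; apply: measurableT_comp => //; exact: measurable_superlevel_restr.
  - exact: measurable_superlevel.
  - move=> x /=; rewrite /superlevel_restr indicE; case: (_ \in _); first by rewrite mule1.
    by rewrite mule0 abse0 lte_fin ltNge (ltW t0).
(* The index is shifted because Chebyshev's inequality needs a positive height. *)
have hJ j t : D t -> h j.+1 t <= lorentz_integral mu r q b * ((j.+1%:R `^ q)^-1 * (t `^ q / t))%:E.
  rewrite /D/= in_itv/= andbT => t0; rewrite EFinM muleA lee_wpmul2r//.
    by rewrite lee_fin divr_ge0 ?powR_ge0// ltW.
  have j0 : (0 < j.+1%:R :> R)%R by rewrite ltr0n.
  rewrite lee_pdivlMr ?powR_gt0//.
  apply: le_trans (lorentz_chebyshev mu r0 q0 q1 mb j0).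
  rewrite lee_wpmul2r ?lee_fin ?powR_ge0//.
  apply: gt0_ler_poweR; rewrite ?in_itv/= ?andbT ?measure_ge0 ?leey//.
    by rewrite divr_ge0 ?(ltW q0) ?(ltW r0).
  apply: le_measure; rewrite ?inE.
  - by apply: measurable_superlevel; apply: measurableT_comp => //; exact: measurable_superlevel_restr.
  - exact: measurable_superlevel.
  - move=> x /=; rewrite /superlevel_restr indicE; case: (boolP (_ \in _)) => [/set_mem//|_].
    by rewrite mule0 abse0 lte_fin ltNge (ltW t0).
have mh j : measurable_fun D (h j).
  by apply: measurable_lorentz_integrand; exact: measurable_superlevel_restr.
have mg : measurable_fun D g by exact: measurable_lorentz_integrand.
have ig : lebesgue_measure.-integrable D g.
  apply/integrableP; split => //.
  apply: le_lt_trans Joo; rewrite le_eqVlt; apply/orP; left; apply/eqP.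
  by apply: eq_integral => t /set_mem Dt; rewrite gee0_abs//; exact: g0.
have Jfin : lorentz_integral mu r q b \is a fin_num.
  by rewrite ge0_fin_numE// lorentz_integral_ge0.
have hcv t : D t -> h j t @[j --> \oo] --> 0.
  move=> Dt; have t0 : (0 < t)%R by move: Dt; rewrite /D/= in_itv/= andbT.
  suff : h j.+1 t @[j --> \oo] --> 0 by rewrite (cvg_shiftS (h^~ t)).
  apply: (@squeeze_cvge _ _ _ _ (cst 0) (fun j => h j.+1 t)
    (fun j => lorentz_integral mu r q b * ((j.+1%:R `^ q)^-1 * (t `^ q / t))%:E)).
  - by apply: nearW => j; rewrite h0//= hJ.
  - exact: cvg_cst.
  - rewrite -(mule0 (lorentz_integral mu r q b)); apply: cvgeZl => //.
    apply/fine_cvgP; split; first exact: nearW.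
    rewrite [X in _ --> X](_ : 0%R = 0 * (t `^ q / t))%R; last by rewrite mul0r.
    apply: (@cvgMr_tmp R nat _ _ (fun j : nat => (j.+1%:R `^ q)^-1)%R 0%R (t `^ q / t)%R).
    apply/cvgrPdist_le => /= u u0.
    have [m _ hm] := near_infty_natSinv_lt (PosNum (powR_gt0 q^-1 u0)).
    exists m => // j /hm /= jm; rewrite sub0r normrN ger0_norm ?invr_ge0 ?powR_ge0//.
    rewrite -(@powR_inv1 _ (_ `^ q)) ?powR_ge0// -powRrM mulrC powRrM powR_inv1//.
    have uE : (u = (u `^ q^-1) `^ q)%R by rewrite -powRrM mulVf ?gt_eqF// powRr1// ltW.
    rewrite {1}uE.
    by rewrite ge0_ler_powR ?nnegrE ?powR_ge0 ?invr_ge0 ?(ltW q0)// ltW.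
have mD : measurable D by exact: measurable_itv.
pose z : measurableTypeR R -> \bar R := cst 0.
have H1 : {ae lebesgue_measure, forall t, D t -> h ^~ t @ \oo --> z t}.
  by apply: aeW => t; exact: hcv.
have H2 : {ae lebesgue_measure, forall t j, D t -> `|h j t| <= g t}.
  by apply: aeW => t j Dt; rewrite gee0_abs ?hg// h0.
have [_ _] := dominated_convergence mD mh (measurable_cst 0 : measurable_fun D z) H1 ig H2.
rewrite integral_cst// mul0e => /fine_cvgP[Df /cvgrPdist_le/(_ e e0) cv].
near \oo => j; exists j.
have fj : \int[lebesgue_measure]_(t in D) h j t \is a fin_num by near: j; exact: Df.
have : (`|0 - fine (\int[lebesgue_measure]_(t in D) h j t)| <= e)%R by near: j.
by rewrite sub0r normrN => /(le_trans (ler_norm _)); rewrite -lee_fin fineK.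
Unshelve. all: by end_near. Qed.

End lorentz_estimates.

Lemma lebesgue_measure_scale (R : realType) (c : {posnum R}) (A : set R) :
  measurable A ->
  lebesgue_measure A = c%:num%:E *
    pushforward lebesgue_measure ((fun y => c%:num * y)%R : _ -> measurableTypeR R) A.
Proof.
move=> mA.
have mr : measurable_fun [set: measurableTypeR R]
    ((fun y => c%:num * y)%R : _ -> measurableTypeR R).
  exact: mulrl_measurable.
pose r : {mfun measurableTypeR R >-> measurableTypeR R} :=
  HB.pack ((fun y => c%:num * y)%R : measurableTypeR R -> measurableTypeR R)
    (isMeasurableFun.Build _ _ _ _ _ mr).
apply: (@lebesgue_measure_unique _ (mscale (c%:num%:nng)%R (pushforward lebesgue_measure r)))
  => //= _ [[a b]] _ <-.
rewrite /mscale/= /pushforward/=.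
have -> : (fun y => c%:num * y)%R @^-1` `]a, b]%classic = `](c%:num^-1 * a)%R, (c%:num^-1 * b)%R]%classic.
  by apply/seteqP; split => x /=; rewrite !in_itv/= ltr_pdivrMl// ler_pdivlMl.
rewrite !lebesgue_measure_itv/= !lte_fin ltr_pM2l ?invr_gt0//; case: ifPn => ab; last by rewrite mule0.
by rewrite -!EFinB -EFinM -mulrBr mulVKf.
Qed.

Lemma ge0_integral_scale (R : realType) (c : {posnum R}) (f : R -> \bar R) :
  measurable_fun (`]0%R, +oo[%classic : set (measurableTypeR R)) f ->
  (forall t, (0 < t)%R -> 0 <= f t) ->
  \int[lebesgue_measure]_(t in `]0%R, +oo[) f t =
  c%:num%:E * \int[lebesgue_measure]_(t in `]0%R, +oo[) f (c%:num * t)%R.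
Proof.
move=> mf f0.
have mr : measurable_fun [set: measurableTypeR R]
    ((fun y => c%:num * y)%R : measurableTypeR R -> measurableTypeR R).
  exact: mulrl_measurable.
pose D : set (measurableTypeR R) := `]0%R, +oo[%classic.
have mD : measurable D by exact: measurable_itv.
have f0' : {in D, forall t, 0 <= f t}.
  by move=> t /set_mem; rewrite /D/= in_itv/= andbT; exact: f0.
have := @ge0_integral_pushforward _ _ _ _ _ _ mr lebesgue_measure D f mD mf f0'.
rewrite (_ : _ @^-1` D = D); last first.
  by apply/seteqP; split => t; rewrite /D/= !in_itv/= !andbT pmulr_rgt0.
move=> <-; rewrite -(ge0_integral_mscale _ mD (c%:num%:nng)%R mf); last first.
  by move=> t Dt; apply: f0'; exact/mem_set.
by apply: eq_measure_integral => A mA _; exact: lebesgue_measure_scale.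
Qed.

(** Substitute [c t] for [t]: the measure [dt/t] is invariant and [t^q] produces [c^q]. *)
Lemma lorentz_integral_scale d (T : measurableType d) (R : realType)
    (mu : {sigma_finite_measure set T -> \bar R}) (r q : R) (c : {posnum R}) (b : T -> \bar R) :
  measurable_fun setT b ->
  lorentz_integral mu r q (fun x => c%:num%:E * b x) =
  (c%:num `^ q)%:E * lorentz_integral mu r q b.
Proof.
move=> mb.
have mcb : measurable_fun setT (fun x => c%:num%:E * b x) by exact: measurable_funeM.
rewrite /lorentz_integral (ge0_integral_scale c); last 2 first.
- exact: measurable_lorentz_integrand.
- by move=> t t0; rewrite mule_ge0 ?poweR_ge0// lee_fin divr_ge0 ?powR_ge0// ltW.
rewrite -ge0_integralZl_EFin//; last 2 first.
- move=> t; rewrite /= in_itv/= andbT => t0.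
  by rewrite mule_ge0 ?poweR_ge0// lee_fin divr_ge0 ?powR_ge0// mulr_ge0// ltW.
- pose D : set (measurableTypeR R) := `]0%R, +oo[%classic.
  have mD : measurable D by exact: measurable_itv.
  have sD : (fun t => c%:num * t)%R @` D `<=` D.
    by move=> _ [t + <-]; rewrite /D/= !in_itv/= !andbT pmulr_rgt0.
  have mc : measurable_fun D (fun t : measurableTypeR R => c%:num * t : measurableTypeR R)%R.
    by apply: measurable_funTS; exact: mulrl_measurable.
  exact: (measurable_comp mD sD (measurable_lorentz_integrand mu r q mcb) mc).
rewrite -ge0_integralZl_EFin ?powR_ge0//; last 2 first.
- move=> t; rewrite /= in_itv/= andbT => t0.
  by rewrite mule_ge0 ?poweR_ge0// lee_fin divr_ge0 ?powR_ge0// ltW.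
- exact: measurable_lorentz_integrand.
apply: eq_integral => t /set_mem; rewrite /= in_itv/= andbT => t0.
rewrite muleCA [RHS]muleCA -EFinM; congr (mu _ `^ _ * _%:E).
  apply/seteqP; split => x /=; rewrite abseM (@gee0_abs _ c%:num%:E) ?lee_fin// EFinM lte_pmul2l//.
by rewrite powRM ?(ltW t0)//; field; rewrite !gt_eqF.
Qed.

(** * Densities of additive set functions *)

Lemma charge_density d (T : measurableType d) (R : realType)
    (mu : {sigma_finite_measure set T -> \bar R}) (nu : set T -> \bar R) :
  nu set0 = 0 -> (forall A, measurable A -> nu A \is a fin_num) ->
  semi_sigma_additive nu -> (forall A, measurable A -> mu A = 0 -> nu A = 0) ->
  exists f : T -> \bar R, mu.-integrable setT f /\
    forall A, measurable A -> nu A = \int[mu]_(x in A) f x.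
Proof.
move=> nu0 nufin nuadd numu.
pose nuC : {charge set T -> \bar R} := HB.pack nu (isCharge.Build _ _ _ nu nu0 nufin nuadd).
have dom : nuC `<< mu.
  apply/null_content_dominatesP => A mA A0; exact: numu.
exists (Radon_Nikodym nuC mu); split; first exact: Radon_Nikodym_integrable.
by move=> A mA; rewrite -Radon_Nikodym_integral.
Qed.

Lemma powR_cvg0 (R : realType) (u : nat -> R) (a : R) : (0 < a)%R ->
  (forall k, (0 <= u k)%R) -> u @ \oo --> (0%R : R) -> (u k `^ a)%R @[k --> \oo] --> (0%R : R).
Proof.
move=> a0 u0 /cvgrPdist_lt cu; apply/cvgrPdist_lt => e e0.
have ea0 : (0 < e `^ a^-1)%R by exact: powR_gt0.
have [N _ h] := cu _ ea0; exists N => // k Nk; have := h k Nk.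
rewrite /= !sub0r !normrN !ger0_norm ?powR_ge0// => uk.
have -> : e = ((e `^ a^-1) `^ a)%R by rewrite -powRrM mulVf ?gt_eqF// powRr1// ltW.
by apply: gt0_ltr_powR; rewrite ?nnegrE// ltW.
Qed.

(** Countable additivity comes from the bound: what a finite stage of a disjoint union misses
    decreases, inside the set [E] of finite measure, to the empty set, so [nu] of it tends to 0. The
    same bound gives absolute continuity. *)
Lemma dominated_additive_density d (T : measurableType d) (R : realType)
    (mu : {sigma_finite_measure set T -> \bar R}) (nu : set T -> R) (E : set T) (D a : R) :
  (0 < a)%R -> measurable E -> mu E < +oo ->
  (forall A B, measurable A -> measurable B -> A `&` B = set0 ->
    nu (A `|` B) = (nu A + nu B)%R) ->
  (forall A, measurable A -> (`|nu A| <= D * fine (mu (A `&` E)) `^ a)%R) ->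
  exists f : T -> \bar R, mu.-integrable setT f /\
    forall A, measurable A -> (nu A)%:E = \int[mu]_(x in A) f x.
Proof.
move=> a0 mE Eoo add bnd.
have nuz A : measurable A -> mu (A `&` E) = 0 -> nu A = 0%R.
  move=> mA A0; have := bnd A mA; rewrite A0/= powR0 ?mulr0 ?gt_eqF//.
  by rewrite normr_le0 => /eqP.
have nu0 : nu set0 = 0%R by apply: nuz => //; rewrite set0I measure0.
apply: (@charge_density _ _ _ mu (fun A => (nu A)%:E)).
- by rewrite nu0.
- by [].
- move=> F mF tF mUF.
  pose U N := \big[setU/set0]_(i < N) F i.
  have mU N : measurable (U N) by exact: bigsetU_measurable.
  have sumE N : (\sum_(0 <= i < N) (nu (F i))%:E = (nu (U N))%:E)%E.
    elim: N => [|N IH]; first by rewrite big_geq// /U big_ord0 nu0.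
    rewrite big_nat_recr//= IH /U big_ord_recr/= add//.
      exact: bigsetU_measurable.
    apply: (@trivIset_bigsetUI _ xpredT F _ N N) => //.
    exact: sub_trivIset tF.
  rewrite (_ : (fun N => _) = (fun N => (nu (U N))%:E)); last exact/funext.
  apply: cvg_EFin; first exact: nearW.
  pose B N := (\bigcup_i F i) `\` U N.
  have mB N : measurable (B N) by exact: measurableD.
  have nuB N : (nu (\bigcup_i F i) - nu (U N) = nu (B N))%R.
    rewrite -[in LHS](@setDUK _ (U N) (\bigcup_i F i)); last first.
      by rewrite /U -bigcup_mkord; by move=> x [i _ Fx]; exists i.
    rewrite (add _ _ (mU N) (mB N)); last by exact: setDIK.
    by rewrite addrC addKr.
  have BE : \bigcap_N (B N `&` E) = set0.
    apply/seteqP; split => // x Bx.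
    have [[[i _ Fix] _] _] := Bx 0%N I.
    have [[_ Ux] _] := Bx i.+1 I; apply: Ux.
    by rewrite /U -bigcup_mkord; exists i => /=.
  have cmu : mu (B N `&` E) @[N --> \oo] --> 0.
    rewrite -(measure0 mu) -BE.
    apply: (nonincreasing_cvg_mu (F := fun N => B N `&` E)) => //=.
    + by apply: le_lt_trans Eoo; apply: le_measure; rewrite ?inE//; exact: measurableI.
    + by move=> N; exact: measurableI.
    + by rewrite BE.
    + move=> i j ij; apply/subsetPset => x [[Fx Ux] Ex]; split=> //; split=> // Uix.
      apply: Ux; move: Uix; rewrite /U -!bigcup_mkord => -[k /= ki Fk].
      by exists k => //=; exact: leq_trans ij.
  have cf : fine (mu (B N `&` E)) @[N --> \oo] --> (0%R : R) by exact: (fine_cvg cmu).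
  have cD : (D * fine (mu (B N `&` E)) `^ a)%R @[N --> \oo] --> (0%R : R).
    rewrite -(mulr0 D); apply: cvgMr; apply: powR_cvg0 => // k.
    exact/fine_ge0/measure_ge0.
  apply/cvgrPdist_lt => e e0; move/cvgrPdist_lt : cD => /(_ e e0).
  apply: filterS => N /=; rewrite sub0r normrN => h.
  by rewrite nuB; apply: le_lt_trans (le_trans (bnd _ (mB N)) (ler_norm _)) h.
- move=> A mA A0; rewrite nuz//; apply/eqP; rewrite eq_le measure_ge0 andbT -A0.
  by apply: le_measure; rewrite ?inE//; exact: measurableI.
Qed.

Lemma measurable_glue d d' (T : measurableType d) (T' : measurableType d')
    (S : nat -> set T) (gs : nat -> T -> T') :
  (forall k, measurable (S k)) -> trivIset setT S -> \bigcup_k S k = setT ->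
  (forall k, measurable_fun setT (gs k)) ->
  exists2 g, measurable_fun setT g & forall k x, S k x -> g x = gs k x.
Proof.
move=> mS tS US mgs.
have ex x : exists k, S k x by have : (\bigcup_k S k) x by [rewrite US|]; move=> [k _ ?]; exists k.
pose i x := projT1 (cid (ex x)).
have iP x : S (i x) x by exact: projT2 (cid (ex x)).
have iE k x : S k x -> i x = k.
  by move=> Skx; apply: tS => //; exists x; split.
exists (fun x => gs (i x) x) => [|k x /iE ->]//.
move=> _ B mB; rewrite setTI.
rewrite (_ : _ @^-1` B = \bigcup_k (S k `&` gs k @^-1` B)).
  apply: bigcup_measurable => k _; apply: measurableI => //.
  by rewrite -[X in measurable X]setTI; exact: mgs.
apply/seteqP; split => [x Bx|x [k _ [/iE <- ?]]]//.
by exists (i x).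
Qed.

Lemma integrable_setU d (T : measurableType d) (R : realType)
    (mu : {measure set T -> \bar R}) (A B : set T) (g : T -> \bar R) :
  measurable A -> measurable B -> A `&` B = set0 ->
  mu.-integrable A g -> mu.-integrable B g -> mu.-integrable (A `|` B) g.
Proof.
move=> mA mB AB /integrableP[mgA gA] /integrableP[mgB gB].
have mg : measurable_fun (A `|` B) g by apply/measurable_funU.
apply/integrableP; split=> //.
rewrite integral_setU//; first exact: lte_add_pinfty.
- exact: measurableT_comp.
- by apply/disj_setPS; rewrite AB.
Qed.

(** * The spaces attached to a capacity *)

(** The weak-type estimate solved for the measure: inner regularity and subadditivity speak of [y]
    itself rather than of its power. *)
Lemma poweR_scale_le (R : realType) (p W : R) (t : R) (y : \bar R) :
  (0 < p)%R -> (0 <= W)%R -> (0 < t)%R -> 0 <= y ->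
  (t%:E * y `^ p^-1 <= W%:E) = (y <= ((W / t) `^ p)%:E).
Proof.
move=> p0 W0 t0; have pn : (p^-1 != 0)%R by rewrite gt_eqF ?invr_gt0.
case: y => // [y|_]; last first.
  by rewrite poweRyr// gt0_muley ?lte_fin// !leye_eq.
rewrite lee_fin => y0; rewrite poweR_EFin -EFinM !lee_fin.
have yE : ((y `^ p^-1) `^ p = y)%R by rewrite -powRrM mulVf ?gt_eqF// powRr1.
rewrite mulrC -ler_pdivlMr//; apply/idP/idP => h.
  by rewrite -yE ge0_ler_powR ?nnegrE ?powR_ge0 ?(ltW p0)// divr_ge0// ltW.
rewrite -[leRHS](_ : ((W / t) `^ p) `^ p^-1 = _)%R; last first.
  by rewrite -powRrM mulfV ?gt_eqF// powRr1// divr_ge0// ltW.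
by rewrite ge0_ler_powR ?nnegrE ?powR_ge0// invr_ge0 ltW.
Qed.

#[global] Instance leb_ae_filter (R : realType) n : Filter (almost_everywhere (leb R n)).
Proof. exact: ae_filter_ringOfSetsType. Qed.

(** The value [y = +oo] is included, since [y] will be the modulus of an extended real value of
    [g]. *)
Lemma mule_nneseries_le (R : realType) (y : \bar R) (a : nat -> \bar R) :
  0 <= y -> (forall k, 0 <= a k) -> y * \sum_(k <oo) a k <= \sum_(k <oo) (y * a k).
Proof.
case: y => [r| |]// r0 a0; first by rewrite nneseriesZl.
have [z|/existsNP[k ak]] := pselect (forall k, a k = 0).
  by rewrite !eseries0 ?mule0// => k _ _; rewrite z ?mule0.
rewrite (@eseries_pinfty _ (fun k => +oo * a k) xpredT k)// ?leey//.
  by move=> j _; rewrite -ltNye (lt_le_trans _ (mule_ge0 _ (a0 j))).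
by rewrite gt0_mulye// lt0e a0 andbT; apply/eqP.
Qed.

Lemma fin_num_muleDl (R : realType) (a x y z : \bar R) :
  a \is a fin_num -> x \is a fin_num -> y \is a fin_num -> z \is a fin_num ->
  (a * x + y) * z = a * (x * z) + y * z.
Proof.
case: a => // a _; case: x => // x _; case: y => // y _; case: z => // z _.
by rewrite -!EFinM -!EFinD mulrDl mulrA.
Qed.

(** A positive finite factor preserves both infinities, so it distributes even over sums that mix
    them. *)
Lemma pmule_sumr (R : realType) (c : R) (a : nat -> \bar R) N : (0 < c)%R ->
  c%:E * \sum_(k < N) a k = \sum_(k < N) (c%:E * a k).
Proof.
move=> c0; elim: N => [|N IH]; first by rewrite !big_ord0 mule0.
rewrite !big_ord_recr/= -IH; move: (\sum_(i < N) a i) (a N) => x y.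
case: x y => [x| |] [y| |]; first by rewrite -!EFinM -!EFinD mulrDr.
all: by rewrite ?addNye ?addeNy ?addye ?addey ?(gt0_muley, gt0_muleNy) ?lte_fin
  ?addNye ?addeNy ?addye ?addey.
Qed.

Section capacity_spaces.
Context {R : realType} {n : nat}.
Local Notation mu := (leb R n).
Local Notation rVl := (leb_space R n).
Variables (cap : set 'rV[R]_n -> \bar R) (p q C : R).
Hypotheses (cap_ge0 : forall E, 0 <= cap E)
  (le_cap : forall E F, E `<=` F -> cap E <= cap F)
  (cap_bounded : forall E, bounded_set E -> cap E < +oo)
  (C0 : (0 < C)%R) (mu_le_cap : forall E, mu E <= C%:E * cap E)
  (p1 : (1 < p)%R) (q0 : (0 < q)%R) (q1 : (q <= 1)%R).
Implicit Types (f g b u : 'rV[R]_n -> \bar R) (E K A : set 'rV[R]_n)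
  (lambda : nat -> R) (bs : nat -> 'rV[R]_n -> \bar R).

Local Notation p' := (p / (p - 1))%R.
Local Notation lorentz := (lorentz_integral mu p' q).
Local Notation Mnorm := (M_norm cap p).
Local Notation Bnorm := (B_norm cap p p' q).
Local Notation Bspace := (B_space cap p p' q).
Local Notation Mspace := (M_space cap p).
Local Notation block := (is_block cap p p' q).
Local Notation decomposition := (block_decomposition cap p p' q).

Let p0 : (0 < p)%R. Proof. exact: lt_trans p1. Qed.
Let pm1 : (0 < p - 1)%R. Proof. by rewrite subr_gt0. Qed.
Let p'0 : (0 < p')%R. Proof. by rewrite divr_gt0. Qed.
Let p'1 : (1 < p')%R. Proof. by rewrite ltr_pdivlMr// mul1r gtrBl. Qed.
Let pVn0 : (p^-1 != 0)%R. Proof. by rewrite gt_eqF ?invr_gt0. Qed.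

Let cap_fin E : bounded_set E -> cap E \is a fin_num.
Proof. by move=> bE; rewrite ge0_fin_numE// cap_bounded. Qed.

Let cap_powE E : bounded_set E -> cap E != 0 ->
  cap E `^ p^-1 = (fine (cap E) `^ p^-1)%:E /\ (0 < fine (cap E) `^ p^-1)%R.
Proof.
move=> bE E0; split; first by rewrite -[in LHS](fineK (cap_fin bE)) poweR_EFin.
by rewrite powR_gt0// fine_gt0// lt0e E0 cap_ge0 cap_bounded.
Qed.

Let mu_cap0 E : cap E = 0 -> mu E = 0.
Proof.
move=> E0; apply/eqP; rewrite eq_le leb_ge0 andbT.
by apply: le_trans (mu_le_cap E) _; rewrite E0 mule0.
Qed.

Let lebesgue_lty E : bounded_set E -> mu E < +oo.
Proof.
by move=> /bounded_subset_box[N EN]; apply: le_lt_trans (leb_box_lty R n N); exact: le_leb.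
Qed.

Lemma Lorentz_normE b : Lorentz_norm p' q b = (p' `^ q^-1)%:E * lorentz b `^ q^-1.
Proof. by []. Qed.

(** The supremum of an empty family is [-oo], so one compact set of nonzero capacity has to be
    exhibited. *)
Lemma M_norm_ge0 g : (exists2 K, compact K & cap K != 0) -> 0 <= Mnorm g.
Proof.
move=> [K cK K0]; apply: le_ereal_sup_tmp.
eexists; first by exists K; first by split.
apply: mule_ge0; last by rewrite inve_ge0 poweR_ge0.
apply: le_ereal_sup_tmp; eexists; first by exists 1%R => //=.
by rewrite mul1e poweR_ge0.
Qed.

(** Compact sets of capacity zero are left out of the supremum; for them both sides vanish, since
    they are null sets. *)
Lemma M_norm_compact g (m : R) K t : Mnorm g <= m%:E -> compact K -> (0 < t)%R ->
  t%:E * mu (K `&` [set x | t%:E < `|g x|]) `^ p^-1 <= m%:E * cap K `^ p^-1.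
Proof.
move=> gm cK t0.
have bK : bounded_set K by exact: compact_bounded.
have capK := cap_fin bK.
have [K0|K0] := eqVneq (cap K) 0.
  have -> : mu (K `&` [set x | t%:E < `|g x|]) = 0.
    apply/eqP; rewrite eq_le leb_ge0 andbT -(mu_cap0 K0); apply: le_leb.
    exact: subIsetl.
  by rewrite poweR0r// mule0 K0 poweR0r// mule0.
have h : t%:E * mu (K `&` [set x | t%:E < `|g x|]) `^ p^-1 <=
    weak_norm p (fun x => g x * (\1_K x)%:E).
  apply: ereal_sup_ubound; exists t => //; congr (_ * mu _ `^ _).
  apply/seteqP; split => x /=; rewrite indicE; case: (boolP (x \in K)) => xK.
  - by rewrite mule1; split => //; exact: set_mem.
  - by rewrite mule0 abse0 lte_fin ltNge (ltW t0).
  - by rewrite mule1 => -[].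
  - by move=> [/mem_set]; rewrite (negbTE xK).
apply: (le_trans h).
have [capE cp0] := cap_powE bK K0.
rewrite capE -lee_pdivrMr//; have -> : (fine (cap K) `^ p^-1)^-1%R%:E = (cap K `^ p^-1)^-1.
  by rewrite capE inver gt_eqF.
apply: le_trans gm; apply: ereal_sup_ubound; exists K => //.
Qed.

Lemma M_norm_le g (m : R) : (0 <= m)%R ->
  (forall K t, compact K -> (0 < t)%R ->
    t%:E * mu (K `&` [set x | t%:E < `|g x|]) `^ p^-1 <= m%:E * cap K `^ p^-1) ->
  Mnorm g <= m%:E.
Proof.
move=> m0 h; apply: ge_ereal_sup => _ [K [cK K0] <-].
have bK : bounded_set K by exact: compact_bounded.
have capK := cap_fin bK.
have [capE cp0] := cap_powE bK K0.
rewrite capE inver gt_eqF// lee_pdivrMr// -capE.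
apply: ge_ereal_sup => _ [t /= t0 <-]; apply: le_trans (h K t cK t0).
rewrite lee_wpmul2l ?lee_fin ?(ltW t0)//.
apply: gt0_ler_poweR; rewrite ?in_itv/= ?andbT ?leb_ge0 ?leey ?invr_ge0 ?(ltW p0)//.
apply: le_leb => x /=; rewrite indicE; case: (boolP (x \in K)) => xK.
  by rewrite mule1; split => //; exact: set_mem.
by rewrite mule0 abse0 lte_fin ltNge (ltW t0).
Qed.

(* [M_norm] tests compact sets only; inner regularity extends the estimate. *)
Lemma M_norm_measurable g (m : R) A t : (0 <= m)%R -> leb_measurable g -> Mnorm g <= m%:E ->
  rV_leb A -> bounded_set A -> (0 < t)%R ->
  t%:E * mu (A `&` [set x | t%:E < `|g x|]) `^ p^-1 <= m%:E * cap A `^ p^-1.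
Proof.
move=> m0 mg gm mA bA t0.
have capA := cap_fin bA.
have capE : m%:E * cap A `^ p^-1 = (m * fine (cap A) `^ p^-1)%:E.
  by rewrite -[in LHS](fineK capA) poweR_EFin.
have c0 : (0 <= m * fine (cap A) `^ p^-1)%R by rewrite mulr_ge0 ?powR_ge0.
(* A violation would be inherited by a compact subset of the part of [A] where [|g| > t], whose
   capacity is no larger than that of [A]. *)
rewrite capE poweR_scale_le ?leb_ge0// leNgt; apply/negP => h.
have mAg : rV_leb (A `&` [set x | t%:E < `|g x|]).
  apply: (@measurableI _ rVl) => //.
  by apply: (@measurable_superlevel _ rVl); exact: measurableT_comp.
have [K [cK KA Kc]] := leb_inner_regular mAg h.
move: Kc; apply/negP; rewrite -leNgt -poweR_scale_le ?leb_ge0// -capE.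
have KE : K = K `&` [set x | t%:E < `|g x|].
  by apply/seteqP; split => x => [Kx|[]//]; split => //; have [] := KA x Kx.
rewrite [X in mu X]KE; apply: le_trans (M_norm_compact gm cK t0) _.
rewrite lee_wpmul2l ?lee_fin//.
apply: gt0_ler_poweR; rewrite ?in_itv/= ?andbT ?cap_ge0 ?leey ?invr_ge0 ?(ltW p0)//.
by apply: le_cap => x /KA[].
Qed.

Lemma bounded_subset (A B : set 'rV[R]_n) : A `<=` B -> bounded_set B -> bounded_set A.
Proof. by move=> AB [M [Mr h]]; exists M; split=> // x Mx v /AB; exact: h. Qed.

(** If [cap E = 0] the block inequality says nothing, as [0 * +oo = 0], but then [b] vanishes
    a.e. *)
Lemma block_lorentz_lty b : block b -> lorentz b < +oo.
Proof.
move=> [mb [E [bE sE le1]]]; have [E0|E0] := eqVneq (cap E) 0.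
  rewrite [X in X < _](_ : _ = 0)//; apply: integral0_eq => t; rewrite /= in_itv/= andbT => t0.
  have -> : (mu : set rVl -> \bar R) [set x | t%:E < `|b x|] = 0.
    apply/eqP; rewrite eq_le (leb_ge0 [set x | t%:E < `|b x|]) andbT -(mu_cap0 E0).
    apply: (@le_leb R n) => x /= tb; apply: sE => /=.
    by apply: contraTneq tb => ->; rewrite abse0 lte_fin ltNge (ltW t0).
  by rewrite poweR0r ?mul0e// mulf_neq0 ?invr_neq0 ?gt_eqF.
have [capE cp0] := cap_powE bE E0.
rewrite ltey; apply: contraPneq le1 => Joo; apply/negP; rewrite -ltNge.
rewrite Lorentz_normE Joo poweRyr ?gt_eqF ?invr_gt0//.
by rewrite gt0_muley ?lte_fin ?powR_gt0// capE gt0_muley ?lte_fin// ltry.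
Qed.

Lemma block_pairing b g (m : R) : (0 <= m)%R -> leb_measurable g -> Mnorm g <= m%:E ->
  block b -> \int[mu]_x (`|b x| * `|g x|) <= (p' * m)%:E.
Proof.
move=> m0 mg gm bb; have Joo := block_lorentz_lty bb.
case: bb => mb [E [bE sE le1]].
pose c := (fine (cap E) `^ p^-1)%R.
have c0 : (0 <= c)%R by exact: powR_ge0.
have capE : cap E `^ p^-1 = c%:E.
  by rewrite -[in LHS](fineK (cap_fin bE)) poweR_EFin.
(* The set [E] of a block may fail to be measurable; the support of [b] replaces it. *)
have mS : rV_leb [set x | b x != 0].
  by rewrite /rV_leb -[X in measurable X](@setTI rVl); apply: emeasurable_neq => //; exact: mb.
have bS : bounded_set [set x | b x != 0] by exact: bounded_subset bE.
have W0 : (0 <= m * c)%R by exact: mulr_ge0.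
have hW t : (0 < t)%R ->
   t%:E * mu ([set x | b x != 0] `&` [set x | t%:E < `|g x|]) `^ p^-1 <= (m * c)%:E.
  move=> t0; apply: le_trans (M_norm_measurable m0 mg gm mS bS t0) _.
  rewrite EFinM -capE lee_wpmul2l ?lee_fin//.
  by apply: gt0_ler_poweR; rewrite ?in_itv/= ?andbT ?cap_ge0 ?leey ?invr_ge0 ?(ltW p0)//; exact: le_cap.
apply: le_trans (@weak_hoelder _ rVl R mu p q _ b g p1 q0 q1 W0 mb mg hW Joo) _.
rewrite mulrA EFinM -muleA -[leRHS]mule1 lee_wpmul2l ?lee_fin//.
  by rewrite mulr_ge0// ltW.
apply: le_trans le1; rewrite capE Lorentz_normE muleA -EFinM.
(* The factor [p'^(1/q)] of the Lorentz norm is at least 1. *)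
rewrite lee_wpmul2r ?poweR_ge0// lee_fin ler_peMr//.
have := ge0_ler_powR (r := q^-1); rewrite invr_ge0 => /(_ (ltW q0)) H.
have h1 : (1 `^ q^-1 = 1 :> R)%R by rewrite powR1.
by rewrite -[leLHS]h1; apply: H; rewrite ?nnegrE//; exact: ltW.
Qed.

Lemma decomposition_pairing f g (m : R) lambda bs : (0 <= m)%R ->
  leb_measurable f -> leb_measurable g -> Mnorm g <= m%:E -> decomposition f lambda bs ->
  \int[mu]_x (`|f x| * `|g x|) <= (p' * m)%:E * \sum_(k <oo) `|lambda k|%:E.
Proof.
move=> m0 mf mg gm [lfin bbs fE].
have mfg : measurable_fun [set: rVl] (fun x => `|f x| * `|g x|).
  by apply: emeasurable_funM; [exact: (measurableT_comp (@abse_measurable R setT) mf)|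
    exact: (measurableT_comp (@abse_measurable R setT) mg)].
have mbs k : measurable_fun [set: rVl] (fun x => `|lambda k|%:E * (`|bs k x| * `|g x|)).
  apply: measurable_funeM.
  have [mb _] := bbs k.
  by apply: emeasurable_funM; [exact: (measurableT_comp (@abse_measurable R setT) mb)|
    exact: (measurableT_comp (@abse_measurable R setT) mg)].
have t0 k x : 0 <= `|lambda k|%:E * (`|bs k x| * `|g x|).
  by rewrite mule_ge0 ?lee_fin// mule_ge0.
apply: (@le_trans _ _ (\int[mu]_x (\sum_(k <oo) (`|lambda k|%:E * (`|bs k x| * `|g x|))))).
  apply: ae_ge0_le_integral.
  - exact: measurableT.
  - by move=> x _; rewrite mule_ge0.
  - exact: mfg.
  - by move=> x _; apply: nneseries_ge0 => k _ _; exact: t0.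
  - by apply: ge0_emeasurable_sum => [k x _ _|k _]; [exact: t0|exact: mbs].
  - apply: (@filterS _ _ (leb_ae_filter R n)) fE => x fx _.
    apply: (@le_trans _ _ (\sum_(k <oo) (`|g x| * (`|lambda k|%:E * `|bs k x|)))); last first.
      by apply: lee_nneseries => k _; rewrite ?mule_ge0 ?lee_fin// muleCA [X in _ * X]muleC.
    apply: le_trans (mule_nneseries_le _ _); last 2 first.
    - exact: abse_ge0.
    - by move=> k; rewrite mule_ge0 ?lee_fin.
    rewrite muleC lee_wpmul2l//.
    have cv : `|\sum_(k < N) ((lambda k)%:E * bs k x)| @[N --> \oo] --> `|f x|.
      by apply: cvg_abse; exact: fx.
    rewrite -(cvg_lim _ cv)//; apply: lime_le; first by apply/cvg_ex; eexists; exact: cv.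
    apply: nearW => N /=; apply: le_trans (lee_abs_sum _ _ _) _.
    rewrite (eq_bigr (fun k : 'I_N => `|lambda k|%:E * `|bs k x|)); last first.
      by move=> k _; rewrite abseM.
    rewrite -(big_mkord xpredT (fun k => `|lambda k|%:E * `|bs k x|)).
    apply: nneseries_lim_ge => k _ _; by rewrite mule_ge0 ?lee_fin.
rewrite integral_nneseries; [|exact: measurableT|exact: mbs|by move=> k x _; exact: t0].
rewrite -nneseriesZl//; apply: lee_nneseries => [k _ _|k _]; first exact: integral_ge0.
have [mb _] := bbs k.
rewrite ge0_integralZl_EFin; last 4 first.
- exact: measurableT.
- by move=> x _; rewrite mule_ge0.
- by apply: emeasurable_funM; [exact: (measurableT_comp (@abse_measurable R setT) mb)|
    exact: (measurableT_comp (@abse_measurable R setT) mg)].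
- exact: normr_ge0.
by rewrite muleC lee_wpmul2r ?lee_fin//; exact: block_pairing.
Qed.

(** Pairing with the constant 1 will show that the elements of B^{p',q} are integrable. Levels
    [t >= 1] are empty; below them [mu K <= C cap K] is used. *)
Lemma M_norm1 : Mnorm (fun=> 1) <= (C `^ p^-1)%:E.
Proof.
apply: M_norm_le => [|K t cK t0]; first exact: powR_ge0.
have rhs0 : 0 <= (C `^ p^-1)%:E * cap K `^ p^-1.
  by rewrite mule_ge0 ?poweR_ge0// lee_fin powR_ge0.
have [t1|t1] := leP 1%R t.
  rewrite (_ : K `&` _ = set0).
    by rewrite (measure0 mu) poweR0r// mule0.
  by apply/seteqP; split => // x [_ /=]; rewrite normr1 lte_fin ltNge t1.
rewrite -poweR_EFin -poweRM ?lee_fin ?(ltW C0)//.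
apply: (@le_trans _ _ (mu K `^ p^-1)).
  rewrite -[leRHS]mul1e lee_pmul ?lee_fin ?(ltW t0) ?(ltW t1) ?poweR_ge0//.
  apply: gt0_ler_poweR; rewrite ?in_itv/= ?andbT ?leb_ge0 ?leey ?invr_ge0 ?(ltW p0)//.
  exact: le_leb.
apply: gt0_ler_poweR; rewrite ?in_itv/= ?andbT ?leb_ge0 ?leey ?invr_ge0 ?(ltW p0)//.
by rewrite mule_ge0 ?cap_ge0 ?lee_fin ?(ltW C0)// leey.
Qed.

Lemma B_norm_pairing f g (m : R) : (0 <= m)%R ->
  leb_measurable f -> leb_measurable g -> Mnorm g <= m%:E -> Bnorm f < +oo ->
  \int[mu]_x (`|f x| * `|g x|) <= (p' * m)%:E * Bnorm f.
Proof.
move=> m0 mf mg gm foo.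
have [_ [l [bs dec] _] _] := ereal_inf_lt foo.
have h := decomposition_pairing m0 mf mg gm.
have [c0|c0] := eqVneq (p' * m)%R 0%R.
  by have := h _ _ dec; rewrite c0 !mul0e.
have {}c0 : (0 < p' * m)%R by rewrite lt0r c0 mulr_ge0// ltW.
rewrite -lee_pdivrMl//; apply: le_ereal_inf_tmp => _ [l' [bs' dec'] <-].
by rewrite lee_pdivrMl//; exact: h dec'.
Qed.

(** The infimum over no decomposition is [+oo], so a finite norm means that one exists. *)
Lemma Bspace_norm f : Bspace f <-> leb_measurable f /\ Bnorm f < +oo.
Proof.
split=> -[mf].
  move=> [l [bs dec]]; split=> //; have [loo _ _] := dec.
  by apply: le_lt_trans loo; apply: ereal_inf_lbound; exists l => //; exists bs.
by move=> /ereal_inf_lt[_ [l [bs dec] _] _]; split=> //; exists l, bs.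
Qed.

Lemma B_norm_ge0 f : 0 <= Bnorm f.
Proof.
apply: le_ereal_inf_tmp => _ [l _ <-]; apply: nneseries_ge0 => k _ _.
by rewrite lee_fin.
Qed.

Lemma B_norm_fin f : Bspace f -> Bnorm f \is a fin_num.
Proof. by move=> /Bspace_norm[_ foo]; rewrite ge0_fin_numE ?B_norm_ge0. Qed.

Lemma B_M_integrable f g (m : R) : (0 <= m)%R -> Bspace f ->
  leb_measurable g -> Mnorm g <= m%:E ->
  mu.-integrable [set: rVl] (fun x => f x * g x).
Proof.
move=> m0 Bf mg gm; have [mf foo] := (Bspace_norm f).1 Bf.
apply/integrableP; split; first by apply: emeasurable_funM; [exact: mf|exact: mg].
have := B_norm_pairing m0 mf mg gm foo.
under eq_integral => x _ do rewrite -abseM.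
by move=> /le_lt_trans; apply; rewrite -(fineK (B_norm_fin Bf)) -EFinM ltry.
Qed.

Lemma B_integrable f : Bspace f -> mu.-integrable [set: rVl] f.
Proof.
move=> Bf; have := @B_M_integrable f (fun=> 1) _ (powR_ge0 C p^-1) Bf _ M_norm1.
rewrite (_ : (fun x => f x * 1) = f); first by apply; exact: measurable_cst.
by apply/funext => x; rewrite mule1.
Qed.

Lemma B_ae_fin f : Bspace f -> \forall x \ae mu, f x \is a fin_num.
Proof.
move=> Bf; have := integrable_ae (@measurableT _ rVl) (B_integrable Bf).
by apply: (@filterS _ _ (leb_ae_filter R n)) => x; exact.
Qed.

(** A weak L^p bound with [p > 1] gives integrability on sets of finite measure. *)
Lemma M_integrable_bounded g (m : R) A : (0 <= m)%R -> leb_measurable g -> Mnorm g <= m%:E ->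
  rV_leb A -> bounded_set A -> mu.-integrable A g.
Proof.
move=> m0 mg gm mA bA.
pose W := (m * fine (cap A) `^ p^-1)%R.
have W0 : (0 <= W)%R by rewrite mulr_ge0 ?powR_ge0.
have capE : m%:E * cap A `^ p^-1 = W%:E.
  by rewrite -[in LHS](fineK (cap_fin bA)) poweR_EFin.
have mag : measurable_fun [set: rVl] (fun x => `|g x|).
  exact: (measurableT_comp (@abse_measurable R setT) mg).
apply/integrableP; split; first exact: (@measurable_funS _ _ rVl _ _ _ _ measurableT (@subsetT _ _) mg).
have h := @weak_Lp_integral _ rVl R mu p W A
  (fun x => `|g x|) p1 W0 mA (lebesgue_lty bA) mag (fun x => abse_ge0 (g x)).
apply: (le_lt_trans (h _)).
  by move=> t t0; rewrite -capE; exact: M_norm_measurable.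
have pW0 : 0 <= (p' * W)%:E by rewrite lee_fin mulr_ge0// ltW.
by apply: (lte_mul_pinfty pW0) => //; exact: (poweR_lty _ (lebesgue_lty bA)).
Qed.

Lemma ae_box (P : 'rV[R]_n -> Prop) :
  (forall N, \forall x \ae mu, box N x -> P x) -> \forall x \ae mu, P x.
Proof.
move=> H; have : mu.-negligible (\bigcup_N (~` [set x : 'rV[R]_n | box N x -> P x])).
  exact: (@negligible_bigcup _ rVl).
apply: negligibleS => x /= Px; have : (\bigcup_N box N) x by rewrite box_cover.
by move=> [N _ xN]; exists N => //= h; exact/Px/h.
Qed.

Lemma borel_box_leb N : rV_leb (box N : set 'rV[R]_n).
Proof. by apply: rV_borel_leb; exact: borel_box. Qed.

Lemma M_ae_fin g (m : R) : (0 <= m)%R -> leb_measurable g -> Mnorm g <= m%:E ->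
  \forall x \ae mu, g x \is a fin_num.
Proof.
move=> m0 mg gm; apply: ae_box => N.
apply: (@integrable_ae _ rVl _ mu (box N)); first exact: borel_box_leb.
by apply: M_integrable_bounded gm _ _ => //; [exact: borel_box_leb|exact: bounded_box].
Qed.

Definition pairing g f : R := fine (\int[mu]_x (f x * g x)).

Lemma pairing_represents g (m : R) : (0 <= m)%R -> leb_measurable g -> Mnorm g <= m%:E ->
  represents Bspace (pairing g) g.
Proof.
move=> m0 mg gm f Bf; have ifg := B_M_integrable m0 Bf mg gm; split=> //.
by rewrite /pairing fineK//; exact: (@integrable_fin_num _ rVl).
Qed.

Lemma represents_bound g (m : R) L f : (0 <= m)%R -> leb_measurable g -> Mnorm g <= m%:E ->
  represents Bspace L g -> Bspace f -> `|L f|%:E <= (p' * m)%:E * Bnorm f.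
Proof.
move=> m0 mg gm rL Bf; have [mf foo] := (Bspace_norm f).1 Bf.
have [ifg LE] := rL f Bf.
have := B_norm_pairing m0 mf mg gm foo; apply: le_trans.
rewrite -[leLHS]/(`|(L f)%:E|) LE; apply: le_trans (le_abse_integral _ _ _) _.
- exact: measurableT.
- exact: measurable_int ifg.
- by under eq_integral => x _ do rewrite abseM.
Qed.

Lemma pairing_clf g (m : R) : (0 <= m)%R -> leb_measurable g -> Mnorm g <= m%:E ->
  continuous_linear_functional Bspace Bnorm (pairing g).
Proof.
move=> m0 mg gm; split.
- move=> f h Bf Bh fh; rewrite /pairing; congr fine.
  have if_ := B_M_integrable m0 Bf mg gm; have ih := B_M_integrable m0 Bh mg gm.
  apply: ae_eq_integral.
  + exact: measurableT.
  + exact: measurable_int if_.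
  + exact: measurable_int ih.
  + by apply: (@filterS _ _ (leb_ae_filter R n)) fh => x E _; rewrite E.
- move=> a f h Bf Bh.
  have if_ := B_M_integrable m0 Bf mg gm; have ih := B_M_integrable m0 Bh mg gm.
  have iaf : mu.-integrable [set: rVl] (fun x => a%:E * (f x * g x)) by exact: integrableZl.
  have E : \int[mu]_x ((a%:E * f x + h x) * g x) = \int[mu]_x (a%:E * (f x * g x) + h x * g x).
    apply: ae_eq_integral.
    + exact: measurableT.
    + have [mf _] := Bf; have [mh _] := Bh.
      apply: emeasurable_funM; last exact: mg.
      by apply: emeasurable_funD; [apply: measurable_funeM; exact: mf|exact: mh].
    + by apply: emeasurable_funD; [exact: measurable_int iaf|exact: measurable_int ih].
    (* Distributivity breaks down at infinite values, so it is applied where all three functions are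
       finite. *)
    + have F1 := B_ae_fin Bf; have F2 := B_ae_fin Bh; have F3 := M_ae_fin m0 mg gm.
      apply: (@filterS3 _ _ (leb_ae_filter R n) _ _ _ _ _ F1 F2 F3) => x fx hx gx _.
      by rewrite fin_num_muleDl.
  rewrite /pairing E integralD//.
  have ff : \int[mu]_x (f x * g x) \is a fin_num by exact: (@integrable_fin_num _ rVl).
  have fh : \int[mu]_x (h x * g x) \is a fin_num by exact: (@integrable_fin_num _ rVl).
  by rewrite integralZl// fineD ?fin_numM// fineM.
- move=> f Bf e e0.
  have pm0 : (0 <= p' * m)%R by rewrite mulr_ge0// ltW.
  (* The 1 in the denominator covers [m = 0]. *)
  exists (e / (p' * m + 1))%R; first by rewrite divr_gt0// ltr_wpDl.
  move=> h Bh hfd.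
  have [mf _] := Bf; have [mh _] := Bh.
  have mhf : leb_measurable (fun x => h x - f x) by apply: emeasurable_funB; [exact: mh|exact: mf].
  (* A finite norm of the difference already means that it has a decomposition. *)
  have Bhf : Bspace (fun x => h x - f x).
    by apply/Bspace_norm; split=> //; apply: lt_trans hfd _; rewrite ltry.
  have E : (pairing g h - pairing g f)%R = pairing g (fun x => h x - f x).
    have if_ := B_M_integrable m0 Bf mg gm; have ih := B_M_integrable m0 Bh mg gm.
    have ff : \int[mu]_x (f x * g x) \is a fin_num by exact: (@integrable_fin_num _ rVl).
    have fh : \int[mu]_x (h x * g x) \is a fin_num by exact: (@integrable_fin_num _ rVl).
    rewrite /pairing -fineB//; congr fine; rewrite -integralB//.
    apply: ae_eq_integral.
    + exact: measurableT.
    + by apply: emeasurable_funB; [exact: measurable_int ih|exact: measurable_int if_].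
    + by apply: emeasurable_funM; [exact: mhf|exact: mg].
    + have F1 := B_ae_fin Bf; have F2 := B_ae_fin Bh; have F3 := M_ae_fin m0 mg gm.
      apply: (@filterS3 _ _ (leb_ae_filter R n) _ _ _ _ _ F1 F2 F3) => x fx hx gx _.
      by rewrite muleBl// fin_num_adde_defl// fin_numN.
  rewrite E -lte_fin.
  apply: le_lt_trans (represents_bound m0 mg gm (pairing_represents m0 mg gm) Bhf) _.
  rewrite -(fineK (B_norm_fin Bhf)) -EFinM lte_fin.
  have pm10 : (0 < p' * m + 1)%R by rewrite ltr_wpDl.
  move: hfd; rewrite -(fineK (B_norm_fin Bhf)) lte_fin ltr_pdivlMr// => hfd.
  apply: le_lt_trans hfd; rewrite mulrC; apply: ler_wpM2l; last by rewrite lerDl.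
  by apply: fine_ge0; rewrite lee_fin fine_ge0//; exact: B_norm_ge0.
Qed.

Lemma decomposition_pscale f lambda bs (c : R) : (0 < c)%R -> decomposition f lambda bs ->
  decomposition (fun x => c%:E * f x) (fun k => c * lambda k)%R bs.
Proof.
move=> c0 [loo bbs fE]; split=> //.
  rewrite (eq_eseriesr (g := fun k => c%:E * `|lambda k|%:E)); last first.
    by move=> k _; rewrite normrM gtr0_norm// EFinM.
  by rewrite nneseriesZl ?lte_mul_pinfty ?lee_fin ?(ltW c0)// => k _; rewrite lee_fin.
apply: (@filterS _ _ (leb_ae_filter R n)) fE => x fx.
rewrite (_ : (fun N => _) = (fun N => c%:E * \sum_(k < N) (lambda k)%:E * bs k x)).
  by apply: cvgeZl => //; exact: fx.
apply/funext => N; rewrite (pmule_sumr (fun k => (lambda k)%:E * bs k x) N c0); apply: eq_bigr => k _.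
by rewrite EFinM muleA.
Qed.

Lemma decomposition_block b (c : R) : block b ->
  decomposition (fun x => c%:E * b x) (fun k => if k == 0%N then c else 0%R) (fun=> b) /\
  \sum_(k <oo) `|if k == 0%N then c else 0%R|%:E = `|c|%:E.
Proof.
move=> bb.
have E : \sum_(k <oo) `|if k == 0%N then c else 0%R|%:E = `|c|%:E.
  rewrite (nneseries_split 0%N 1%N)//.
  rewrite add0n big_nat1 eqxx eseries0 ?adde0// => k k0 _.
  by rewrite gtn_eqF// normr0.
split=> //; split=> //; first by rewrite E ltry.
apply: (@filterE _ _ (leb_ae_filter R n)) => x.
rewrite -cvg_shiftS; apply: cvg_near_cst; apply: nearW => N.
rewrite /= big_ord_recl/= big1 ?adde0// => k _; by rewrite mul0e.
Qed.

(** [u / m] is a single block, taken with coefficient [m]. *)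
Lemma decomposition_of_norm u E (m : R) : (0 < m)%R -> leb_measurable u ->
  bounded_set E -> [set x | u x != 0] `<=` E ->
  cap E `^ p^-1 * Lorentz_norm p' q u <= m%:E ->
  exists lambda bs, decomposition u lambda bs /\ \sum_(k <oo) `|lambda k|%:E = m%:E.
Proof.
move=> m0 mu_ bE uE le.
pose c := PosNum (etrans (invr_gt0 m) m0).
have bb : block (fun x => c%:num%:E * u x).
  split; first by apply: measurable_funeM; exact: mu_.
  exists E; split=> //.
    move=> x /= ux; apply: uE => /=; apply: contraNneq ux => ->; by rewrite mule0.
  rewrite Lorentz_normE (@lorentz_integral_scale _ rVl R mu p' q c u mu_).
  rewrite poweRM ?lorentz_integral_ge0 ?lee_fin ?powR_ge0// poweR_EFin -powRrM mulfV ?gt_eqF//.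
  have aux (x y z t : \bar R) : x * (y * (z * t)) = z * (x * (y * t)).
    by rewrite (muleCA y z) (muleCA x z).
  rewrite powRr1// aux; apply: (@le_trans _ _ (c%:num%:E * m%:E)).
    by apply: lee_wpmul2l => //; exact: le.
  by rewrite -EFinM lee_fin mulVf ?gt_eqF.
have [d s] := decomposition_block m bb.
exists (fun k => if k == 0%N then m else 0%R), (fun=> (fun x => c%:num%:E * u x)).
split; last by rewrite [LHS]s gtr0_norm.
move: d; rewrite (_ : (fun x => _) = u)//.
by apply/funext => x; rewrite muleA -EFinM mulfV ?gt_eqF// mul1e.
Qed.

(* The constant of [lorentz_integral_bounded], read as a norm. *)
Definition indicator_constant : R := (p' `^ q^-1 * q^-1 `^ q^-1)%R.

Lemma indicator_constant_gt0 : (0 < indicator_constant)%R.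
Proof. by rewrite mulr_gt0// powR_gt0// invr_gt0. Qed.

Lemma Lorentz_norm_bounded u A (a : R) : (0 < a)%R -> rV_leb A -> bounded_set A ->
  leb_measurable u -> (forall x, `|u x| <= a%:E * (\1_A x)%:E) ->
  Lorentz_norm p' q u <= (indicator_constant * a * fine (mu A) `^ p'^-1)%:E.
Proof.
move=> a0 mA bA mu_ uA.
have h := @lorentz_integral_bounded _ rVl R mu p' q a A u p'0 q0 a0 mA mu_ uA.
have muA : mu A \is a fin_num by rewrite ge0_fin_numE ?leb_ge0// lebesgue_lty.
have mE : mu A = (fine (mu A))%:E by rewrite fineK.
have h2 : lorentz u <= (fine (mu A) `^ (q / p') * (a `^ q / q))%:E.
  by apply: (le_trans h); rewrite [X in X `^ _]mE poweR_EFin -EFinM lee_fin.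
have fm : (0 <= fine (mu A))%R by rewrite fine_ge0// leb_ge0.
have qn : (q != 0)%R by rewrite gt_eqF.
rewrite Lorentz_normE.
have h3 : lorentz u `^ q^-1 <= ((fine (mu A) `^ (q / p') * (a `^ q / q)) `^ q^-1)%:E.
  rewrite -poweR_EFin; apply: gt0_ler_poweR => //.
  - by rewrite invr_ge0 ltW.
  - by rewrite in_itv/= lorentz_integral_ge0 leey.
  - by rewrite in_itv/= leey andbT lee_fin mulr_ge0 ?powR_ge0// divr_ge0 ?powR_ge0// ltW.
apply: le_trans (lee_wpmul2l _ h3) _; first by rewrite lee_fin powR_ge0.
rewrite -EFinM lee_fin /indicator_constant le_eqVlt; apply/orP; left; apply/eqP.
have aq0 : (0 <= a `^ q / q)%R by rewrite mulr_ge0 ?powR_ge0// invr_ge0 ltW.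
have qV0 : (0 <= q^-1)%R by rewrite invr_ge0 ltW.
rewrite (powRM _ (powR_ge0 _ _) aq0) (powRM _ (powR_ge0 _ _) qV0).
have e1 : (q / p' * q^-1 = p'^-1)%R by rewrite mulrAC mulfV// mul1r.
rewrite -(powRrM _ (q / p')%R) e1 -(powRrM a) mulfV// powRr1 ?(ltW a0)//.
by move: (p' `^ q^-1)%R (fine _ `^ _)%R (_ `^ q^-1)%R => x y z; ring.
Qed.

(** * Representation of functionals *)

Section functional.
Variable L : ('rV[R]_n -> \bar R) -> R.
Hypothesis Lc : continuous_linear_functional Bspace Bnorm L.

Lemma B_zero : Bspace (fun=> 0).
Proof.
have m0 : leb_measurable (fun _ : 'rV[R]_n => 0) by exact: measurable_cst.
split=> //.
have b0 : bounded_set (set0 : set 'rV[R]_n).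
  by apply: bounded_subset (@bounded_box R n 0%N) => x [] .
have sub : [set x : 'rV[R]_n | (0 : \bar R) != 0] `<=` set0 by move=> x /=; rewrite eqxx.
have [|l [bs [d _]]] := @decomposition_of_norm (fun=> 0) set0 1%R ltr01 m0 b0 sub.
  rewrite (_ : Lorentz_norm p' q (fun=> 0) = 0) ?mule0//.
  apply/eqP; rewrite eq_le; apply/andP; split; last first.
    by rewrite Lorentz_normE mule_ge0 ?poweR_ge0// lee_fin powR_ge0.
  have m00 : rV_leb (set0 : set 'rV[R]_n) by exact: (@measurable0 _ rVl).
  apply: le_trans (@Lorentz_norm_bounded (fun=> 0) set0 1%R ltr01 m00 b0 m0 _) _.
    by move=> x; rewrite abse0 mule_ge0 ?lee_fin.
  by rewrite (measure0 mu)/= powR0 ?mulr0// gt_eqF// invr_gt0.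
by exists l, bs.
Qed.

Lemma clf_zero : L (fun=> 0) = 0%R.
Proof.
have [_ lin _] := Lc; have := lin 1%R _ _ B_zero B_zero.
rewrite (_ : (fun x => 1%:E * 0 + 0) = (fun=> 0 : \bar R)).
  by move=> /esym/eqP; rewrite mul1r -subr_eq0 addrK => /eqP.
by apply/funext => x; rewrite mule0 adde0.
Qed.

Lemma clf_scale (c : R) f : Bspace f -> L (fun x => c%:E * f x) = (c * L f)%R.
Proof.
move=> Bf; have [_ lin _] := Lc; have := lin c _ _ Bf B_zero.
rewrite clf_zero addr0 => <-; congr L.
by apply/funext => x; rewrite adde0.
Qed.

(** Continuity at 0, with tolerance 1 and radius [d], combined with homogeneity. Bounding by the
    cost of a given decomposition, rather than by the norm, allows the tails of a decomposition to
    be used later. *)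
Lemma clf_bound : exists2 k : R, (0 < k)%R & forall f lambda bs,
  leb_measurable f -> decomposition f lambda bs ->
  `|L f|%:E <= k%:E * \sum_(j <oo) `|lambda j|%:E.
Proof.
have [_ _ cont] := Lc; have [d d0 hd] := cont _ B_zero 1%R ltr01.
exists (2 / d)%R; first by rewrite divr_gt0.
move=> f l bs mf dec; have Bf : Bspace f by split=> //; exists l, bs.
have [loo _ _] := dec.
have l0 : 0 <= \sum_(j <oo) `|l j|%:E by apply: nneseries_ge0 => j _ _; rewrite lee_fin.
have lfin : \sum_(j <oo) `|l j|%:E \is a fin_num by rewrite ge0_fin_numE.
pose S := fine (\sum_(j <oo) `|l j|%:E).
have SE : \sum_(j <oo) `|l j|%:E = S%:E by rewrite fineK.
have S0 : (0 <= S)%R by exact: fine_ge0.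
rewrite SE -EFinM lee_fin; apply/ler_addgt0Pr => e e0.
(* The slack keeps [s] positive when [S = 0] and adds exactly [e] to the resulting bound
   [2 s / d]. *)
pose s := (S + e * d / 2)%R.
have s0 : (0 < s)%R by rewrite ltr_wpDl// divr_gt0// mulr_gt0.
pose c := (d / (2 * s))%R.
have c0 : (0 < c)%R by rewrite divr_gt0// mulr_gt0.
have Bcf : Bspace (fun x => c%:E * f x).
  split; first by apply: measurable_funeM; exact: mf.
  by exists (fun k => c * l k)%R, bs; exact: decomposition_pscale.
have nc : Bnorm (fun x => c%:E * f x - 0) < d%:E.
  have E : (fun x => c%:E * f x - 0) = (fun x => c%:E * f x).
    by apply/funext => x; rewrite sube0.
  rewrite E; apply: (@le_lt_trans _ _ (c * S)%:E).
    have -> : (c * S)%:E = c%:E * \sum_(j <oo) `|l j|%:E by rewrite SE -EFinM.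
    rewrite -nneseriesZl; last by move=> k _; rewrite lee_fin.
    rewrite (eq_eseriesr (g := fun k => `|c * l k|%:E)); last first.
      by move=> k _; rewrite normrM gtr0_norm.
    by apply: ereal_inf_lbound; eexists; [exists bs; exact: decomposition_pscale dec|].
  rewrite lte_fin /c mulrAC ltr_pdivrMr ?mulr_gt0// ltr_pM2l// mulr_natl mulr2n.
  rewrite ltr_wpDl//; first exact: ltW.
  by rewrite /s ltrDl divr_gt0// mulr_gt0.
have := hd _ Bcf nc; rewrite clf_zero subr0 clf_scale// normrM gtr0_norm//.
rewrite /c mulrAC ltr_pdivrMr ?mulr_gt0// mul1r => h.
rewrite -(ler_pM2l d0); apply: le_trans (ltW h) _.
rewrite /s le_eqVlt; apply/orP; left; apply/eqP.
by field; rewrite gt_eqF.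
Qed.

(** The quantitative input of the construction of the density. With [k] as a parameter, it can be
    any bound in the existence part and the functional norm in the norm estimate. *)
Definition block_bounded (k : R) := forall u E (m : R), (0 < m)%R -> leb_measurable u ->
  bounded_set E -> [set x | u x != 0] `<=` E ->
  cap E `^ p^-1 * Lorentz_norm p' q u <= m%:E -> (`|L u| <= k * m)%R.

Lemma clf_block_bounded : exists2 k : R, (0 < k)%R & block_bounded k.
Proof.
have [k k0 hk] := clf_bound; exists k => // u E m m0 mu_ bE uE le.
have [l [bs [d s]]] := decomposition_of_norm m0 mu_ bE uE le.
by have := hk _ _ _ mu_ d; rewrite s -EFinM lee_fin.
Qed.

Lemma functional_norm_block_bounded (k : R) :
  functional_norm Bspace Bnorm L <= k%:E -> block_bounded k.
Proof.
move=> Lk u E m m0 mu_ bE uE le.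
have [l [bs [d s]]] := decomposition_of_norm m0 mu_ bE uE le.
have mV0 : (0 < m^-1)%R by rewrite invr_gt0.
have Bu : Bspace u by split=> //; exists l, bs.
have dv := decomposition_pscale mV0 d.
have Bv : Bspace (fun x => (m^-1)%R%:E * u x).
  split; first by apply: measurable_funeM; exact: mu_.
  by exists (fun j => m^-1 * l j)%R, bs.
have nv : Bnorm (fun x => (m^-1)%R%:E * u x) <= 1.
  have -> : 1 = \sum_(j <oo) `|(m^-1 * l j)%R|%:E.
    rewrite (eq_eseriesr (g := fun j => (m^-1)%R%:E * `|l j|%:E)); last first.
      by move=> j _; rewrite normrM gtr0_norm// EFinM.
    rewrite nneseriesZl; last by move=> j _; rewrite lee_fin.
    by rewrite s -EFinM mulVf ?gt_eqF.
  by apply: ereal_inf_lbound; eexists; [exists bs; exact: dv|].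
have : `|L (fun x => (m^-1)%R%:E * u x)%E|%:E <= k%:E.
  by apply: le_trans Lk; apply: ereal_sup_ubound; eexists; [split; [exact: Bv|exact: nv]|].
by rewrite clf_scale// normrM gtr0_norm// lee_fin ler_pdivrMl// mulrC.
Qed.

Section bounded.
Variable k : R.
Hypotheses (k0 : (0 <= k)%R) (hk : block_bounded k).

Lemma support_bounded u A (a : R) : (forall x, `|u x| <= a%:E * (\1_A x)%:E) ->
  [set x | u x != 0] `<=` A.
Proof.
move=> uA x /= ux; apply: contrapT => Ax; move/negP: ux; apply; rewrite -abse_eq0.
apply/eqP/le_anti; rewrite abse_ge0 andbT; apply: le_trans (uA x) _.
by rewrite indicE memNset// mule0.
Qed.

Lemma block_cost u A E (a : R) : (0 < a)%R -> rV_leb A -> A `<=` E -> bounded_set E ->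
  leb_measurable u -> (forall x, `|u x| <= a%:E * (\1_A x)%:E) ->
  cap E `^ p^-1 * Lorentz_norm p' q u <=
  (indicator_constant * a * fine (cap E) `^ p^-1 * fine (mu A) `^ p'^-1)%:E.
Proof.
move=> a0 mA AE bE mu_ uA.
have bA := bounded_subset AE bE.
rewrite -[in leLHS](fineK (cap_fin bE)) poweR_EFin.
apply: le_trans (lee_wpmul2l _ (Lorentz_norm_bounded a0 mA bA mu_ uA)) _.
  by rewrite lee_fin powR_ge0.
by rewrite -EFinM mulrCA mulrA.
Qed.

Lemma bounded_Bspace u A (a : R) : (0 < a)%R -> rV_leb A -> bounded_set A ->
  leb_measurable u -> (forall x, `|u x| <= a%:E * (\1_A x)%:E) -> Bspace u.
Proof.
move=> a0 mA bA mu_ uA.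
have h := block_cost a0 mA (@subset_refl _ A) bA mu_ uA.
pose s := (indicator_constant * a * fine (cap A) `^ p^-1 * fine (mu A) `^ p'^-1)%R.
(* [decomposition_of_norm] asks for a positive cost, and [s] may be 0. *)
have s0 : (0 < Num.max s 1)%R by rewrite lt_max ltr01 orbT.
have h' : cap A `^ p^-1 * Lorentz_norm p' q u <= (Num.max s 1)%:E.
  by apply: (le_trans h); rewrite -/s lee_fin le_max lexx.
have [l [bs [d _]]] := decomposition_of_norm s0 mu_ bA (support_bounded uA) h'.
by split=> //; exists l, bs.
Qed.

Lemma block_bounded_bounded u A E (a : R) : (0 < a)%R -> rV_leb A -> A `<=` E -> bounded_set E ->
  leb_measurable u -> (forall x, `|u x| <= a%:E * (\1_A x)%:E) ->
  (`|L u| <= k * (indicator_constant * a * fine (cap E) `^ p^-1 * fine (mu A) `^ p'^-1))%R.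
Proof.
move=> a0 mA AE bE mu_ uA.
have h := block_cost a0 mA AE bE mu_ uA.
pose s := (indicator_constant * a * fine (cap E) `^ p^-1 * fine (mu A) `^ p'^-1)%R.
rewrite -/s in h *.
have s0 : (0 <= s)%R.
  by rewrite !mulr_ge0 ?powR_ge0 ?(ltW indicator_constant_gt0) ?(ltW a0).
apply/ler_addgt0Pr => e e0.
(* The cost [s] may be 0, so it is enlarged by [d], chosen so that [k d <= e]. *)
pose d := (e / (k + 1))%R.
have d0 : (0 < d)%R by rewrite divr_gt0// ltr_wpDl.
have := hk (ltr_wpDl s0 d0) mu_ bE (subset_trans (support_bounded uA) AE).
have le2 : cap E `^ p^-1 * Lorentz_norm p' q u <= (s + d)%:E.
  by apply: (le_trans h); rewrite lee_fin lerDl ltW.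
move=> /(_ le2) /le_trans; apply; rewrite mulrDr lerD2l /d mulrCA ger_pMr//.
by rewrite ler_pdivrMr ?ltr_wpDl// mul1r lerDl.
Qed.

Definition indic A : 'rV[R]_n -> \bar R := fun x => (\1_A x)%:E.

Lemma measurable_indicl A : rV_leb A -> leb_measurable (indic A).
Proof.
by move=> mA; apply/measurable_EFinP; exact: (@measurable_indic _ rVl R setT A mA).
Qed.

Lemma indic_le A x : `|indic A x| <= 1%:E * (\1_A x)%:E.
Proof. by rewrite mul1e gee0_abs// lee_fin. Qed.

Lemma indic_Bspace A : rV_leb A -> bounded_set A -> Bspace (indic A).
Proof.
by move=> mA bA; exact: (bounded_Bspace ltr01 mA bA (measurable_indicl mA) (indic_le A)).
Qed.

Lemma indic_bound A E : rV_leb A -> A `<=` E -> bounded_set E ->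
  (`|L (indic A)| <= k * indicator_constant * fine (cap E) `^ p^-1 * fine (mu A) `^ p'^-1)%R.
Proof.
move=> mA AE bE.
have := block_bounded_bounded ltr01 mA AE bE (measurable_indicl mA) (@indic_le A).
by rewrite mulr1 !mulrA.
Qed.

(* The factor 2 comes from treating the positive and the negative part separately. *)
Lemma M_norm_lower g : leb_measurable g ->
  (forall A, rV_leb A -> bounded_set A ->
    mu.-integrable A g /\ (L (indic A))%:E = \int[mu]_(x in A) g x) ->
  Mnorm g <= (2 * (k * indicator_constant))%:E.
Proof.
move=> mg hg.
have ic0 : (0 <= k * indicator_constant)%R by rewrite mulr_ge0// ltW// indicator_constant_gt0.
apply: M_norm_le => [|K t cK t0]; first by rewrite mulr_ge0.
have bK : bounded_set K by exact: compact_bounded.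
have mK : rV_leb K by apply: rV_borel_leb; exact: borel_compact.
pose c := (fine (cap K) `^ p^-1)%R.
have c0 : (0 <= c)%R by exact: powR_ge0.
have capE : cap K `^ p^-1 = c%:E by rewrite -[in LHS](fineK (cap_fin bK)) poweR_EFin.
pose W := (k * indicator_constant * c)%R.
have W0 : (0 <= W)%R by rewrite mulr_ge0.
(* On the part [A] of [K] where [h > t], [t mu(A)] is at most the integral of [h], hence at most
   [W mu(A)^(1/p')]; dividing by [mu(A)^(1/p')] leaves [t mu(A)^(1/p) <= W]. *)
have half (h : 'rV[R]_n -> \bar R) : leb_measurable h ->
    (forall A, A `<=` K -> rV_leb A -> \int[mu]_(x in A) h x <= `|L (indic A)|%:E) ->
    mu (K `&` [set x | t%:E < h x]) <= ((W / t) `^ p)%:E.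
  move=> mh hL; set A := K `&` _.
  have mA : rV_leb A.
    by apply: (@measurableI _ rVl) => //; exact: (@measurable_superlevel _ rVl).
  have AK : A `<=` K by move=> x [].
  have h1 : t%:E * mu A <= (W * fine (mu A) `^ p'^-1)%:E.
    apply: (@le_trans _ _ (\int[mu]_(x in A) h x)).
      rewrite -(@integral_cst _ rVl R mu A mA t%:E).
      apply: ge0_le_integral; [exact: mA|by move=> x _; rewrite /= lee_fin ltW|exact: measurable_cst| |].
        exact: (@measurable_funS _ _ rVl _ _ _ _ measurableT (@subsetT _ _) mh).
      by move=> x [_ /ltW].
    apply: le_trans (hL A AK mA) _.
    by rewrite lee_fin; apply: le_trans (indic_bound mA AK bK) _.
  have muA : mu A \is a fin_num by rewrite ge0_fin_numE ?leb_ge0//;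
    apply: lebesgue_lty; exact: bounded_subset bK.
  rewrite -poweR_scale_le ?leb_ge0//.
  have y0 : (0 <= fine (mu A))%R by rewrite fine_ge0// leb_ge0.
  have muE : mu A = (fine (mu A))%:E by rewrite fineK.
  rewrite [X in _ * X `^ _]muE; rewrite [X in _ * X]muE -EFinM lee_fin in h1.
  move: y0 h1; move: (fine (mu A)) => y y0 h1.
  rewrite poweR_EFin -EFinM lee_fin.
  have [->|y1] := eqVneq y 0%R; first by rewrite powR0 ?mulr0.
  have {y0}y1 : (0 < y)%R by rewrite lt0r y1.
  rewrite -(ler_pM2r (powR_gt0 p'^-1 y1)) -mulrA -powRD ?(gt_eqF y1) ?implybT//.
  rewrite (_ : p^-1 + p'^-1 = 1)%R ?powRr1 ?(ltW y1)//.
  by rewrite invfM invrK mulrBr mulr1 mulVf ?gt_eqF// addrC subrK.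
have [gK _] := hg K mK bK.
have hpos A : A `<=` K -> rV_leb A -> \int[mu]_(x in A) g x <= `|L (indic A)|%:E.
  move=> AK mA; have [_ <-] := hg A mA (bounded_subset AK bK).
  by rewrite lee_fin ler_norm.
have hneg A : A `<=` K -> rV_leb A -> \int[mu]_(x in A) (- g x) <= `|L (indic A)|%:E.
  move=> AK mA; have [ig E] := hg A mA (bounded_subset AK bK).
  rewrite (@integralN _ rVl R mu A g); last first.
    exact: (@integrable_add_def _ rVl R mu A mA g ig).
  by rewrite -E lee_fin -normrN ler_norm.
have mng : leb_measurable (fun x => - g x) by exact: measurableT_comp mg.
have h1 := half _ mg hpos; have h2 := half _ mng hneg.
rewrite capE -EFinM (_ : 2 * (k * indicator_constant) * c = 2 * W)%R; last by rewrite -mulrA.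
have W20 : (0 <= 2 * W)%R by exact: mulr_ge0.
have Wt0 : (0 <= W / t)%R by rewrite divr_ge0// ltW.
rewrite (poweR_scale_le p0 W20 t0 (leb_ge0 _)).
apply: (@le_trans _ _ (mu (K `&` [set x | t%:E < g x]) + mu (K `&` [set x | t%:E < - g x]))).
  apply: le_trans (outer_measureU2 (mu_ext (borel_lebesgue_rV R n)) _ _).
  apply: le_leb => x [Kx /=]; rewrite /abse; case E : (g x) => [r| |] /=.
  - rewrite lte_fin real_ltr_normr ?num_real// => /orP[h|h]; [left|right]; split => //=; rewrite E lte_fin//.
  - by left; split => //=; rewrite E.
  - by right; split => //=; rewrite E.
apply: (le_trans (leeD h1 h2)); rewrite -EFinD lee_fin -[(2 * W / t)%R]mulrA (powRM p (ler0n _ _) Wt0).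
have <- : (2 * (W / t) `^ p = (W / t) `^ p + (W / t) `^ p)%R by rewrite mulr_natl mulr2n.
apply: ler_wpM2r; first exact: powR_ge0.
(* [2 <= 2^p] because [p > 1]. *)
by rewrite -[leLHS]powRr1//; apply: ler_powR; [rewrite ler1n|exact: ltW].
Qed.

Lemma clf_indicU A B : rV_leb A -> rV_leb B -> bounded_set A -> bounded_set B ->
  A `&` B = set0 -> L (indic (A `|` B)) = (L (indic A) + L (indic B))%R.
Proof.
move=> mA mB bA bB AB; have [_ lin _] := Lc.
have := lin 1%R _ _ (indic_Bspace mA bA) (indic_Bspace mB bB).
rewrite mul1r => <-; congr L; apply/funext => x; rewrite mul1e /indic !indicE.
rewrite in_setU; case: (boolP (x \in A)) => xA; case: (boolP (x \in B)) => xB //=; last first.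
- by rewrite adde0.
- by rewrite add0e.
- by rewrite adde0.
- have : (A `&` B) x by split; exact: set_mem.
  by rewrite AB.
Qed.

(** On indicators [L] is bounded by a multiple of [mu(A)^(1/p')], which is the domination that
    yields a density. *)
Lemma density_on_box N : exists g, mu.-integrable [set: rVl] g /\
  forall A, rV_leb A -> A `<=` box N -> (L (indic A))%:E = \int[mu]_(x in A) g x.
Proof.
have mbox := borel_box_leb N.
have bbox := @bounded_box R n N.
pose D := (k * indicator_constant * fine (cap (box N)) `^ p^-1)%R.
have p'V0 : (0 < p'^-1)%R by rewrite invr_gt0.
have [||g [ig gE]] := @dominated_additive_density _ rVl R mu
  (fun A => L (indic (A `&` box N))) (box N) D _ p'V0 mbox (leb_box_lty R n N).
- move=> A B mA mB AB; rewrite -clf_indicU.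
  + by rewrite setIUl.
  + exact: (@measurableI _ rVl).
  + exact: (@measurableI _ rVl).
  + by apply: bounded_subset bbox.
  + by apply: bounded_subset bbox.
  + by rewrite setIACA AB set0I.
- move=> A mA; apply: indic_bound => //.
  exact: (@measurableI _ rVl).
- by exists g; split=> // A mA AN; rewrite -gE//; congr (L (indic _))%:E; apply/esym/setIidl.
Qed.

(** [g] is taken from the N-th density on the N-th shell between consecutive boxes, so the densities
    need not agree pointwise on overlaps; a set in a larger box is cut along the shells, and finite
    additivity of [L] restores the formula. *)
Lemma density : exists2 g, leb_measurable g & forall A, rV_leb A -> bounded_set A ->
  mu.-integrable A g /\ (L (indic A))%:E = \int[mu]_(x in A) g x.
Proof.
have /choice[gs gsP] := density_on_box.
pose S := seqD (@box R n).
have ndb : nondecreasing_seq (@box R n) by move=> i j ij; exact/subsetPset/box_mono.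
have Sbox N : S N `<=` box N by case: N => [|N] x // [].
have mS N : rV_leb (S N).
  by case: N => [|N]; [exact: borel_box_leb|apply: (@measurableD _ rVl); exact: borel_box_leb].
have US : \bigcup_k S k = setT by rewrite /S eq_bigcup_seqD box_cover.
have [g mg gE] := @measurable_glue _ _ rVl _ S gs mS (trivIset_seqD ndb) US
  (fun N => measurable_int _ (gsP N).1).
exists g => //.
have layer N A : rV_leb A -> A `<=` S N ->
    mu.-integrable A g /\ (L (indic A))%:E = \int[mu]_(x in A) g x.
  move=> mA AS; have [igs gsE] := gsP N; split.
    apply: (@eq_integrable _ rVl R mu A mA (gs N)).
      by move=> x /set_mem /AS /gE.
    exact: (@integrableS _ rVl R mu setT A _ measurableT mA (@subsetT _ _) igs).
  rewrite gsE//; last by move=> x /AS /Sbox.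
  by apply: eq_integral => x /set_mem /AS /gE.
suff H N A : rV_leb A -> A `<=` box N ->
    mu.-integrable A g /\ (L (indic A))%:E = \int[mu]_(x in A) g x.
  by move=> A mA /bounded_subset_box[N]; exact: H.
elim: N A => [|N IH] A mA AN; first exact: (layer 0%N).
have mA1 : rV_leb (A `&` box N) by apply: (@measurableI _ rVl) => //; exact: borel_box_leb.
have mA2 : rV_leb (A `\` box N) by apply: (@measurableD _ rVl) => //; exact: borel_box_leb.
have [i1 E1] := IH _ mA1 (@subIsetr _ _ _).
have [|i2 E2] := layer N.+1 _ mA2; first by move=> x [/AN].
have dj : (A `&` box N) `&` (A `\` box N) = set0 by apply/seteqP; split => // x [[_ ?] []].
have AE : A = (A `&` box N) `|` (A `\` box N) by rewrite setUIDK.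
have bA : bounded_set A by exact: bounded_subset (@bounded_box R n N.+1).
rewrite AE; split; first exact: (@integrable_setU _ rVl).
rewrite clf_indicU//.
- rewrite EFinD E1 E2; apply/esym; apply: (@integral_setU _ rVl R mu).
  + exact: mA1.
  + exact: mA2.
  + exact: (@measurable_funS _ _ rVl _ _ _ _ measurableT (@subsetT _ _) mg).
  + by apply/disj_setPS; rewrite dj.
- by apply: bounded_subset bA => x [].
- by apply: bounded_subset bA => x [].
Qed.

(** * Functionals that vanish on indicators *)

Section vanishing.
Hypothesis Lz : forall A, rV_leb A -> bounded_set A -> L (indic A) = 0%R.

(* Subtracting [a/2] on {u >= 0} and adding it on {u < 0} halves the bound [a]
   without changing [L u]. *)
Lemma clf_vanish_bounded u A (a : R) : (0 < a)%R -> rV_leb A -> bounded_set A ->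
  leb_measurable u -> (forall x, `|u x| <= a%:E * (\1_A x)%:E) -> L u = 0%R.
Proof.
move=> a0 mA bA mu_ uA.
pose D := (k * (indicator_constant * fine (cap A) `^ p^-1 * fine (mu A) `^ p'^-1))%R.
have D0 : (0 <= D)%R.
  by rewrite mulr_ge0// mulr_ge0 ?powR_ge0// mulr_ge0 ?powR_ge0// ltW// indicator_constant_gt0.
have [_ lin _] := Lc.
(* [D] does not depend on [j], so [j] halvings of the bound give [|L v| <= D c / 2^j]. *)
have H j : forall v (c : R), (0 < c)%R -> leb_measurable v ->
    (forall x, `|v x| <= c%:E * (\1_A x)%:E) -> (`|L v| * 2 ^+ j <= D * c)%R.
  elim: j => [|j IH] v c c0 mv vA.
    rewrite mulr1; apply: le_trans (block_bounded_bounded c0 mA (@subset_refl _ A) bA mv vA) _.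
    by rewrite /D le_eqVlt; apply/orP; left; apply/eqP; ring.
  have mP : rV_leb (A `&` [set x | 0 <= v x]).
    apply: (@measurableI _ rVl) => //; rewrite -[X in _.-measurable X](@setTI rVl).
    by apply: emeasurable_fun_c_infty => //; exact: mv.
  have mN : rV_leb (A `&` [set x | v x < 0]).
    apply: (@measurableI _ rVl) => //; rewrite -[X in _.-measurable X](@setTI rVl).
    by apply: emeasurable_fun_infty_o => //; exact: mv.
  have bP : bounded_set (A `&` [set x | 0 <= v x]) by apply: bounded_subset bA => x [].
  have bN : bounded_set (A `&` [set x | v x < 0]) by apply: bounded_subset bA => x [].
  have BP := indic_Bspace mP bP; have BN := indic_Bspace mN bN.
  have Bv := bounded_Bspace c0 mA bA mv vA.
  pose w1 := fun x => (c / 2)%:E * indic (A `&` [set x | v x < 0]) x + v x.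
  pose w := fun x => (- (c / 2))%:E * indic (A `&` [set x | 0 <= v x]) x + w1 x.
  have mw1 : leb_measurable w1.
    apply: emeasurable_funD; last exact: mv.
    by apply: measurable_funeM; exact: measurable_indicl.
  have mw : leb_measurable w.
    apply: emeasurable_funD; last exact: mw1.
    by apply: measurable_funeM; exact: measurable_indicl.
  have c20 : (0 < c / 2)%R by rewrite divr_gt0.
  have wA x : `|w x| <= (c / 2)%:E * (\1_A x)%:E.
    have := vA x; rewrite /w /w1 /indic !indicE !in_setI.
    case: (boolP (x \in A)) => xA /=; last first.
      by rewrite !mule0 !add0e.
    rewrite !mule1; case E : (v x) => [y| |]//=.
    rewrite !lee_fin => yc.
    have -> : (x \in [set x | 0 <= v x]) = (0 <= y)%R.
      by apply/idP/idP => [/set_mem|h]; [|apply/mem_set]; rewrite /= E lee_fin.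
    have -> : (x \in [set x | v x < 0]) = (y < 0)%R.
      by apply/idP/idP => [/set_mem|h]; [|apply/mem_set]; rewrite /= E lte_fin.
    move: yc; rewrite !ler_norml => /andP[y1 y2].
    by case: (leP 0%R y) => y0 /=; apply/andP; split; lra.
  (* Linearity is applied to two functions at a time, so the intermediate [w1] must lie in the space
     as well; a crude bound suffices. *)
  have Bw1 : Bspace w1.
    apply: (@bounded_Bspace w1 A (c / 2 + c)%R) => //; first by rewrite addr_gt0.
    move=> x; apply: le_trans (lee_abs_add _ _) _.
    rewrite EFinD muleDl ?fin_num_adde_defl//; apply: leeD => //.
    rewrite abseM /indic !gee0_abs ?lee_fin ?(ltW c20)//; apply: ler_wpM2l; first exact: ltW.
    by rewrite !indicE in_setI; case: (x \in A) => //=; rewrite lern1 leq_b1.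
  have Lw : L w = L v.
    by rewrite /w lin// Lz// mulr0 add0r /w1 lin// Lz// mulr0 add0r.
  have := IH w _ c20 mw wA; rewrite Lw exprS => h.
  by rewrite mulrCA mulrC -ler_pdivlMr// -mulrA.
apply/eqP; rewrite -normr_eq0; apply/eqP/le_anti; rewrite normr_ge0 andbT.
rewrite leNgt; apply/negP => L0.
pose j := Num.bound (D * a / `|L u|)%R.
have := @upper_nthrootP R (D * a / `|L u|)%R j (leqnn _).
by rewrite ltr_pdivrMr// ltNge [X in ~~ (X <= _)%R]mulrC H.
Qed.

Lemma block_Bspace b : block b -> Bspace b.
Proof.
move=> bb; have [d _] := decomposition_block 1%R bb; split; first by have [] := bb.
exists (fun k => if k == 0%N then 1%R else 0%R), (fun=> b).
by move: d; rewrite (_ : (fun x => 1 * b x) = b)//; apply/funext => x; rewrite mul1e.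
Qed.

(** [b] is split at height [j]: [L] already vanishes on the bounded part [t], and the part [h] above
    [j] has a small Lorentz integral, hence a small block cost. *)
Lemma clf_vanish_block b : block b -> L b = 0%R.
Proof.
move=> bb; have Joo := block_lorentz_lty bb; have [mb [E [bE sE _]]] := bb.
have [_ lin _] := Lc.
have mS : rV_leb [set x | b x != 0].
  by rewrite /rV_leb -[X in measurable X](@setTI rVl); apply: emeasurable_neq => //; exact: mb.
have bS : bounded_set [set x | b x != 0] by exact: bounded_subset bE.
pose W := (fine (cap E) `^ p^-1 * p' `^ q^-1)%R.
have W0 : (0 <= W)%R by rewrite mulr_ge0 ?powR_ge0.
(* [W e] bounds the cost of the tall part of [b]; the extra [e] makes the bound positive when
   [W = 0]. *)
have H (e : R) : (0 < e)%R -> (`|L b| <= k * (W * e + e))%R.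
  (* The Lorentz integral of the tall part is made at most [e^q], so that its q-th root is at most
     [e]. *)
  move=> e0; have eq0 : (0 < e `^ q)%R by exact: powR_gt0.
  have [j hj] := @lorentz_integral_truncation _ rVl R mu p' q b _ p'0 q0 q1 mb Joo eq0.
  set h := superlevel_restr b j in hj.
  have mh : leb_measurable h := @measurable_superlevel_restr _ rVl R b j mb.
  pose t x := b x * (\1_[set x | (`|b x| <= j%:R%:E)%E] x)%:E.
  have mt : leb_measurable t.
    apply: emeasurable_funM; first exact: mb.
    apply/measurable_EFinP; apply: (@measurable_indic _ rVl).
    rewrite (_ : [set x | _] = ~` [set x | j%:R%:E < `|b x|]).
      by apply: (@measurableC _ rVl); apply: (@measurable_superlevel _ rVl); exact: measurableT_comp.
    by apply/seteqP; split => x /=; rewrite leNgt => /negP.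
  (* [j + 1] instead of [j], because a positive bound is required. *)
  have tA x : `|t x| <= j.+1%:R%:E * (\1_[set x | (b x != 0)%E] x)%:E.
    rewrite /t !indicE; case: (boolP (x \in [set x | (b x != 0)%E])) => bx; last first.
      have -> : b x = 0 by apply/eqP; apply: contraNT bx => bx; exact: mem_set.
      by rewrite mul0e abse0 mule0.
    rewrite mule1; case: (boolP (x \in _)) => [/set_mem /= bj|_].
      by rewrite mule1; apply: (le_trans bj); rewrite lee_fin ler_nat.
    by rewrite mule0 abse0 lee_fin.
  have bt x : b x = 1%:E * h x + t x.
    rewrite mul1e /h /superlevel_restr /t !indicE.
    have [bj|bj] := leP `|b x| j%:R%:E.
      rewrite memNset/=; last by apply/negP; rewrite -leNgt.
      by rewrite mem_set//= mule0 add0e mule1.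
    by rewrite mem_set//= memNset/= ?mule0 ?adde0 ?mule1//; apply/negP; rewrite -ltNge.
  have hE : [set x | h x != 0] `<=` E.
    move=> x /= hx; apply: sE => /=; apply: contraNneq hx.
    by rewrite /h /superlevel_restr => ->; rewrite mul0e.
  have We0 : (0 < W * e + e)%R by rewrite ltr_wpDl// mulr_ge0// ltW.
  have le : cap E `^ p^-1 * Lorentz_norm p' q h <= (W * e + e)%:E.
    rewrite -[X in X `^ _](fineK (cap_fin bE)) poweR_EFin Lorentz_normE muleA -EFinM.
    apply: (@le_trans _ _ (W * e)%:E); last by rewrite lee_fin lerDl ltW.
    rewrite [leRHS]EFinM; apply: lee_wpmul2l; first by rewrite lee_fin.
    have -> : e%:E = (e `^ q)%:E `^ q^-1.
      by rewrite poweR_EFin -powRrM mulfV ?gt_eqF// powRr1// ltW.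
    apply: gt0_ler_poweR; rewrite ?in_itv/= ?leey ?andbT ?lorentz_integral_ge0//.
      by rewrite invr_ge0 ltW.
    by rewrite lee_fin ltW.
  have Bh : Bspace h.
    have [l [bs [d _]]] := decomposition_of_norm We0 mh bE hE le.
    by split=> //; exists l, bs.
  have Bt : Bspace t := bounded_Bspace (ltr0Sn _ _) mS bS mt tA.
  have Lt : L t = 0%R := clf_vanish_bounded (ltr0Sn _ _) mS bS mt tA.
  have -> : L b = L h.
    by rewrite (_ : b = (fun x => 1%:E * h x + t x)) ?lin ?Lt ?addr0 ?mul1r//; exact/funext.
  exact: hk We0 mh bE hE le.
apply/eqP; rewrite -normr_eq0; apply/eqP/le_anti; rewrite normr_ge0 andbT.
apply/ler_addgt0Pr => e e0; rewrite add0r.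
have kW0 : (0 < k * (W + 1) + 1)%R by rewrite ltr_wpDl// mulr_ge0// addr_ge0.
apply: le_trans (H (e / (k * (W + 1) + 1))%R (divr_gt0 e0 kW0)) _.
rewrite (_ : k * _ = k * (W + 1) * (e / (k * (W + 1) + 1)))%R; last by ring.
rewrite mulrCA ger_pMr// ler_pdivrMr// mul1r lerDl ler01//.
Qed.

(** Subtracting the first term is legitimate a.e., namely where the block [bs 0] is finite. *)
Lemma decomposition_behead f lambda bs : decomposition f lambda bs ->
  decomposition (fun x => (- lambda 0%N)%:E * bs 0%N x + f x)
    (fun j => lambda j.+1) (fun j => bs j.+1).
Proof.
move=> [loo bbs fE]; split=> [|j|]; last 2 first.
- exact: bbs.
- apply: (@filterS2 _ _ (leb_ae_filter R n) _ _ _ _ fE (B_ae_fin (block_Bspace (bbs 0%N)))).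
  move=> x fx b0.
  have E N : \sum_(j < N) (lambda j.+1)%:E * bs j.+1 x =
      (- lambda 0%N)%:E * bs 0%N x + \sum_(j < N.+1) (lambda j)%:E * bs j x.
    rewrite big_ord_recl/= addeA EFinN mulNe.
    have lb : (lambda 0%N)%:E * bs 0%N x \is a fin_num by rewrite fin_numM.
    by rewrite [X in X + _]addeC subee// add0e.
  rewrite (_ : (fun N => _) = (fun N => (- lambda 0%N)%:E * bs 0%N x +
      \sum_(j < N.+1) (lambda j)%:E * bs j x)); last exact/funext.
  apply: cvgeD; [|exact: cvg_cst|].
  + by rewrite fin_num_adde_defr// fin_numM.
  + by rewrite (cvg_shiftS (fun N => \sum_(j < N) (lambda j)%:E * bs j x)); exact: fx.
- apply: le_lt_trans loo; rewrite [leRHS]nneseries_recl//.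
  rewrite -(nneseries_addn 1 (f := fun j => `|lambda j|%:E))//.
  rewrite (eq_eseriesr (f := fun j => `|lambda (j + 1)%N|%:E) (g := fun j => `|lambda j.+1|%:E)).
    by rewrite leeDr// lee_fin.
  by move=> j _; rewrite addn1.
Qed.

(** Removing the first term of a decomposition leaves the value of [L] unchanged, so [|L f|] is
    bounded by a fixed multiple of the cost of every tail. *)
Lemma clf_vanish f : Bspace f -> L f = 0%R.
Proof.
have [K K0 hK] := clf_bound; have [_ lin _] := Lc.
have H N : forall f lambda bs, leb_measurable f -> decomposition f lambda bs ->
    `|L f|%:E <= K%:E * \sum_(N <= j <oo) `|lambda j|%:E.
  elim: N => [|N IH] g l bs mg d; first exact: hK d.
  have [_ bbs _] := d.
  have B0 := block_Bspace (bbs 0%N); have [m0 _] := B0.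
  have Bg : Bspace g by split=> //; exists l, bs.
  have d' := decomposition_behead d.
  have mg' : leb_measurable (fun x => (- l 0%N)%:E * bs 0%N x + g x).
    by apply: emeasurable_funD; [apply: measurable_funeM; exact: m0|exact: mg].
  have := IH _ _ _ mg' d'; rewrite lin// clf_vanish_block// mulr0 add0r.
  move=> /le_trans; apply; apply: lee_wpmul2l; first by rewrite lee_fin ltW.
  rewrite -(nneseries_addn N (f := fun j => `|l j.+1|%:E))//.
  rewrite -(nneseries_addn N.+1 (f := fun j => `|l j|%:E))//.
  rewrite le_eqVlt; apply/orP; left; apply/eqP.
  by apply: eq_eseriesr => j _; rewrite -addnS.
move=> [mf [l [bs d]]]; have [loo _ _] := d.
have cv : K%:E * \sum_(N <= j <oo) `|l j|%:E @[N --> \oo] --> K%:E * 0.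
  by apply: cvgeZl => //; apply: nneseries_tail_cvg.
have : `|L f|%:E <= K%:E * 0.
  rewrite -(cvg_lim _ cv)//; apply: lime_ge; first by apply/cvg_ex; eexists; exact: cv.
  by apply: nearW => N; exact: H d.
by rewrite mule0 lee_fin normr_le0 => /eqP.
Qed.

End vanishing.

End bounded.

End functional.

(** * Identification of the dual *)

Lemma clf_sub L1 L2 : continuous_linear_functional Bspace Bnorm L1 ->
  continuous_linear_functional Bspace Bnorm L2 ->
  continuous_linear_functional Bspace Bnorm (fun f => L1 f - L2 f)%R.
Proof.
move=> [ae1 lin1 c1] [ae2 lin2 c2]; split.
- by move=> f g Bf Bg fg; rewrite (ae1 _ _ Bf Bg fg) (ae2 _ _ Bf Bg fg).
- by move=> a f g Bf Bg; rewrite lin1// lin2//; ring.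
- move=> f Bf e e0; have e20 : (0 < e / 2)%R by rewrite divr_gt0.
  have [d1 d10 h1] := c1 f Bf _ e20; have [d2 d20 h2] := c2 f Bf _ e20.
  exists (Num.min d1 d2); first by rewrite lt_min d10.
  move=> g Bg; rewrite EFin_min lt_min => /andP[gd1 gd2].
  have := ltrD (h1 g Bg gd1) (h2 g Bg gd2); rewrite -splitr; apply: le_lt_trans.
  rewrite (_ : L1 g - L2 g - (L1 f - L2 f) = (L1 g - L1 f) - (L2 g - L2 f))%R; last by ring.
  exact: ler_normB.
Qed.

Lemma represents_indic L g A : represents Bspace L g -> rV_leb A -> bounded_set A ->
  (L (indic A))%:E = \int[mu]_(x in A) g x.
Proof.
move=> rL mA bA; have BA : Bspace (indic A).
  apply: (bounded_Bspace ltr01 mA bA (measurable_indicl mA) (indic_le A)).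
have [_ ->] := rL _ BA; rewrite [RHS]integral_mkcond; apply: eq_integral => x _.
rewrite /indic patchE indicE; case: (x \in A); first by rewrite mul1e.
by rewrite mul0e.
Qed.

Lemma M_norm_bound g : Mnorm g < +oo -> exists2 m : R, (0 <= m)%R & Mnorm g <= m%:E.
Proof.
move=> goo; exists (Num.max 0 (fine (Mnorm g)))%R; first by rewrite le_max lexx.
case: (Mnorm g) goo => [r| |]//=; first by rewrite lee_fin le_max lexx orbT.
by rewrite leNye.
Qed.

Lemma clf_representable L : continuous_linear_functional Bspace Bnorm L ->
  exists2 g, Mspace g & represents Bspace L g.
Proof.
move=> Lc; have [k k0 hk] := clf_block_bounded Lc.
have [g mg hg] := density Lc (ltW k0) hk.
have gM := M_norm_lower (ltW k0) hk mg hg.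
set m := (2 * (k * indicator_constant))%R in gM.
have m0 : (0 <= m)%R.
  by rewrite mulr_ge0// mulr_ge0// ltW// indicator_constant_gt0.
have rg := pairing_represents m0 mg gM.
exists g; first by split=> //; apply: le_lt_trans gM _; rewrite ltry.
move=> f Bf; have [ifg pE] := rg f Bf; split=> //; rewrite -pE; congr (_%:E).
apply/eqP; rewrite -subr_eq0; apply/eqP.
(* The difference of [L] and the pairing with [g] is continuous and, by the choice of [g], zero on
   indicators. *)
have Dc := clf_sub Lc (pairing_clf m0 mg gM).
have [k' k'0 hk'] := clf_block_bounded Dc.
apply: (clf_vanish Dc (ltW k'0) hk' _ Bf) => A mA bA.
have [_ E] := hg A mA bA; have := represents_indic rg mA bA; rewrite -E => -[->].
by rewrite subrr.
Qed.

(** Both functions are integrable on each box and, tested on indicators, have the same integrals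
    over its measurable subsets. *)
Lemma represents_unique L g g' : Mspace g -> Mspace g' -> represents Bspace L g ->
  represents Bspace L g' -> g' = g %[ae mu].
Proof.
move=> [mg goo] [mg' g'oo] rg rg'.
have [m m0 gm] := M_norm_bound goo; have [m' m'0 gm'] := M_norm_bound g'oo.
apply: ae_box => N.
have mbox := borel_box_leb N.
suff H : ae_eq mu (box N : set rVl) g' g.
  by apply: (@filterS _ _ (leb_ae_filter R n)) H => x xE /xE.
apply: (@integral_ae_eq _ rVl R mu (box N) mbox g g').
- exact: M_integrable_bounded m'0 mg' gm' mbox (@bounded_box R n N).
- exact: (@measurable_funS _ _ rVl _ _ _ _ measurableT (@subsetT _ _) mg).
- move=> A AN mA; have bA := bounded_subset AN (@bounded_box R n N).
  by rewrite -(represents_indic rg mA bA) -(represents_indic rg' mA bA).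
Qed.

Lemma cap_box1_neq0 : cap (box 1) != 0.
Proof.
apply/eqP => /mu_cap0; rewrite (leb_box R n 1) => -[] /eqP.
by rewrite expf_eq0 -mulr_natl mulr1 pnatr_eq0 andbF.
Qed.

Lemma B_norm_zero : Bnorm (fun=> 0) <= 0.
Proof.
have [_ [l [bs [_ bbs _]]]] := B_zero.
have [d s] := decomposition_block 0%R (bbs 0%N).
move: d s; rewrite (_ : (fun x => _) = (fun=> 0)) ?normr0 => [d s|]; last first.
  by apply/funext => x; rewrite mul0e.
rewrite -[leRHS]s.
by apply: ereal_inf_lbound; eexists; [exists (fun=> bs 0%N); exact: d|].
Qed.

Lemma functional_norm_ge0 L : 0 <= functional_norm Bspace Bnorm L.
Proof.
apply: (@le_trans _ _ `|L (fun=> 0)|%:E); first by rewrite lee_fin.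
apply: ereal_sup_ubound; exists (fun=> 0) => //; split; first exact: B_zero.
by apply: le_trans B_norm_zero _; rewrite lee_fin.
Qed.

Lemma functional_norm_upper L g (m : R) : (0 <= m)%R -> leb_measurable g -> Mnorm g <= m%:E ->
  represents Bspace L g -> functional_norm Bspace Bnorm L <= (p' * m)%:E.
Proof.
move=> m0 mg gm rL; apply: ge_ereal_sup => _ [f [Bf f1] <-].
apply: le_trans (represents_bound m0 mg gm rL Bf) _.
by rewrite -[leRHS]mule1; apply: lee_wpmul2l => //; rewrite lee_fin mulr_ge0// ltW.
Qed.

Lemma M_norm_upper L g (k : R) : continuous_linear_functional Bspace Bnorm L ->
  Mspace g -> represents Bspace L g -> (0 <= k)%R -> functional_norm Bspace Bnorm L <= k%:E ->
  Mnorm g <= (2 * (k * indicator_constant))%:E.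
Proof.
move=> Lc [mg goo] rL k0 Lk; have [m m0 gm] := M_norm_bound goo.
apply: (M_norm_lower k0 (functional_norm_block_bounded Lc Lk) mg) => A mA bA; split.
  exact: M_integrable_bounded gm mA bA.
exact: represents_indic.
Qed.

Lemma block_space_dual : dual_identified_with Bspace Bnorm Mspace Mnorm.
Proof.
split.
- move=> L Lc; have [g Mg rg] := clf_representable Lc; exists g; split=> // g' Mg' rg'.
  exact: represents_unique rg rg'.
- move=> g [mg goo]; have [m m0 gm] := M_norm_bound goo.
  by exists (pairing g); [exact: pairing_clf gm|exact: pairing_represents gm].
(* [p'] serves to bound the functional by [g], [2 * indicator_constant] to bound [g] by the
   functional. *)
pose c := (Num.max p' (2 * indicator_constant))%R.
have c0 : (0 < c)%R by rewrite lt_max p'0.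
have Mnorm0 g : 0 <= Mnorm g.
  by apply: M_norm_ge0; exists (box 1); [exact: compact_box|exact: cap_box1_neq0].
exists c => // L g Lc Mg rL; have [mg goo] := Mg.
have F0 := functional_norm_ge0 L; split.
  rewrite lee_pdivrMl//; have [->|Foo] := eqVneq (functional_norm Bspace Bnorm L) +oo.
    by rewrite gt0_muley ?leey// lte_fin.
  have Ffin : functional_norm Bspace Bnorm L \is a fin_num by rewrite ge0_fin_numE// ltey.
  have f0 : (0 <= fine (functional_norm Bspace Bnorm L))%R by exact: fine_ge0.
  have FE : functional_norm Bspace Bnorm L = (fine (functional_norm Bspace Bnorm L))%:E.
    by rewrite fineK.
  have := M_norm_upper Lc Mg rL f0; rewrite -FE => /(_ (lexx _)) /le_trans; apply.
  rewrite [leRHS](_ : _ = (c * fine (functional_norm Bspace Bnorm L))%:E); last by rewrite EFinM -FE.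
  by rewrite lee_fin mulrCA mulrC ler_wpM2r// le_max lexx orbT.
have gfin : Mnorm g \is a fin_num by rewrite ge0_fin_numE.
have g0 : (0 <= fine (Mnorm g))%R by exact: fine_ge0.
have gE : Mnorm g = (fine (Mnorm g))%:E by rewrite fineK.
have gle : Mnorm g <= (fine (Mnorm g))%:E by rewrite -gE.
apply: le_trans (functional_norm_upper g0 mg gle rL) _.
rewrite [leRHS](_ : _ = (c * fine (Mnorm g))%:E); last by rewrite EFinM -gE.
by rewrite lee_fin ler_wpM2r// le_max lexx.
Qed.

End capacity_spaces.

Local Close Scope ereal_scope.

Theorem theorem1p9 (R : realType) (n : nat) (alpha s : R)
  (halpha : 0 < alpha) (hs1 : 1 < s) (hs2 : s <= n%:R / alpha)
  (G : 'rV[R]_n -> \bar R) (hG : is_Bessel_kernel alpha G)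
  (p p' q : R) (hp : 1 < p) (hp' : p' = p / (p - 1)) (hq0 : 0 < q) (hq1 : q <= 1) :
  dual_identified_with
    (B_space (capacity G s) p p' q) (B_norm (capacity G s) p p' q)
    (M_space (capacity G s) p) (M_norm (capacity G s) p).
Proof.
have [C C0 mu_le] := leb_le_capacity hs1 hG.1.
rewrite hp'; apply: (block_space_dual (C := C)) => //.
- by move=> E; exact: capacity_ge0.
- by move=> E F; exact: le_capacity.
- by move=> E; exact: (capacity_bounded hs1 hG).
Qed.
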